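(* Let $T(t,\tau)$ be an evolution family on a Banach space $X$ which admits a polynomial dichotomy with respect to a family of norms $\|\cdot\|_t$, with projections $P(t)$, $Q(t)=\mathrm{Id}-P(t)$. Put $Z=\operatorname{Im}Q(1)$. Then for each $y\in Y_1$ there exists a unique $x\in Y_Z$ such that $$x(t)=T(t,\tau)x(\tau)+\int_\tau^t \frac{1}{s}T(t,s)y(s)\,ds\quad\text{for all } t\ge\tau\ge1.$$
   Context: Let $X$ be a Banach space with norm $\|\cdot\|$. An evolution family is a family of bounded linear operators $T(t,\tau)$ on $X$, $t\ge\tau\ge1$, such that $T(t,t)=\mathrm{Id}$ for $t\ge1$, $T(t,s)T(s,\tau)=T(t,\tau)$ for $t\ge s\ge\tau\ge1$, and for each $\tau\ge1$ and $x\in X$ the map $s\mapsto T(s,\tau)x$ is continuous on $[\tau,\infty)$. A family of norms $\|\cdot\|_t$, $t\ge1$, on $X$ is always assumed to satisfy: (i) there exist $C>0$ and $\epsilon\ge0$ with $\|x\|\le\|x\|_\tau\le C\tau^\epsilon\|x\|$ for all $x\in X$, $\tau\ge1$; (ii) $t\mapsto\|x\|_t$ is measurable for each $x\in X$. $T(t,\tau)$ admits a polynomial dichotomy with respect to $\|\cdot\|_t$ if: there are projections $P(t)$, $t\ge1$, with $P(t)T(t,\tau)=T(t,\tau)P(\tau)$ for $t\ge\tau\ge1$ such that $T(t,\tau)|_{\ker P(\tau)}:\ker P(\tau)\to\ker P(t)$ is invertible for all $t\ge\tau\ge1$; and there are $\lambda,D>0$ such that for all $x\in X$, $t,\tau\ge1$: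 $\|T(t,\tau)P(\tau)x\|_t\le D(t/\tau)^{-\lambda}\|x\|_\tau$ for $t\ge\tau$, and $\|T(t,\tau)Q(\tau)x\|_t\le D(\tau/t)^{-\lambda}\|x\|_\tau$ for $t\le\tau$, where $Q(t)=\mathrm{Id}-P(t)$ and for $t<\tau$, $T(t,\tau)=(T(\tau,t)|_{\ker P(t)})^{-1}:\ker P(\tau)\to\ker P(t)$. Function spaces: $Y$ is the Banach space of continuous $x:[1,\infty)\to X$ with $\|x\|_\infty:=\sup_{t\ge1}\|x(t)\|_t<\infty$. For a closed subspace $Z\subset X$, $Y_Z=\{x\in Y: x(1)\in Z\}$; $Y_0=Y_{\{0\}}$. $Y_1$ is the Banach space of locally (Bochner) integrable $x:[1,\infty)\to X$ (identified when equal a.e.) with $\|x\|_L:=\sup_{t\ge1}\int_t^{t+1}\|x(s)\|_s\,ds<\infty$. *)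

(* Defs.v *)
From Stdlib Require Import Reals Lra.
Open Scope R_scope.
Set Implicit Arguments.

Record Banach := mkBanach {
  bcar :> Type;
  bzero : bcar;
  badd : bcar -> bcar -> bcar;
  bopp : bcar -> bcar;
  bscal : R -> bcar -> bcar;
  bnorm : bcar -> R;
  badd_assoc : forall x y z, badd x (badd y z) = badd (badd x y) z;
  badd_comm : forall x y, badd x y = badd y x;
  badd_0 : forall x, badd x bzero = x;
  badd_opp : forall x, badd x (bopp x) = bzero;
  bscal_1 : forall x, bscal 1 x = x;
  bscal_assoc : forall a b x, bscal a (bscal b x) = bscal (a * b) x;
  bscal_distr_l : forall a x y, bscal a (badd x y) = badd (bscal a x) (bscal a y);
  bscal_distr_r : forall a b x, bscal (a + b) x = badd (bscal a x) (bscal b x);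
  bnorm_nonneg : forall x, 0 <= bnorm x;
  bnorm_eq0 : forall x, bnorm x = 0 -> x = bzero;
  bnorm_scal : forall a x, bnorm (bscal a x) = Rabs a * bnorm x;
  bnorm_triangle : forall x y, bnorm (badd x y) <= bnorm x + bnorm y;
  bcomplete : forall u : nat -> bcar,
    (forall eps, 0 < eps -> exists N, forall n m, (N <= n)%nat -> (N <= m)%nat ->
        bnorm (badd (u n) (bopp (u m))) < eps) ->
    exists l, forall eps, 0 < eps -> exists N, forall n, (N <= n)%nat ->
        bnorm (badd (u n) (bopp l)) < eps
}.

Arguments bzero {_}.
Arguments badd {_}.
Arguments bopp {_}.
Arguments bscal {_}.
Arguments bnorm {_}.

Definition bdist {X : Banach} (x y : X) : R := bnorm (badd x (bopp y)).

Fixpoint psum {V : Type} (z : V) (add : V -> V -> V) (u : nat -> V) (n : nat) : V :=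
  match n with
  | O => z
  | S m => add (psum z add u m) (u m)
  end.

Definition sums_to {V : Type} (z : V) (add : V -> V -> V) (dist : V -> V -> R)
  (u : nat -> V) (w : V) : Prop :=
  forall eps, 0 < eps -> exists N, forall n, (N <= n)%nat -> dist (psum z add u n) w < eps.

Definition rseries_bounded (u : nat -> R) : Prop :=
  exists M, forall n, psum 0 Rplus u n <= M.

Definition ind (c d s : R) : R :=
  if Rle_dec c s then (if Rle_dec s d then 1 else 0) else 0.

(** * Lebesgue / Bochner integral (Mikusinski's definition via brick series).
   [IntGen ... f a b v] : f is Lebesgue (Bochner) integrable on [a,b] with
   integral v: there are bricks w_k * 1_[c_k,d_k] in [a,b] with
   sum (d_k-c_k) |w_k| < oo, f(s) = sum_k 1_[c_k,d_k](s) w_k at every interior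
   point s where sum_k 1_[c_k,d_k](s) |w_k| < oo, and v = sum_k (d_k-c_k) w_k. *)
Definition IntGen {V : Type} (z : V) (add : V -> V -> V) (scal : R -> V -> V)
  (nrm : V -> R) (dist : V -> V -> R) (f : R -> V) (a b : R) (v : V) : Prop :=
  a <= b /\
  exists (c d : nat -> R) (w : nat -> V),
    (forall k, a <= c k /\ c k <= d k /\ d k <= b) /\
    rseries_bounded (fun k => (d k - c k) * nrm (w k)) /\
    (forall s, a < s < b ->
       rseries_bounded (fun k => ind (c k) (d k) s * nrm (w k)) ->
       sums_to z add dist (fun k => scal (ind (c k) (d k) s) (w k)) (f s)) /\
    sums_to z add dist (fun k => scal (d k - c k) (w k)) v.

Definition BInt {X : Banach} (f : R -> X) (a b : R) (v : X) : Prop :=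
  IntGen bzero (@badd X) (@bscal X) (@bnorm X) bdist f a b v.

Definition LInt (f : R -> R) (a b : R) (v : R) : Prop :=
  IntGen 0 Rplus Rmult Rabs (fun x y => Rabs (x - y)) f a b v.

(** Lebesgue measurability on [1,oo): all truncations are integrable on
    bounded subintervals. *)
Definition measurable_from1 (g : R -> R) : Prop :=
  forall (a b : R) (n : nat), 1 <= a <= b ->
    exists I, LInt (fun s => Rmax (- INR n) (Rmin (INR n) (g s))) a b I.

Definition cont_from {X : Banach} (a : R) (g : R -> X) : Prop :=
  forall t, a <= t -> forall eps, 0 < eps -> exists delta, 0 < delta /\
    forall s, a <= s -> Rabs (s - t) < delta -> bdist (g s) (g t) < eps.

Definition lin_op {X : Banach} (A : X -> X) : Prop :=
  (forall x y, A (badd x y) = badd (A x) (A y)) /\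
  (forall a x, A (bscal a x) = bscal a (A x)).

Definition bounded_op {X : Banach} (A : X -> X) : Prop :=
  exists K, forall x, bnorm (A x) <= K * bnorm x.

Definition evolution_family {X : Banach} (T : R -> R -> X -> X) : Prop :=
  (forall t tau, 1 <= tau <= t -> lin_op (T t tau) /\ bounded_op (T t tau)) /\
  (forall t x, 1 <= t -> T t t x = x) /\
  (forall t s tau x, 1 <= tau -> tau <= s -> s <= t -> T t s (T s tau x) = T t tau x) /\
  (forall tau x, 1 <= tau -> cont_from tau (fun s => T s tau x)).

Definition is_norm {X : Banach} (N : X -> R) : Prop :=
  (forall x, 0 <= N x) /\
  (forall x, N x = 0 -> x = bzero) /\
  (forall a x, N (bscal a x) = Rabs a * N x) /\
  (forall x y, N (badd x y) <= N x + N y).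

Definition norm_family {X : Banach} (nt : R -> X -> R) : Prop :=
  (forall t, 1 <= t -> is_norm (nt t)) /\
  (exists C eps, 0 < C /\ 0 <= eps /\
     forall x tau, 1 <= tau -> bnorm x <= nt tau x /\ nt tau x <= C * Rpower tau eps * bnorm x) /\
  (forall x, measurable_from1 (fun t => nt t x)).

Definition Qop {X : Banach} (P : R -> X -> X) (t : R) (x : X) : X :=
  badd x (bopp (P t x)).

(** Polynomial dichotomy with respect to nt, with projections P. The backward
    operator T(t,tau) (t <= tau) on ker P(tau) is the inverse of
    T(tau,t)|ker P(t); the second estimate is stated through it. *)
Definition poly_dichotomy {X : Banach} (T : R -> R -> X -> X) (nt : R -> X -> R)
  (P : R -> X -> X) : Prop :=
  (forall t, 1 <= t -> lin_op (P t) /\ forall x, P t (P t x) = P t x) /\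
  (forall t tau x, 1 <= tau <= t -> P t (T t tau x) = T t tau (P tau x)) /\
  (forall t tau, 1 <= tau <= t ->
     (forall x y, P tau x = bzero -> P tau y = bzero -> T t tau x = T t tau y -> x = y) /\
     (forall z, P t z = bzero -> exists x, P tau x = bzero /\ T t tau x = z)) /\
  exists lam D, 0 < lam /\ 0 < D /\
    (forall t tau x, 1 <= tau <= t ->
       nt t (T t tau (P tau x)) <= D * Rpower (t / tau) (- lam) * nt tau x) /\
    (forall t tau x z, 1 <= t <= tau -> P t z = bzero -> T tau t z = Qop P tau x ->
       nt t z <= D * Rpower (tau / t) (- lam) * nt tau x).

Definition inY1 {X : Banach} (nt : R -> X -> R) (y : R -> X) : Prop :=
  (forall a b, 1 <= a <= b -> exists v, BInt y a b v) /\
  exists M, forall t, 1 <= t ->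
    exists I, LInt (fun s => nt s (y s)) t (t + 1) I /\ I <= M.

Definition inYZ {X : Banach} (nt : R -> X -> R) (P : R -> X -> X) (x : R -> X) : Prop :=
  cont_from 1 x /\
  (exists M, forall t, 1 <= t -> nt t (x t) <= M) /\
  (exists u, x 1 = Qop P 1 u).

Definition mild_sol {X : Banach} (T : R -> R -> X -> X) (y x : R -> X) : Prop :=
  forall t tau, 1 <= tau <= t ->
    exists v, BInt (fun s => bscal (/ s) (T t s (y s))) tau t v /\
      x t = badd (T t tau (x tau)) v.

(* Main.v *)
(** The forward kernel T(t,s), 1 <= s <= t, is uniformly bounded in s (on ker P(s) it factors
    through the backward operator), hence right-continuous in s, and a bounded
    right-continuous kernel applied to an integrable function is integrable. So
    V(t,tau) = int_tau^t T(t,s) y(s) ds/s exists and satisfies the cocycle identity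
    V(t,tau) = T(t,s) V(s,tau) + V(t,s).  The solution is x(t) = P(t) V(t,1) - z(t), where
    z(tau) is the limit as t -> oo of W(tau,t), the pull-back to ker P(tau) of Q(t) V(t,tau).
    On intervals of length one both parts are at most D ||y||_L / tau; the cocycle identity
    and a telescoping sum of powers make these bounds uniform. Bounded solutions of the
    homogeneous equation starting in ker P(1) vanish, which gives uniqueness.

    Integrals are handled through series of bricks with majorants. Comparison of integrals
    comes from a covering argument (Cousin's lemma). *)

(* The solution is the usual Green formula: P(t)V(t,1) is the integral over [1,t] of
   T(t,s)P(s)y(s)/s, and W(tau,t) is the integral over [tau,t] of T(tau,s)Q(s)y(s)/s. With the
   projection and the backward operator pulled out of the integral, only one kernel has to be shown
   integrable against y. Its continuity from one side only is all that the continuity of s ->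
   T(s,tau)x yields. The weight 1/s is what lets a rate s^(-lam) suffice for every lam > 0: over
   unit steps the sum of r^lam / (r+1) up to t is of order t^lam / lam, which the decay t^(-lam) of
   the stable part cancels, and the sum of r^(-lam) / r converges, which settles the unstable part.
   The estimates live in the norms ||.||_s, whose ratio to ||.|| may grow with s, while integrals
   are defined through ||.|| alone. Hence integrals are compared under an arbitrary seminorm
   dominated by the norm, and only against a real integrand already known to be integrable, here s
   -> ||y(s)||_s. *)
From Stdlib Require Import Reals Lra Lia List Cantor.
From Stdlib Require Import Classical ClassicalEpsilon FunctionalExtensionality.
Require Import Defs.
Open Scope R_scope.
Set Implicit Arguments.
Unset Strict Implicit.

Notation "x [+] y" := (badd x y) (at level 50, left associativity).
Notation "x [-] y" := (badd x (bopp y)) (at level 50, left associativity).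
Notation "a [*] x" := (bscal a x) (at level 40, left associativity).
Notation rsum := (psum 0 Rplus).
Notation bsum := (psum bzero badd).
Notation bsums := (sums_to bzero badd bdist).

(** * Linear identities in a Banach space *)

Section Banach_algebra.
Variable X : Banach.
Implicit Types x y z : X.

Lemma badd_0l x : bzero [+] x = x.
Proof. rewrite badd_comm; apply badd_0. Qed.

Lemma badd_cancel_l x y z : x [+] y = x [+] z -> y = z.
Proof.
  intro H. rewrite <- (badd_0l y), <- (badd_0l z).
  rewrite <- (badd_opp _ x), (badd_comm _ x), <- !badd_assoc, H; reflexivity.
Qed.

Lemma bscal_0l x : 0 [*] x = bzero.
Proof.
  apply (@badd_cancel_l (0 [*] x)). rewrite <- bscal_distr_r, badd_0, Rplus_0_l; reflexivity.
Qed.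

Lemma bscal_0r a : a [*] (bzero : X) = bzero.
Proof. rewrite <- (bscal_0l bzero), bscal_assoc, Rmult_0_r; reflexivity. Qed.

Lemma bopp_scal x : bopp x = (-1) [*] x.
Proof.
  apply (@badd_cancel_l x). rewrite badd_opp.
  rewrite <- (bscal_1 _ x) at 1. rewrite <- bscal_distr_r.
  replace (1 + -1) with 0 by ring. rewrite bscal_0l; reflexivity.
Qed.

(** Syntax for a proof by reflection: the value of a linear expression depends only on the
    coefficients of its atoms, so an identity of vectors reduces to identities of real numbers. *)
Inductive vexp :=
| VZero : vexp
| VAtom : nat -> vexp
| VAdd : vexp -> vexp -> vexp
| VOpp : vexp -> vexp
| VScal : R -> vexp -> vexp.

Fixpoint veval (env : list X) (e : vexp) : X :=
  match e with
  | VZero => bzero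
  | VAtom n => nth n env bzero
  | VAdd a b => veval env a [+] veval env b
  | VOpp a => bopp (veval env a)
  | VScal r a => r [*] veval env a
  end.

Fixpoint vcoef (e : vexp) (k : nat) : R :=
  match e with
  | VZero => 0
  | VAtom n => if Nat.eqb n k then 1 else 0
  | VAdd a b => vcoef a k + vcoef b k
  | VOpp a => - vcoef a k
  | VScal r a => r * vcoef a k
  end.

Fixpoint lincomb (env : list X) (f : nat -> R) : X :=
  match env with
  | nil => bzero
  | x :: l => f O [*] x [+] lincomb l (fun k => f (S k))
  end.

Lemma lincomb_zero env f : (forall k, f k = 0) -> lincomb env f = bzero.
Proof.
  revert f; induction env as [|x l IH]; intros f H; simpl; auto.
  rewrite H, bscal_0l, badd_0l; apply IH; auto.
Qed.

Lemma lincomb_add env f g :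
  lincomb env (fun k => f k + g k) = lincomb env f [+] lincomb env g.
Proof.
  revert f g; induction env as [|x l IH]; intros f g; simpl.
  - rewrite badd_0; reflexivity.
  - rewrite (IH (fun k => f (S k)) (fun k => g (S k))), bscal_distr_r, <- !badd_assoc. f_equal.
    rewrite !badd_assoc. f_equal. apply badd_comm.
Qed.

Lemma lincomb_scal env a f : lincomb env (fun k => a * f k) = a [*] lincomb env f.
Proof.
  revert f; induction env as [|x l IH]; intros f; simpl.
  - rewrite bscal_0r; reflexivity.
  - rewrite (IH (fun k => f (S k))), bscal_distr_l, bscal_assoc; reflexivity.
Qed.

Lemma lincomb_atom env n :
  lincomb env (fun k => if Nat.eqb n k then 1 else 0) = nth n env bzero.
Proof.
  revert n; induction env as [|x l IH]; intros [|n]; simpl; auto.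
  - rewrite lincomb_zero by auto. rewrite badd_0, bscal_1; auto.
  - rewrite bscal_0l, badd_0l; apply IH.
Qed.

Lemma lincomb_veval env e : lincomb env (vcoef e) = veval env e.
Proof.
  induction e; simpl.
  - apply lincomb_zero; auto.
  - apply lincomb_atom.
  - rewrite lincomb_add; congruence.
  - rewrite bopp_scal, <- IHe, <- lincomb_scal. f_equal.
    apply functional_extensionality; intro; ring.
  - rewrite lincomb_scal; congruence.
Qed.

Lemma veval_eq env e1 e2 :
  lincomb env (vcoef e1) = lincomb env (vcoef e2) -> veval env e1 = veval env e2.
Proof. rewrite !lincomb_veval; auto. Qed.

End Banach_algebra.

Ltac vmem x l :=
  match l with
  | nil => constr:(false)
  | x :: _ => constr:(true)
  | _ :: ?r => vmem x r
  end.

Ltac vatoms t l :=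
  match t with
  | bzero => l
  | badd ?a ?b => let l1 := vatoms a l in vatoms b l1
  | bopp ?a => vatoms a l
  | bscal _ ?a => vatoms a l
  | _ => match vmem t l with true => l | false => constr:(t :: l) end
  end.

Ltac vindex x l :=
  match l with
  | x :: _ => constr:(O)
  | _ :: ?r => let n := vindex x r in constr:(S n)
  end.

Ltac vreify t l :=
  match t with
  | bzero => constr:(VZero)
  | badd ?a ?b => let a' := vreify a l in let b' := vreify b l in constr:(VAdd a' b')
  | bopp ?a => let a' := vreify a l in constr:(VOpp a')
  | bscal ?r ?a => let a' := vreify a l in constr:(VScal r a')
  | _ => let n := vindex t l in constr:(VAtom n)
  end.

(* Decides equalities of linear combinations by comparing the coefficients of the atoms. *)
Ltac vring :=
  match goal with
  | |- @eq ?XT ?a ?b =>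
    let X := match XT with bcar ?X => X end in
    let l0 := vatoms a (@nil (bcar X)) in
    let l := vatoms b l0 in
    let e1 := vreify a l in
    let e2 := vreify b l in
    change (@veval X l e1 = @veval X l e2);
    apply veval_eq; cbn [lincomb vcoef Nat.eqb];
    repeat (apply f_equal2; [apply f_equal2; [try ring | reflexivity] |]);
    try reflexivity
  end.

Section Banach_norm.
Variable X : Banach.
Implicit Types x y z : X.

Lemma bnorm_0 : bnorm (bzero : X) = 0.
Proof. rewrite <- (bscal_0l (bzero : X)), bnorm_scal, Rabs_R0; ring. Qed.

Lemma bnorm_opp x : bnorm (bopp x) = bnorm x.
Proof.
  rewrite bopp_scal, bnorm_scal. replace (Rabs (-1)) with 1; [ring|].
  rewrite Rabs_left; lra.
Qed.

Lemma bdist_triangle y x z : bdist x z <= bdist x y + bdist y z.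
Proof.
  unfold bdist. replace (x [-] z) with ((x [-] y) [+] (y [-] z)) by vring.
  apply bnorm_triangle.
Qed.

Lemma bdist_sym x y : bdist x y = bdist y x.
Proof.
  unfold bdist. rewrite <- bnorm_opp. f_equal. vring.
Qed.

Lemma bdist_refl x : bdist x x = 0.
Proof. unfold bdist. rewrite badd_opp. apply bnorm_0. Qed.

Lemma bdist_nonneg x y : 0 <= bdist x y.
Proof. apply bnorm_nonneg. Qed.

Lemma bsub_eq0 x y : x [-] y = bzero -> x = y.
Proof.
  intro H. replace x with ((x [-] y) [+] y) by vring. rewrite H. apply badd_0l.
Qed.

Lemma bdist_eq x y : bdist x y = 0 -> x = y.
Proof. intro H; apply bsub_eq0, bnorm_eq0, H. Qed.

Lemma bdist_eq_eps x y : (forall eps, 0 < eps -> bdist x y <= eps) -> x = y.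
Proof.
  intro H. apply bdist_eq. apply Rle_antisym; [|apply bdist_nonneg].
  apply le_epsilon. intros e he. specialize (H e he). lra.
Qed.

Lemma bdist_add x y x' y' : bdist (x [+] y) (x' [+] y') <= bdist x x' + bdist y y'.
Proof.
  unfold bdist. replace (x [+] y [-] (x' [+] y')) with ((x [-] x') [+] (y [-] y')) by vring.
  apply bnorm_triangle.
Qed.

Lemma bnorm_le_dist x y : bnorm x <= bnorm y + bdist x y.
Proof.
  unfold bdist. replace x with (y [+] (x [-] y)) at 1 by vring. apply bnorm_triangle.
Qed.

End Banach_norm.

(** * Series *)

Lemma rsum_le (u v : nat -> R) n :
  (forall k, (k < n)%nat -> u k <= v k) -> rsum u n <= rsum v n.
Proof.
  induction n; intro H; simpl; [lra|].
  apply Rplus_le_compat; [apply IHn; intros; apply H; lia | apply H; lia].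
Qed.

Lemma rsum_nonneg (u : nat -> R) n : (forall k, 0 <= u k) -> 0 <= rsum u n.
Proof. intro H; induction n; simpl; [lra|]. specialize (H n); lra. Qed.

Lemma rsum_mono (u : nat -> R) n m :
  (forall k, 0 <= u k) -> (n <= m)%nat -> rsum u n <= rsum u m.
Proof.
  intros H Hnm. induction Hnm; simpl; [lra|]. specialize (H m); lra.
Qed.

Lemma rsum_scal a (u : nat -> R) n : rsum (fun k => a * u k) n = a * rsum u n.
Proof. induction n; simpl; [ring|]. rewrite IHn; ring. Qed.

Lemma rsum_plus (u v : nat -> R) n : rsum (fun k => u k + v k) n = rsum u n + rsum v n.
Proof. induction n; simpl; [ring|]. rewrite IHn; ring. Qed.

Lemma psum_ext V (z : V) add (u v : nat -> V) n :
  (forall k, (k < n)%nat -> u k = v k) -> psum z add u n = psum z add v n.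
Proof.
  induction n; intro H; simpl; auto. rewrite IHn by (intros; apply H; lia).
  rewrite H by lia; reflexivity.
Qed.

Lemma rsum_const a n : rsum (fun _ => a) n = INR n * a.
Proof. induction n; simpl psum; [simpl; ring|]. rewrite IHn, S_INR; ring. Qed.

Lemma rsum_geometric a n : 0 <= a -> rsum (fun k => a * (/2)^k) n <= 2 * a.
Proof.
  intro Ha. assert (H : rsum (fun k => a * (/2)^k) n = 2 * a - 2 * a * (/2)^n).
  { induction n; simpl; [ring|]. rewrite IHn. field. }
  rewrite H. assert (0 <= (/2)^n) by (apply pow_le; lra).
  assert (0 <= 2 * a * (/2)^n) by (apply Rmult_le_pos; lra). lra.
Qed.

Lemma half_pow_small (B eps : R) : 0 < eps -> exists N, forall n, (N <= n)%nat -> B * (/2)^n < eps.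
Proof.
  intro He.
  destruct (pow_lt_1_zero (/2)) with (y := eps / (Rabs B + 1)) as [N HN].
  - rewrite Rabs_pos_eq; lra.
  - apply Rdiv_lt_0_compat; auto. pose proof (Rabs_pos B); lra.
  - exists N; intros n Hn. specialize (HN n Hn).
    assert (Hp : 0 <= (/2)^n) by (apply pow_le; lra).
    rewrite Rabs_pos_eq in HN by auto.
    pose proof (Rabs_pos B). pose proof (Rle_abs B).
    assert (B * (/2)^n <= (Rabs B + 1) * (/2)^n) by (apply Rmult_le_compat_r; lra).
    apply Rle_lt_trans with ((Rabs B + 1) * (/2)^n); auto.
    apply Rmult_lt_reg_l with (/ (Rabs B + 1)); [apply Rinv_0_lt_compat; lra|].
    rewrite <- Rmult_assoc, Rinv_l, Rmult_1_l by lra. unfold Rdiv in HN; lra.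
Qed.

(** The partial sums increase to their supremum, and some partial sum is within [eps] of it. *)
Lemma rsum_tail_small (u : nat -> R) M eps :
  (forall k, 0 <= u k) -> (forall n, rsum u n <= M) -> 0 < eps ->
  exists N, forall n, (N <= n)%nat -> rsum u n - rsum u N <= eps.
Proof.
  intros Hu HM He.
  destruct (completeness (fun x => exists n, x = rsum u n)) as [l [Hub Hl]].
  - exists M; intros x [n ->]; apply HM.
  - exists (rsum u O), O; reflexivity.
  - destruct (classic (exists N, l - eps < rsum u N)) as [[N HN]|Hno].
    + exists N; intros n Hn. assert (rsum u n <= l) by (apply Hub; exists n; auto). lra.
    + exfalso. assert (l <= l - eps); [|lra].
      apply Hl. intros x [n ->]. apply Rnot_lt_le; intro; apply Hno; exists n; auto.
Qed.

Section Series.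
Variable X : Banach.
Implicit Types u v : nat -> X.

Lemma bnorm_bsum u n : bnorm (bsum u n) <= rsum (fun k => bnorm (u k)) n.
Proof.
  induction n; simpl; [rewrite bnorm_0; lra|].
  eapply Rle_trans; [apply bnorm_triangle|]; lra.
Qed.

Lemma bdist_bsum_tail u (r : nat -> R) n m :
  (forall k, bnorm (u k) <= r k) -> (n <= m)%nat ->
  bdist (bsum u m) (bsum u n) <= rsum r m - rsum r n.
Proof.
  intros H Hnm. induction Hnm; simpl.
  - rewrite bdist_refl; lra.
  - unfold bdist in *.
    replace (bsum u m [+] u m [-] bsum u n) with ((bsum u m [-] bsum u n) [+] u m) by vring.
    eapply Rle_trans; [apply bnorm_triangle|]. specialize (H m). lra.
Qed.

Lemma abs_summable u (r : nat -> R) M :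
  (forall k, bnorm (u k) <= r k) -> (forall n, rsum r n <= M) -> exists l, bsums u l.
Proof.
  intros Hr HM. apply bcomplete. intros eps He.
  assert (Hr0 : forall k, 0 <= r k)
    by (intro k; eapply Rle_trans; [apply bnorm_nonneg | apply Hr]).
  destruct (rsum_tail_small (eps := eps / 3) Hr0 HM) as [N HN]; [lra|].
  exists N; intros n m Hn Hm. change (bdist (bsum u n) (bsum u m) < eps).
  pose proof (bdist_triangle (bsum u N) (bsum u n) (bsum u m)).
  pose proof (bdist_bsum_tail Hr Hn). pose proof (bdist_bsum_tail Hr Hm).
  pose proof (HN n Hn). pose proof (HN m Hm).
  rewrite (bdist_sym (bsum u N) (bsum u m)) in H. lra.
Qed.

(** Convergence along a subsequence is enough to identify a limit that is known to exist. This
    serves series obtained by interleaving, whose even partial sums alone are easy to compute. *)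
Lemma bsums_unique_sub u (l l' : X) (phi : nat -> nat) :
  (forall n, (n <= phi n)%nat) -> bsums u l ->
  (forall eps, 0 < eps -> exists N, forall n, (N <= n)%nat -> bdist (bsum u (phi n)) l' < eps) ->
  l = l'.
Proof.
  intros Hphi Hl Hl'. apply bdist_eq_eps; intros eps He.
  destruct (Hl (eps / 2)) as [N HN]; [lra|]. destruct (Hl' (eps / 2)) as [N' HN']; [lra|].
  set (n := Nat.max N N').
  pose proof (HN (phi n)) as H1. pose proof (HN' n) as H2.
  specialize (Hphi n). specialize (H1 ltac:(lia)). specialize (H2 ltac:(lia)).
  pose proof (bdist_triangle (bsum u (phi n)) l l').
  rewrite (bdist_sym l (bsum u (phi n))) in H. lra.
Qed.

Lemma bsums_unique u (l l' : X) : bsums u l -> bsums u l' -> l = l'.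
Proof. intros Hl Hl'. apply (@bsums_unique_sub u l l' (fun n => n)); auto. Qed.

Lemma bsums_ext u v (l : X) : (forall k, u k = v k) -> bsums u l -> bsums v l.
Proof.
  intros H. replace v with u; auto. apply functional_extensionality; auto.
Qed.

Lemma bsums_dist_le u (l x : X) c n0 :
  bsums u l -> (forall n, (n0 <= n)%nat -> bdist (bsum u n) x <= c) -> bdist l x <= c.
Proof.
  intros Hl H. apply le_epsilon; intros eps He. destruct (Hl eps He) as [N HN].
  set (n := Nat.max N n0). specialize (H n ltac:(lia)). specialize (HN n ltac:(lia)).
  pose proof (bdist_triangle (bsum u n) l x). rewrite (bdist_sym l (bsum u n)) in H0. lra.
Qed.

Lemma bsums_norm_le u (r : nat -> R) (l : X) c :
  bsums u l -> (forall k, bnorm (u k) <= r k) -> (forall n, rsum r n <= c) -> bnorm l <= c.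
Proof.
  intros Hl Hr Hc. replace l with (l [-] bzero) by vring.
  apply (@bsums_dist_le u l bzero c O Hl). intros n _. unfold bdist.
  replace (bsum u n [-] bzero) with (bsum u n) by vring.
  eapply Rle_trans; [apply bnorm_bsum|]. eapply Rle_trans; [apply rsum_le | apply (Hc n)]; auto.
Qed.

Lemma bsums_finite u n0 :
  (forall k, (n0 <= k)%nat -> u k = bzero) -> bsums u (bsum u n0).
Proof.
  intros H eps He. exists n0. intros n Hn.
  replace (bsum u n) with (bsum u n0); [rewrite bdist_refl; auto|].
  induction Hn; auto. simpl. rewrite H by auto. rewrite badd_0; auto.
Qed.

Lemma bsums_zero u : (forall k, u k = bzero) -> bsums u bzero.
Proof. intro H. apply (@bsums_finite u O); auto. Qed.

Lemma bsums_single u n0 : (forall k, k <> n0 -> u k = bzero) -> bsums u (u n0).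
Proof.
  intro H. replace (u n0) with (bsum u (S n0)).
  - apply bsums_finite. intros; apply H; lia.
  - simpl. replace (bsum u n0) with (bzero : X); [apply badd_0l|].
    symmetry. assert (forall m, (m <= n0)%nat -> bsum u m = bzero); [|auto].
    induction m; simpl; auto. intro. rewrite IHm, H by lia. apply badd_0.
Qed.

Lemma bsum_map (Y : Banach) (A : X -> Y) u n :
  (forall x y, A (x [+] y) = A x [+] A y) -> A bzero = bzero ->
  A (bsum u n) = bsum (fun k => A (u k)) n.
Proof. intros Ha H0. induction n; simpl; auto. rewrite Ha, IHn; auto. Qed.

End Series.

Section Linear_maps.
Variables (X Y : Banach) (A : X -> Y) (K : R).
Hypothesis Aadd : forall x y, A (x [+] y) = A x [+] A y.
Hypothesis Ascal : forall a x, A (a [*] x) = a [*] A x.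

Lemma lin_zero : A bzero = bzero.
Proof. rewrite <- (bscal_0l (bzero : X)), Ascal, bscal_0l; auto. Qed.

Lemma lin_opp x : A (bopp x) = bopp (A x).
Proof. rewrite !bopp_scal; apply Ascal. Qed.

Hypothesis Abnd : forall x, bnorm (A x) <= K * bnorm x.

Lemma bsums_map (u : nat -> X) (l : X) : bsums u l -> bsums (fun k => A (u k)) (A l).
Proof.
  intros H eps He. pose proof (Rabs_pos K). pose proof (Rle_abs K).
  destruct (H (eps / (Rabs K + 1))) as [N HN]; [apply Rdiv_lt_0_compat; lra|].
  exists N; intros n Hn. specialize (HN n Hn).
  rewrite <- bsum_map; auto using lin_zero.
  unfold bdist in *. rewrite <- lin_opp, <- Aadd.
  eapply Rle_lt_trans; [apply Abnd|].
  pose proof (bnorm_nonneg _ (bsum u n [-] l)).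
  apply Rle_lt_trans with ((Rabs K + 1) * bnorm (bsum u n [-] l));
    [apply Rmult_le_compat_r; lra|].
  apply Rmult_lt_reg_r with (/ (Rabs K + 1)); [apply Rinv_0_lt_compat; lra|].
  unfold Rdiv in HN. rewrite Rmult_comm, <- Rmult_assoc, Rinv_l, Rmult_1_l by lra. auto.
Qed.

End Linear_maps.

(** Makes every result on series and integrals available for real functions. It ends with [Defined]
    so that its operations reduce to those of the reals and [LInt] is convertible with [BInt] over
    [RB]. *)
Definition RB : Banach.
Proof.
  refine (@mkBanach R 0 Rplus Ropp Rmult Rabs _ _ _ _ _ _ _ _ _ _ _ _ _).
  - intros; ring.
  - intros; ring.
  - intros; ring.
  - intros; ring.
  - intros; ring.
  - intros; ring.
  - intros; ring.
  - intros; ring.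
  - apply Rabs_pos.
  - intros x H. destruct (Req_dec x 0); auto. apply Rabs_no_R0 in H0; contradiction.
  - apply Rabs_mult.
  - apply Rabs_triang.
  - intros u H. destruct (R_complete u) as [l Hl].
    + intros eps He. destruct (H eps He) as [N HN]. exists N; intros; apply HN; auto.
    + exists l; intros eps He. destruct (Hl eps He) as [N HN]. exists N; intros; apply HN; auto.
Defined.

(** * Double series along Cantor's enumeration of pairs *)

Definition dsum (X : Banach) (u : nat -> nat -> X) (N J : nat) : X :=
  bsum (fun n => bsum (u n) J) N.

Definition sel (X : Banach) (b : bool) (x : X) : X := if b then x else bzero.

Definition flat V (u : nat -> nat -> V) (m : nat) : V := u (fst (of_nat m)) (snd (of_nat m)).

Section Double_sums.
Variable X : Banach.
Implicit Types u v : nat -> nat -> X.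

Lemma bsum_plus (u v : nat -> X) n : bsum (fun k => u k [+] v k) n = bsum u n [+] bsum v n.
Proof. induction n; simpl; [rewrite badd_0; auto|]. rewrite IHn. vring. Qed.

Lemma dsum_plus u v N J :
  dsum (fun n j => u n j [+] v n j) N J = dsum u N J [+] dsum v N J.
Proof.
  unfold dsum. rewrite <- bsum_plus. apply psum_ext. intros. apply bsum_plus.
Qed.

Lemma dsum_ext u v N J :
  (forall n j, (n < N)%nat -> (j < J)%nat -> u n j = v n j) -> dsum u N J = dsum v N J.
Proof. intro H. unfold dsum. apply psum_ext; intros. apply psum_ext; intros; auto. Qed.

Lemma bsum_zero (u : nat -> X) n : (forall k, (k < n)%nat -> u k = bzero) -> bsum u n = bzero.
Proof.
  induction n; intro H; simpl; auto. rewrite IHn by (intros; apply H; lia).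
  rewrite H by lia. apply badd_0.
Qed.

Lemma bsum_sel_eq (x : X) n0 n : (n0 < n)%nat -> bsum (fun k => sel (Nat.eqb k n0) x) n = x.
Proof.
  induction n; intro H; [lia|]. simpl. destruct (Nat.eq_dec n n0) as [->|Hn].
  - rewrite bsum_zero.
    + rewrite Nat.eqb_refl. apply badd_0l.
    + intros. unfold sel. rewrite (proj2 (Nat.eqb_neq k n0)) by lia. auto.
  - rewrite IHn by lia. unfold sel. rewrite (proj2 (Nat.eqb_neq n n0)) by lia. apply badd_0.
Qed.

Lemma dsum_sel_eq (x : X) n0 j0 N J : (n0 < N)%nat -> (j0 < J)%nat ->
  dsum (fun n j => sel (Nat.eqb n n0 && Nat.eqb j j0) x) N J = x.
Proof.
  intros Hn Hj. unfold dsum. etransitivity; [|apply (bsum_sel_eq x Hn)]. apply psum_ext.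
  intros n _. unfold sel. destruct (Nat.eqb n n0) eqn:E; simpl.
  - apply (bsum_sel_eq x Hj).
  - apply bsum_zero; auto.
Qed.

Lemma of_nat_le m : (fst (of_nat m) <= m)%nat /\ (snd (of_nat m) <= m)%nat.
Proof.
  rewrite <- (cancel_to_of m) at 2 4. destruct (of_nat m) as [a b].
  pose proof (to_nat_non_decreasing a b). simpl fst; simpl snd. lia.
Qed.

(** Both coordinates of the pair with code m are at most m, so the first [M] entries of the
    enumeration lie in any rectangle with sides at least [M]; masking the other entries turns a flat
    sum into a rectangular one. *)
Lemma dsum_flat u M N J : (M <= N)%nat -> (M <= J)%nat ->
  dsum (fun n j => sel (Nat.ltb (to_nat (n, j)) M) (u n j)) N J = bsum (flat u) M.
Proof.
  induction M; intros HN HJ.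
  - unfold dsum. apply bsum_zero; intros. apply bsum_zero; intros. reflexivity.
  - simpl psum. rewrite <- IHM by lia.
    pose proof (of_nat_le M) as [H1 H2]. unfold flat.
    rewrite <- (dsum_sel_eq (u (fst (of_nat M)) (snd (of_nat M)))
                  (n0 := fst (of_nat M)) (j0 := snd (of_nat M)) (N := N) (J := J)) by lia.
    rewrite <- dsum_plus. apply dsum_ext. intros n j Hn Hj.
    destruct (Nat.eq_dec (to_nat (n, j)) M) as [E|E].
    + rewrite <- E, cancel_of_to. simpl. rewrite !Nat.eqb_refl. simpl.
      rewrite Nat.ltb_irrefl. rewrite (proj2 (Nat.ltb_lt _ _)) by lia.
      unfold sel. rewrite badd_0l; auto.
    + replace (Nat.eqb n (fst (of_nat M)) && Nat.eqb j (snd (of_nat M)))%bool with false.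
      * unfold sel at 3. rewrite badd_0. f_equal.
        destruct (Nat.ltb_spec (to_nat (n, j)) M);
        destruct (Nat.ltb_spec (to_nat (n, j)) (S M)); auto; lia.
      * symmetry. apply Bool.andb_false_iff.
        destruct (Nat.eqb_spec n (fst (of_nat M))); auto.
        destruct (Nat.eqb_spec j (snd (of_nat M))); auto.
        exfalso; apply E. rewrite e, e0, <- surjective_pairing. apply cancel_to_of.
Qed.

End Double_sums.

Section Double_series.
Variable X : Banach.
Variables (u : nat -> nat -> X) (r : nat -> nat -> R).
Hypothesis Hr : forall n j, bnorm (u n j) <= r n j.

Lemma dsum_r_nonneg n j : 0 <= r n j.
Proof. eapply Rle_trans; [apply bnorm_nonneg | apply Hr]. Qed.

Lemma dsum_le (a b : nat -> nat -> R) N J :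
  (forall n j, a n j <= b n j) -> dsum (X := RB) a N J <= dsum (X := RB) b N J.
Proof.
  intro H. unfold dsum. apply rsum_le; intros. apply rsum_le; intros; auto.
Qed.

Lemma rsum_flat_le_dsum M : rsum (flat r) M <= dsum (X := RB) r M M.
Proof.
  change (bsum (flat (r : nat -> nat -> RB)) M <= dsum (X := RB) r M M).
  rewrite <- (@dsum_flat RB r M M M) by auto. apply dsum_le. intros. unfold sel.
  pose proof (dsum_r_nonneg n j).
  match goal with |- context [if ?b then _ else _] => destruct b end; simpl; lra.
Qed.

Lemma dsum_mono (a : nat -> nat -> R) N J N' J' : (forall n j, 0 <= a n j) ->
  (N <= N')%nat -> (J <= J')%nat -> dsum (X := RB) a N J <= dsum (X := RB) a N' J'.
Proof.
  intros Ha HN HJ. unfold dsum.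
  apply Rle_trans with (rsum (fun n => rsum (a n) J') N).
  - apply rsum_le; intros. apply rsum_mono; auto.
  - apply rsum_mono; auto. intros; apply rsum_nonneg; auto.
Qed.

Lemma to_nat_bounded N J :
  exists M, forall n j, (n < N)%nat -> (j < J)%nat -> (to_nat (n, j) < M)%nat.
Proof.
  exists (S (to_nat (0, N + J)%nat)). intros n j Hn Hj.
  pose proof (to_nat_spec n j). pose proof (to_nat_spec 0 (N + J)). nia.
Qed.

Lemma dsum_le_flat A N J : (forall M, rsum (flat r) M <= A) -> dsum (X := RB) r N J <= A.
Proof.
  intro HA. destruct (to_nat_bounded N J) as [M HM].
  eapply Rle_trans; [|apply (HA M)].
  change (dsum (X := RB) r N J <= bsum (flat (r : nat -> nat -> RB)) M).
  set (N' := (N + M)%nat). set (J' := (J + M)%nat).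
  rewrite <- (@dsum_flat RB r M N' J') by lia.
  rewrite (@dsum_ext RB r (fun n j => sel (X := RB) (Nat.ltb (to_nat (n, j)) M) (r n j)) N J).
  - apply dsum_mono; try lia. intros. unfold sel. pose proof (dsum_r_nonneg n j).
    match goal with |- context [if ?b then _ else _] => destruct b end; simpl; lra.
  - intros. rewrite (proj2 (Nat.ltb_lt _ _)); auto.
Qed.

Lemma row_le_flat A n J : (forall M, rsum (flat r) M <= A) -> rsum (r n) J <= A.
Proof.
  intro HA. eapply Rle_trans; [|apply (dsum_le_flat (S n) J HA)].
  unfold dsum. simpl.
  assert (0 <= rsum (fun n0 => rsum (r n0) J) n).
  { apply rsum_nonneg; intro; apply rsum_nonneg; intro; apply dsum_r_nonneg. }
  change (rsum (r n) J <= rsum (fun n0 => rsum (r n0) J) n + rsum (r n) J). lra.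
Qed.

(** What remains after subtraction are the entries of the rectangle with code at least [M], and
    their majorants add up to the right-hand side. *)
Lemma dsum_sub_flat M N J : (M <= N)%nat -> (M <= J)%nat ->
  bdist (dsum u N J) (bsum (flat u) M) <= dsum (X := RB) r N J - rsum (flat r) M.
Proof.
  intros HN HJ. change (rsum (flat r) M) with (bsum (flat (r : nat -> nat -> RB)) M).
  rewrite <- (dsum_flat u HN HJ), <- (@dsum_flat RB r M N J HN HJ).
  assert (split : forall (Y : Banach) (a : nat -> nat -> Y),
    dsum a N J = dsum (fun n j => sel (Nat.ltb (to_nat (n, j)) M) (a n j)) N J [+]
                 dsum (fun n j => sel (negb (Nat.ltb (to_nat (n, j)) M)) (a n j)) N J).
  { intros. rewrite <- dsum_plus. apply dsum_ext. intros. unfold sel.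
    destruct (Nat.ltb (to_nat (n, j)) M); simpl; [rewrite badd_0 | rewrite badd_0l]; auto. }
  rewrite (split X u), (split RB r). unfold bdist.
  match goal with |- bnorm (?a [+] ?b [-] ?a) <= @badd RB ?c ?d - _ =>
    assert (Hbd : bnorm b <= d);
    [|replace (a [+] b [-] a) with b by vring; change (bnorm b <= c + d - c);
      generalize (c : R) (d : R) Hbd; intros; lra] end.
  unfold dsum. eapply Rle_trans; [apply bnorm_bsum|].
  apply rsum_le; intros. eapply Rle_trans; [apply bnorm_bsum|].
  apply rsum_le; intros. unfold sel.
  destruct (negb _); [apply Hr|]. rewrite bnorm_0. simpl; lra.
Qed.

(** Fubini for absolutely convergent double series. Large rectangles are uniformly close to a long
    flat partial sum, and letting their width grow with the height fixed replaces each truncated row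
    by its sum. *)
Lemma double_series (phi : nat -> X) A :
  (forall M, rsum (flat r) M <= A) -> (forall n, bsums (u n) (phi n)) ->
  (forall N, rsum (fun n => bnorm (phi n)) N <= A) /\
  exists U, bsums (flat u) U /\ bsums phi U.
Proof.
  intros HA Hphi.
  (* For fixed [N], one width serves the first [N] rows at once. *)
  assert (Hdl : forall N eps, 0 < eps -> exists J0, forall J, (J0 <= J)%nat ->
            rsum (fun n => bdist (bsum (u n) J) (phi n)) N <= eps).
  { intros N. induction N; intros eps He; [exists O; intros; simpl; lra|].
    destruct (IHN (eps / 2)) as [J0 HJ0]; [lra|].
    destruct (Hphi N (eps / 2)) as [J1 HJ1]; [lra|].
    exists (Nat.max J0 J1). intros J HJ. simpl.
    specialize (HJ0 J ltac:(lia)). specialize (HJ1 J ltac:(lia)). lra. }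
  split.
  - intro N. apply le_epsilon. intros eps He. destruct (Hdl N eps He) as [J HJ].
    specialize (HJ J (le_n J)).
    apply Rle_trans with (rsum (fun n => rsum (r n) J + bdist (bsum (u n) J) (phi n)) N).
    + apply rsum_le. intros n _. eapply Rle_trans; [apply (bnorm_le_dist _ (bsum (u n) J))|].
      rewrite (bdist_sym (phi n)). apply Rplus_le_compat_r.
      eapply Rle_trans; [apply bnorm_bsum|]. apply rsum_le; auto.
    + rewrite rsum_plus. pose proof (dsum_le_flat N J HA). unfold dsum in H.
      change (rsum (fun n => rsum (r n) J) N <= A) in H. lra.
  - destruct (@abs_summable X (flat u) (flat r) A) as [U HU]; auto.
    { intro; apply Hr. }
    exists U; split; auto. intros eps He.
    assert (Hf : forall k, 0 <= flat r k) by (intro; apply dsum_r_nonneg).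
    destruct (rsum_tail_small (eps := eps / 4) Hf HA) as [M0 HM0]; [lra|].
    exists M0. intros N HN.
    destruct (Hdl N (eps / 4)) as [J0 HJ0]; [lra|].
    set (J := Nat.max J0 M0). specialize (HJ0 J ltac:(lia)).
    assert (H1 : bdist (dsum u N J) (bsum (flat u) M0) <= eps / 4).
    { eapply Rle_trans; [apply dsum_sub_flat; lia|].
      assert (dsum (X := RB) r N J <= rsum (flat r) M0 + eps / 4); [|lra].
      apply dsum_le_flat. intro M. destruct (Nat.le_gt_cases M0 M) as [Hc|Hc].
      - specialize (HM0 M Hc). lra.
      - assert (rsum (flat r) M <= rsum (flat r) M0) by (apply rsum_mono; auto; lia). lra. }
    assert (H2 : bdist (bsum phi N) (dsum u N J) <= eps / 4).
    { eapply Rle_trans; [|apply HJ0]. unfold dsum. clear. induction N; simpl.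
      - rewrite bdist_refl; lra.
      - eapply Rle_trans; [apply bdist_add|]. apply Rplus_le_compat; auto.
        rewrite bdist_sym; lra. }
    assert (H3 : bdist U (bsum (flat u) M0) <= eps / 4).
    { apply (@bsums_dist_le X (flat u) U _ _ M0 HU). intros n Hn.
      eapply Rle_trans; [apply (@bdist_bsum_tail _ (flat u) (flat r)); auto|apply HM0; auto].
      intro; apply Hr. }
    pose proof (bdist_triangle (dsum u N J) (bsum phi N) U).
    pose proof (bdist_triangle (bsum (flat u) M0) (dsum u N J) U).
    rewrite (bdist_sym (bsum (flat u) M0) U) in H0. lra.
Qed.

End Double_series.

(** * Weighted brick series *)

(* A brick [w * 1_[lo, hi]] together with a majorant [bm >= |w|]; surplus mass makes it
   possible to exclude a null set without changing the sum of the series. *)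
Record brick (X : Banach) := Brick { lo : R; hi : R; bw : X; bm : R }.

Definition zero_brick (X : Banach) (a : R) : brick X := Brick a a bzero 0.

(** A brick of length zero with majorant 1. Repeated infinitely often it adds no mass, yet the
    majorant series diverges at [p], so nothing is required of the represented function there. *)
Definition kill_brick (X : Banach) (p : R) : brick X := Brick p p bzero 1.

Section Bricks.
Variable X : Banach.
Implicit Types (beta : nat -> brick X) (b : brick X).

Definition mass b : R := (hi b - lo b) * bm b.
Definition mass_at (s : R) b : R := ind (lo b) (hi b) s * bm b.
Definition value b : X := (hi b - lo b) [*] bw b.
Definition value_at (s : R) b : X := ind (lo b) (hi b) s [*] bw b.

Definition brick_in (a c : R) b : Prop := a <= lo b <= hi b /\ hi b <= c /\ bnorm (bw b) <= bm b.

Definition finite_at beta (s : R) : Prop := exists A, forall n, rsum (fun k => mass_at s (beta k)) n <= A.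

(** The bound [S] on the total mass is recorded along with the value because countably many
    integrals can be added only when their masses are summable. *)
Definition represents beta (f : R -> X) (a c : R) (v : X) (S : R) : Prop :=
  (forall k, brick_in a c (beta k)) /\
  (forall n, rsum (fun k => mass (beta k)) n <= S) /\
  (forall s, a < s < c -> finite_at beta s -> bsums (fun k => value_at s (beta k)) (f s)) /\
  bsums (fun k => value (beta k)) v.

Definition Integ (f : R -> X) (a c : R) (v : X) (S : R) : Prop :=
  a <= c /\ exists beta, represents beta f a c v S.

Lemma ind_range c d s : 0 <= ind c d s <= 1.
Proof. unfold ind. destruct (Rle_dec c s), (Rle_dec s d); lra. Qed.

Lemma ind_in c d s : c <= s <= d -> ind c d s = 1.
Proof. intros. unfold ind. destruct (Rle_dec c s), (Rle_dec s d); lra. Qed.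

Lemma ind_out c d s : ~ (c <= s <= d) -> ind c d s = 0.
Proof. intros. unfold ind. destruct (Rle_dec c s), (Rle_dec s d); lra. Qed.

Lemma bm_nonneg a c b : brick_in a c b -> 0 <= bm b.
Proof. intros (H1 & H2 & H3). pose proof (bnorm_nonneg _ (bw b)). lra. Qed.

Lemma bnorm_value a c b : brick_in a c b -> bnorm (value b) <= mass b.
Proof.
  intros (H1 & H2 & H3). unfold value, mass. rewrite bnorm_scal, Rabs_pos_eq by lra.
  apply Rmult_le_compat_l; lra.
Qed.

Lemma bnorm_value_at a c s b : brick_in a c b -> bnorm (value_at s b) <= mass_at s b.
Proof.
  intros (H1 & H2 & H3). unfold value_at, mass_at. pose proof (ind_range (lo b) (hi b) s).
  rewrite bnorm_scal, Rabs_pos_eq by lra.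
  apply Rmult_le_compat_l; lra.
Qed.

Lemma mass_nonneg a c b : brick_in a c b -> 0 <= mass b.
Proof. intro H. eapply Rle_trans; [apply bnorm_nonneg | eapply bnorm_value; eauto]. Qed.

Lemma mass_at_nonneg a c s b : brick_in a c b -> 0 <= mass_at s b.
Proof. intro H. eapply Rle_trans; [apply bnorm_nonneg | eapply bnorm_value_at; eauto]. Qed.

Lemma brick_in_mono a c a' c' b : a' <= a -> c <= c' -> brick_in a c b -> brick_in a' c' b.
Proof. unfold brick_in. intros; lra. Qed.

Lemma finite_at_summable a c beta s : (forall k, brick_in a c (beta k)) -> finite_at beta s ->
  exists l, bsums (fun k => value_at s (beta k)) l.
Proof.
  intros Hb [A HA]. apply (@abs_summable X _ (fun k => mass_at s (beta k)) A); auto.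
  intro k. eapply bnorm_value_at; eauto.
Qed.

Lemma mass_summable a c beta S : (forall k, brick_in a c (beta k)) ->
  (forall n, rsum (fun k => mass (beta k)) n <= S) ->
  exists l, bsums (fun k => value (beta k)) l.
Proof.
  intros Hb HA. apply (@abs_summable X _ (fun k => mass (beta k)) S); auto.
  intro k. eapply bnorm_value; eauto.
Qed.

(** All rows are flattened into one brick series, and [double_series] is used twice: once for the
    values and once at each point. Where the flat majorant series is finite, every row is finite and
    the row sums are absolutely summable, so the pointwise hypothesis is asked for only in that
    situation. *)
Lemma merge (beta : nat -> nat -> brick X) (f : R -> X) a c (v : nat -> X) (S : nat -> R) S' :
  a <= c ->
  (forall n k, brick_in a c (beta n k)) ->
  (forall n N, rsum (fun k => mass (beta n k)) N <= S n) ->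
  (forall N, rsum S N <= S') ->
  (forall n, bsums (fun k => value (beta n k)) (v n)) ->
  (forall s (phi : nat -> X), a < s < c -> (forall n, finite_at (beta n) s) ->
     (forall n, bsums (fun k => value_at s (beta n k)) (phi n)) ->
     (exists A, forall N, rsum (fun n => bnorm (phi n)) N <= A) -> bsums phi (f s)) ->
  exists v', bsums v v' /\ Integ f a c v' S'.
Proof.
  intros Hac Hin Hmass HS Hv Hpt.
  assert (HM : forall M, rsum (flat (fun n k => mass (beta n k))) M <= S').
  { intro M. eapply Rle_trans;
      [apply (@rsum_flat_le_dsum X (fun n k => value (beta n k)) (fun n k => mass (beta n k)))|].
    - intros. eapply bnorm_value; eauto.
    - eapply Rle_trans; [|apply (HS M)]. unfold dsum. apply rsum_le; intros. apply Hmass. }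
  destruct (@double_series X (fun n k => value (beta n k)) (fun n k => mass (beta n k))
    (fun n j => bnorm_value (Hin n j)) v S' HM Hv) as [_ [U [HU1 HU2]]].
  exists U. split; auto. split; auto. exists (flat beta). split; [|split; [|split]].
  - intro k. apply Hin.
  - exact HM.
  - intros s Hs [A HA].
    assert (Hb : forall n j, bnorm (value_at s (beta n j)) <= mass_at s (beta n j))
      by (intros; eapply bnorm_value_at; eauto).
    assert (Hfin : forall n, finite_at (beta n) s).
    { intro n. exists A. intro J.
      apply (@row_le_flat X (fun n j => value_at s (beta n j)) (fun n j => mass_at s (beta n j)));
        auto. }
    destruct (choice (fun n l => bsums (fun k => value_at s (beta n k)) l)) as [phi Hphi].
    { intro n. apply (finite_at_summable (Hin n) (Hfin n)). }
    destruct (@double_series X (fun n k => value_at s (beta n k))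
      (fun n k => mass_at s (beta n k)) Hb phi A HA Hphi) as [HN [W [HW1 HW2]]].
    replace (f s) with W; auto.
    apply (bsums_unique HW2). apply Hpt; eauto.
  - exact HU1.
Qed.

Lemma brick_in_zero a c p : a <= p <= c -> brick_in a c (zero_brick X p).
Proof. intros. unfold brick_in; simpl. rewrite bnorm_0. lra. Qed.

Lemma brick_in_kill a c p : a <= p <= c -> brick_in a c (kill_brick X p).
Proof. intros. unfold brick_in; simpl. rewrite bnorm_0. lra. Qed.

Lemma kill_not_finite p : ~ finite_at (fun _ => kill_brick X p) p.
Proof.
  intros [A HA]. destruct (INR_unbounded A) as [n Hn]. specialize (HA n).
  unfold mass_at in HA. simpl in HA. rewrite ind_in in HA by lra.
  rewrite rsum_const in HA. lra.
Qed.

Lemma rsum_finite_le (u : nat -> R) n0 N :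
  (forall k, 0 <= u k) -> (forall k, (n0 <= k)%nat -> u k = 0) -> rsum u N <= rsum u n0.
Proof.
  intros H0 H. destruct (Nat.le_gt_cases n0 N) as [Hc|Hc].
  - induction Hc; [lra|]. simpl. rewrite (H m) by lia. lra.
  - apply rsum_mono; auto; lia.
Qed.

(** Besides the two series, two rows of kill bricks remove the points [p] and [q]. This allows for
    end points, where a glued or extended function is not controlled by its pieces. *)
Lemma merge_two p q beta1 beta2 (f : R -> X) a c (v1 v2 : X) S1 S2 :
  a <= p <= c -> a <= q <= c ->
  (forall k, brick_in a c (beta1 k)) -> (forall k, brick_in a c (beta2 k)) ->
  (forall n, rsum (fun k => mass (beta1 k)) n <= S1) ->
  (forall n, rsum (fun k => mass (beta2 k)) n <= S2) ->
  bsums (fun k => value (beta1 k)) v1 -> bsums (fun k => value (beta2 k)) v2 ->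
  (forall s phi1 phi2, a < s < c -> s <> p -> s <> q -> finite_at beta1 s -> finite_at beta2 s ->
     bsums (fun k => value_at s (beta1 k)) phi1 -> bsums (fun k => value_at s (beta2 k)) phi2 ->
     f s = phi1 [+] phi2) ->
  Integ f a c (v1 [+] v2) (S1 + S2).
Proof.
  intros Hp Hq H1 H2 HS1 HS2 Hv1 Hv2 Hpt.
  pose (beta := fun n => match n with
    | 0%nat => beta1 | 1%nat => beta2 | 2%nat => fun _ => kill_brick X p
    | 3%nat => fun _ => kill_brick X q | _ => fun _ => zero_brick X a end).
  pose (S := fun n => match n with 0%nat => S1 | 1%nat => S2 | _ => 0 end).
  pose (v := fun n => match n with 0%nat => v1 | 1%nat => v2 | _ => bzero end).
  assert (Hz : forall r w m n, rsum (fun _ : nat => mass (Brick r r (w : X) m)) n <= 0).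
  { intros. rewrite rsum_const. unfold mass; simpl. right; ring. }
  assert (HS1' := HS1 0%nat). assert (HS2' := HS2 0%nat). simpl in HS1', HS2'.
  destruct (@merge beta f a c v S (S1 + S2)) as [v' [Hv' HI]].
  - lra.
  - intros [|[|[|[|n]]]] k; simpl; auto; try (apply brick_in_kill; auto).
    apply brick_in_zero; lra.
  - intros [|[|[|[|n]]]] k; simpl; auto; apply Hz.
  - intro N. eapply Rle_trans; [apply (@rsum_finite_le S 2 N)|simpl; lra].
    + intros [|[|n]]; simpl; lra.
    + intros [|[|n]] Hn; simpl; auto; lia.
  - assert (Hzero : forall r m, bsums (fun _ => value (Brick r r (bzero : X) m)) bzero).
    { intros. apply bsums_zero. intro. unfold value; simpl. apply bscal_0r. }
    intros [|[|[|[|n]]]]; simpl; auto; apply Hzero.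
  - intros s phi Hs Hfin Hphi _.
    assert (Hzero : forall n, (2 <= n)%nat -> phi n = bzero).
    { intros n Hn. apply (bsums_unique (Hphi n)). apply bsums_zero. intro k.
      destruct n as [|[|[|[|n]]]]; try lia; unfold value_at; simpl; apply bscal_0r. }
    rewrite (Hpt s (phi 0%nat) (phi 1%nat)); auto.
    + replace (phi 0%nat [+] phi 1%nat) with (bsum phi 2) by (simpl; rewrite badd_0l; auto).
      apply bsums_finite; auto.
    + intros ->. apply (kill_not_finite (Hfin 2%nat)).
    + intros ->. apply (kill_not_finite (Hfin 3%nat)).
    + apply (Hfin 0%nat).
    + apply (Hfin 1%nat).
    + apply (Hphi 0%nat).
    + apply (Hphi 1%nat).
  - replace (v1 [+] v2) with v'; auto. apply (bsums_unique Hv').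
    replace (v1 [+] v2) with (bsum v 2) by (simpl; rewrite badd_0l; auto).
    apply bsums_finite. intros [|[|n]] Hn; simpl; auto; lia.
Qed.

Lemma Integ_ext (f g : R -> X) a c v S :
  (forall s, a < s < c -> f s = g s) -> Integ f a c v S -> Integ g a c v S.
Proof.
  intros H [Hac [beta (H1 & H2 & H3 & H4)]]. split; auto. exists beta.
  repeat split; auto; try apply H1. intros s Hs Hf. rewrite <- H by auto. auto.
Qed.

Lemma Integ_mono_bound (f : R -> X) a c v S S' : S <= S' -> Integ f a c v S -> Integ f a c v S'.
Proof.
  intros H [Hac [beta (H1 & H2 & H3 & H4)]]. split; auto. exists beta.
  repeat split; auto; try apply H1. intros; eapply Rle_trans; eauto.
Qed.

Lemma Integ_add (f g : R -> X) a c v w S S' :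
  Integ f a c v S -> Integ g a c w S' ->
  Integ (fun s => f s [+] g s) a c (v [+] w) (S + S').
Proof.
  intros [Hac [beta (H1 & H2 & H3 & H4)]] [_ [gamma (G1 & G2 & G3 & G4)]].
  apply (@merge_two a a beta gamma); auto; try lra.
  intros s phi1 phi2 Hs _ _ F1 F2 B1 B2.
  rewrite (bsums_unique (H3 s Hs F1) B1), (bsums_unique (G3 s Hs F2) B2). auto.
Qed.

Lemma value_at_out s b : ~ (lo b <= s <= hi b) -> value_at s b = bzero.
Proof. intro H. unfold value_at. rewrite ind_out by auto. apply bscal_0l. Qed.

Lemma Integ_zero a c : a <= c -> Integ (fun _ => bzero : X) a c bzero 0.
Proof.
  intro H. split; auto. exists (fun _ => zero_brick X a). split; [|split; [|split]].
  - intro. apply brick_in_zero; lra.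
  - intro n. rewrite rsum_const. unfold mass; simpl; right; ring.
  - intros. apply bsums_zero. intro. apply bscal_0r.
  - apply bsums_zero. intro. apply bscal_0r.
Qed.

(** At [a] and [c] nothing is known about [g], and bricks may end there; these are the two points
    that get removed. *)
Lemma Integ_extend (f g : R -> X) a c a' c' v S :
  a' <= a -> c <= c' -> (forall s, a < s < c -> g s = f s) ->
  (forall s, s < a \/ c < s -> g s = bzero) ->
  Integ f a c v S -> Integ g a' c' v S.
Proof.
  intros Ha Hc Hin Hout [Hac [beta (H1 & H2 & H3 & H4)]].
  replace v with (v [+] bzero) by (apply badd_0).
  replace S with (S + 0) by ring.
  destruct (@Integ_zero a' c') as [_ [gamma (G1 & G2 & G3 & G4)]]; [lra|].
  apply (@merge_two a c beta gamma); auto; try lra.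
  - intro k. apply (brick_in_mono Ha Hc (H1 k)).
  - intros s phi1 phi2 Hs Hsa Hsc F1 F2 B1 B2.
    rewrite <- (bsums_unique (G3 s Hs F2) B2), badd_0.
    destruct (Rlt_dec s a); [|destruct (Rlt_dec c s)].
    + rewrite Hout by auto. apply (@bsums_unique X (fun k => value_at s (beta k))); auto.
      apply bsums_zero. intro k. apply value_at_out. destruct (H1 k). lra.
    + rewrite Hout by auto. apply (@bsums_unique X (fun k => value_at s (beta k))); auto.
      apply bsums_zero. intro k. apply value_at_out. destruct (H1 k) as (?&?&?). lra.
    + rewrite Hin by lra. apply (@bsums_unique X (fun k => value_at s (beta k))); auto.
      apply H3; auto; lra.
Qed.

(** The common end [m] is interior to neither piece and may be touched by bricks of both, so it is
    removed. *)
Lemma Integ_concat (f : R -> X) a m c v w S S' :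
  Integ f a m v S -> Integ f m c w S' -> Integ f a c (v [+] w) (S + S').
Proof.
  intros [Hac [beta (H1 & H2 & H3 & H4)]] [Hmc [gamma (G1 & G2 & G3 & G4)]].
  apply (@merge_two m m beta gamma); auto; try lra.
  - intro k. apply (brick_in_mono (a := a) (c := m)); auto; lra.
  - intro k. apply (brick_in_mono (a := m) (c := c)); auto; lra.
  - intros s phi1 phi2 Hs Hsm _ F1 F2 B1 B2.
    destruct (Rlt_dec s m).
    + replace phi2 with (bzero : X).
      * rewrite badd_0. apply (fun H => bsums_unique H B1). apply H3; auto; lra.
      * apply (fun H => bsums_unique H B2). apply bsums_zero; intro k.
        apply value_at_out. destruct (G1 k) as (?&?&?). lra.
    + replace phi1 with (bzero : X).
      * rewrite badd_0l. apply (fun H => bsums_unique H B2). apply G3; auto; lra.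
      * apply (fun H => bsums_unique H B1). apply bsums_zero; intro k.
        apply value_at_out. destruct (H1 k) as (?&?&?). lra.
Qed.

Lemma bsum_shift (u : nat -> X) n : bsum u (S n) = u O [+] bsum (fun k => u (S k)) n.
Proof. induction n; simpl in *; [vring|]. rewrite IHn. vring. Qed.

Lemma rsum_shift (u : nat -> R) n : rsum u (S n) = u O + rsum (fun k => u (S k)) n.
Proof. induction n; simpl in *; [ring|]. rewrite IHn. ring. Qed.

Lemma bsums_shift (u : nat -> X) l : u O = bzero -> (bsums u l <-> bsums (fun k => u (S k)) l).
Proof.
  intro H0. split; intros H eps He; destruct (H eps He) as [N HN].
  - exists N; intros n Hn. specialize (HN (S n) ltac:(lia)).
    rewrite bsum_shift, H0, badd_0l in HN. auto.
  - exists (S N). intros [|n] Hn; [lia|]. specialize (HN n ltac:(lia)).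
    rewrite bsum_shift, H0, badd_0l. auto.
Qed.

(** The bricks [gamma] enter with weight zero as an additional first row. They contribute their
    majorants only, and thereby restrict the points at which the series of functions has to converge
    to those where [gamma] is finite. *)
Lemma Integ_sum (f : nat -> R -> X) (g : R -> X) a c (v : nat -> X) (S : nat -> R) S' T gamma :
  a <= c ->
  (forall n, Integ (f n) a c (v n) (S n)) -> (forall N, rsum S N <= S') ->
  (forall k, brick_in a c (gamma k)) -> (forall n, rsum (fun k => mass (gamma k)) n <= T) ->
  (forall s, a < s < c -> finite_at gamma s ->
     (exists A, forall N, rsum (fun n => bnorm (f n s)) N <= A) -> bsums (fun n => f n s) (g s)) ->
  exists v', bsums v v' /\ Integ g a c v' (T + S').
Proof.
  intros Hac Hf HS Hg HT Hpt.
  destruct (choice (fun n beta => represents beta (f n) a c (v n) (S n))) as [beta Hbeta].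
  { intro n. apply (Hf n). }
  pose (B := fun n => match n with
    | O => fun k => Brick (lo (gamma k)) (hi (gamma k)) (bzero : X) (bm (gamma k))
    | Datatypes.S n => beta n end).
  pose (V := fun n => match n with O => bzero | Datatypes.S n => v n end).
  pose (Q := fun n => match n with O => T | Datatypes.S n => S n end).
  destruct (@merge B g a c V Q (T + S')) as [v' [Hv' HI]]; auto.
  - intros [|n] k; simpl.
    + destruct (Hg k) as (?&?&?). unfold brick_in; simpl. rewrite bnorm_0.
      pose proof (bm_nonneg (Hg k)). lra.
    + apply (proj1 (Hbeta n)).
  - intros [|n] N; simpl; [apply (HT N)|]. apply (proj1 (proj2 (Hbeta n))).
  - intros [|N].
    + simpl. pose proof (HT O). pose proof (HS O). simpl in *; lra.
    + rewrite rsum_shift. simpl. pose proof (HS N).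
      change (T + rsum S N <= T + S'). lra.
  - intros [|n]; simpl.
    + apply bsums_zero. intro. apply bscal_0r.
    + apply (Hbeta n).
  - intros s phi Hs Hfin Hphi [A HA].
    assert (E0 : phi O = bzero).
    { apply (bsums_unique (Hphi O)). apply bsums_zero. intro. apply bscal_0r. }
    assert (E : forall n, phi (Datatypes.S n) = f n s).
    { intro n. apply (bsums_unique (Hphi (Datatypes.S n))).
      apply (Hbeta n); auto. apply (Hfin (Datatypes.S n)). }
    apply bsums_shift; auto.
    apply (@bsums_ext X (fun n => f n s)); [intro; symmetry; apply E|].
    apply Hpt; auto.
    + apply (Hfin O).
    + exists A. intro N. eapply Rle_trans; [|apply (HA (Datatypes.S N))].
      rewrite rsum_shift, E0, bnorm_0, Rplus_0_l. right. apply psum_ext. intros; rewrite E; auto.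
  - exists v'; split; auto. apply (proj1 (@bsums_shift V v' eq_refl)) in Hv'. exact Hv'.
Qed.

Lemma Integ_const (w : X) a c : a <= c ->
  Integ (fun _ => w) a c ((c - a) [*] w) ((c - a) * bnorm w).
Proof.
  intro H. split; auto.
  pose (beta := fun n => match n with O => Brick a c w (bnorm w) | _ => zero_brick X a end).
  pose proof (bnorm_nonneg _ w).
  exists beta. split; [|split; [|split]].
  - intros [|k]; simpl; [unfold brick_in; simpl; lra | apply brick_in_zero; lra].
  - intro n. eapply Rle_trans; [apply (@rsum_finite_le _ 1 n)|].
    + intros [|k]; simpl; unfold mass; simpl; [apply Rmult_le_pos|]; lra.
    + intros [|k] Hk; [lia|]. unfold mass; simpl; ring.
    + simpl. unfold mass; simpl. lra.
  - intros s Hs _. replace w with (value_at s (beta O)).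
    + apply (@bsums_single X (fun k => value_at s (beta k)) O).
      intros [|k] Hk; [lia|]. apply bscal_0r.
    + unfold value_at; simpl. rewrite ind_in by lra. apply bscal_1.
  - apply (@bsums_single X (fun k => value (beta k)) O).
      intros [|k] Hk; [lia|]. apply bscal_0r.
Qed.

(** * Restriction to subintervals and images under bounded operators *)

Definition clip (a c r : R) : R := Rmax a (Rmin c r).

Lemma clip_range a c r : a <= c -> a <= clip a c r <= c.
Proof. intros. unfold clip, Rmax, Rmin. repeat destruct Rle_dec; lra. Qed.

Lemma clip_diff a c r r' : a <= c -> r <= r' ->
  0 <= clip a c r' - clip a c r /\ clip a c r' - clip a c r <= c - a
  /\ clip a c r' - clip a c r <= r' - r.
Proof. intros. unfold clip, Rmax, Rmin. repeat destruct Rle_dec; lra. Qed.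

(** A brick that misses [a,c] is collapsed onto an end point, hence the restriction to interior
    [s]. *)
Lemma ind_clip a c x y s : a < s < c -> ind (clip a c x) (clip a c y) s = ind x y s.
Proof.
  intro H. unfold ind.
  assert (E1 : clip a c x <= s <-> x <= s)
    by (unfold clip, Rmax, Rmin; repeat destruct Rle_dec; lra).
  assert (E2 : s <= clip a c y <-> s <= y)
    by (unfold clip, Rmax, Rmin; repeat destruct Rle_dec; lra).
  destruct (Rle_dec x s), (Rle_dec (clip a c x) s); try tauto;
  destruct (Rle_dec s y), (Rle_dec s (clip a c y)); tauto.
Qed.

Lemma rsum_split_le (u : nat -> R) N n c :
  (forall k, 0 <= u k) -> (forall m, (N <= m)%nat -> rsum u m - rsum u N <= c) -> 0 <= c ->
  rsum u n <= rsum u N + c.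
Proof.
  intros Hu H Hc. destruct (Nat.le_gt_cases N n) as [Hn|Hn].
  - specialize (H n Hn). lra.
  - assert (rsum u n <= rsum u N) by (apply rsum_mono; auto; lia). lra.
Qed.

(** Absolute continuity of the integral: clip all bricks to the subinterval. The first [N]
    contribute at most its length times the sum of their majorants, the others at most the tail of
    the masses. *)
Lemma Integ_restrict_small (f : R -> X) a c v S eps :
  Integ f a c v S -> 0 < eps ->
  exists delta, 0 < delta /\
    forall a' c', a <= a' -> a' <= c' -> c' <= c -> c' - a' < delta ->
    exists v', Integ f a' c' v' S /\ bnorm v' <= eps.
Proof.
  intros [Hac [beta (H1 & H2 & H3 & H4)]] He.
  assert (Hm0 : forall k, 0 <= mass (beta k)) by (intro; eapply mass_nonneg; eauto).
  destruct (rsum_tail_small (eps := eps / 2) Hm0 H2) as [N HN]; [lra|].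
  set (B := rsum (fun k => bm (beta k)) N).
  assert (HB : 0 <= B) by (apply rsum_nonneg; intro; eapply bm_nonneg; eauto).
  (* Keeps the first [N] clipped bricks below [eps / 2]; [B + 1] avoids a division by zero. *)
  exists (eps / 2 / (B + 1)). split; [apply Rdiv_lt_0_compat; lra|].
  intros a' c' Ha Hac' Hc Hd.
  pose (beta' := fun k => Brick (clip a' c' (lo (beta k))) (clip a' c' (hi (beta k)))
                               (bw (beta k)) (bm (beta k))).
  assert (Hin : forall k, brick_in a' c' (beta' k)).
  { intro k. destruct (H1 k) as (?&?&?). unfold brick_in; simpl.
    pose proof (clip_range (lo (beta k)) Hac'). pose proof (clip_range (hi (beta k)) Hac').
    assert (lo (beta k) <= hi (beta k)) by lra.
    pose proof (@clip_diff a' c' (lo (beta k)) (hi (beta k))). lra. }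
  assert (Hmass : forall k, mass (beta' k) <= mass (beta k)).
  { intro k. unfold mass; simpl. apply Rmult_le_compat_r; [eapply bm_nonneg; eauto|].
    destruct (H1 k) as (?&?&?). apply clip_diff; lra. }
  assert (Hmass' : forall k, mass (beta' k) <= (c' - a') * bm (beta k)).
  { intro k. unfold mass; simpl. apply Rmult_le_compat_r; [eapply bm_nonneg; eauto|].
    destruct (H1 k) as (?&?&?). apply clip_diff; lra. }
  assert (HS : forall n, rsum (fun k => mass (beta' k)) n <= S).
  { intro n. eapply Rle_trans; [apply rsum_le; intros; apply Hmass | apply H2]. }
  destruct (mass_summable Hin HS) as [v' Hv'].
  exists v'. split.
  - split; auto. exists beta'. repeat split; auto; try apply Hin.
    intros s Hs [A HA].
    apply (@bsums_ext X (fun k => value_at s (beta k))).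
    + intro k. unfold value_at; simpl. rewrite ind_clip; auto.
    + apply H3; [lra|]. exists A. intro n. eapply Rle_trans; [|apply (HA n)].
      right; apply psum_ext. intros. unfold mass_at; simpl. rewrite ind_clip; auto.
  - apply (@bsums_norm_le X _ (fun k => mass (beta' k)) v' eps Hv').
    + intro. eapply bnorm_value; eauto.
    + assert (Hm0' : forall k, 0 <= mass (beta' k)) by (intro; eapply mass_nonneg; eauto).
      intro n. apply Rle_trans with (rsum (fun k => mass (beta' k)) N + eps / 2).
      * apply rsum_split_le; auto; [|lra]. intros m Hm.
        eapply Rle_trans; [|apply (HN m Hm)].
        clear - Hmass Hm. induction Hm; simpl; [lra|]. specialize (Hmass m). lra.
      * assert (rsum (fun k => mass (beta' k)) N <= (c' - a') * B).
        { unfold B. rewrite <- rsum_scal. apply rsum_le; auto. }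
        assert ((c' - a') * B <= eps / 2 / (B + 1) * (B + 1)).
        { apply Rmult_le_compat; lra. }
        replace (eps / 2 / (B + 1) * (B + 1)) with (eps / 2) in H0 by (field; lra).
        lra.
Qed.

End Bricks.

(** The operator is applied to the weights and the majorants are multiplied by [K]. As [K] is
    positive, the scaled majorant series is finite at the same points as before. *)
Lemma Integ_map (X Y : Banach) (A : X -> Y) K (f : R -> X) a c v S :
  0 < K -> (forall x y, A (x [+] y) = A x [+] A y) -> (forall r x, A (r [*] x) = r [*] A x) ->
  (forall x, bnorm (A x) <= K * bnorm x) ->
  Integ f a c v S -> Integ (fun s => A (f s)) a c (A v) (K * S).
Proof.
  intros HK Ha Hs HA [Hac [beta (H1 & H2 & H3 & H4)]]. split; auto.
  exists (fun k => Brick (lo (beta k)) (hi (beta k)) (A (bw (beta k))) (K * bm (beta k))).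
  split; [|split; [|split]].
  - intro k. destruct (H1 k) as (?&?&?). unfold brick_in; simpl. repeat split; try lra.
    eapply Rle_trans; [apply HA|]. apply Rmult_le_compat_l; lra.
  - intro n. apply Rle_trans with (K * rsum (fun k => mass (beta k)) n).
    + rewrite <- rsum_scal. right. apply psum_ext. intros. unfold mass; simpl. ring.
    + apply Rmult_le_compat_l; auto; lra.
  - intros s Hsc [M HM].
    apply (@bsums_ext Y (fun k => A (value_at s (beta k)))).
    + intro. unfold value_at; simpl. apply Hs.
    + apply (bsums_map Ha Hs HA). apply H3; auto. exists (M / K). intro n.
      apply Rmult_le_reg_l with K; auto. rewrite <- rsum_scal.
      replace (K * (M / K)) with M by (field; lra).
      eapply Rle_trans; [|apply (HM n)]. right. apply psum_ext. intros.
      unfold mass_at; simpl; ring.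
  - apply (@bsums_ext Y (fun k => A (value (beta k)))).
    + intro. unfold value; simpl. apply Hs.
    + apply (bsums_map Ha Hs HA H4).
Qed.

(** * Comparison with the integral of the statement *)

Definition interleave V (x y : nat -> V) (m : nat) : V :=
  if Nat.even m then x (Nat.div2 m) else y (Nat.div2 m).

Lemma interleave_even V (x y : nat -> V) k : interleave x y (2 * k) = x k.
Proof. unfold interleave. rewrite Nat.even_mul, Nat.div2_double. auto. Qed.

Lemma interleave_odd V (x y : nat -> V) k : interleave x y (S (2 * k)) = y k.
Proof.
  unfold interleave. rewrite Nat.even_succ, Nat.odd_mul, Nat.div2_succ_double. auto.
Qed.

Lemma interleave_prop V (Q : V -> Prop) (x y : nat -> V) :
  (forall k, Q (x k)) -> (forall k, Q (y k)) -> forall m, Q (interleave x y m).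
Proof. intros Hx Hy m. unfold interleave. destruct (Nat.even m); auto. Qed.

Lemma interleave_map V W (h : V -> W) (x y : nat -> V) m :
  h (interleave x y m) = interleave (fun k => h (x k)) (fun k => h (y k)) m.
Proof. unfold interleave. destruct (Nat.even m); auto. Qed.

Lemma bsum_interleave (X : Banach) (x y : nat -> X) n :
  bsum (interleave x y) (2 * n) = bsum (fun k => x k [+] y k) n.
Proof.
  induction n; auto. replace (2 * S n)%nat with (S (S (2 * n))) by lia.
  simpl psum at 1. change (n + (n + 0))%nat with (2 * n)%nat.
  rewrite IHn, interleave_even, interleave_odd. simpl. vring.
Qed.

Lemma rsum_interleave (x y : nat -> R) n :
  rsum (interleave x y) (2 * n) = rsum x n + rsum y n.
Proof. rewrite <- rsum_plus. exact (@bsum_interleave RB x y n). Qed.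

Lemma rsum_interleave_le (x y : nat -> R) A B n :
  (forall k, 0 <= x k) -> (forall k, 0 <= y k) ->
  (forall n, rsum x n <= A) -> (forall n, rsum y n <= B) ->
  rsum (interleave x y) n <= A + B.
Proof.
  intros Hx Hy HA HB. apply Rle_trans with (rsum (interleave x y) (2 * n)).
  - apply rsum_mono; [|lia]. apply interleave_prop; auto.
  - rewrite rsum_interleave. apply Rplus_le_compat; auto.
Qed.

Lemma bsum_interleave_map V (X : Banach) (h : V -> X) (x y : nat -> V) n :
  bsum (fun m => h (interleave x y m)) (2 * n) = bsum (fun k => h (x k) [+] h (y k)) n.
Proof.
  rewrite <- bsum_interleave. apply psum_ext. intros; apply interleave_map.
Qed.

Lemma rsum_interleave_map V (h : V -> R) (x y : nat -> V) n :
  rsum (fun m => h (interleave x y m)) (2 * n) = rsum (fun k => h (x k)) n + rsum (fun k => h (y k)) n.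
Proof.
  rewrite <- rsum_interleave. apply psum_ext. intros; apply interleave_map.
Qed.

Lemma rsum_interleave_map_le V (h : V -> R) (x y : nat -> V) A B n :
  (forall k, 0 <= h (x k)) -> (forall k, 0 <= h (y k)) ->
  (forall n, rsum (fun k => h (x k)) n <= A) -> (forall n, rsum (fun k => h (y k)) n <= B) ->
  rsum (fun m => h (interleave x y m)) n <= A + B.
Proof.
  intros Hx Hy HA HB.
  replace (rsum (fun m => h (interleave x y m)) n)
    with (rsum (interleave (fun k => h (x k)) (fun k => h (y k))) n)
    by (apply psum_ext; intros; symmetry; apply interleave_map).
  apply rsum_interleave_le; auto.
Qed.

Section Conversion.
Variable X : Banach.

Lemma BInt_Integ (f : R -> X) a c v : BInt f a c v -> exists S, Integ f a c v S.
Proof.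
  intros [Hac (lo & hi & w & Hin & [S HS] & Hpt & Hv)].
  exists S. split; auto. exists (fun k => Brick (lo k) (hi k) (w k) (bnorm (w k))).
  split; [|split; [|split]]; auto.
  - intro k. destruct (Hin k) as (?&?&?). unfold brick_in; simpl. lra.
Qed.

(* A unit vector [e] turns surplus mass [m] into the pair of bricks [w + m e], [- m e]. *)
Lemma Integ_BInt (f : R -> X) a c v S : Integ f a c v S -> BInt f a c v.
Proof.
  intros [Hac [beta (H1 & H2 & H3 & H4)]]. split; auto.
  (* The zero space has no unit vector, but there every series sums to everything. *)
  destruct (classic (forall x : X, x = bzero)) as [Htriv|Hnt].
  - exists (fun _ => a), (fun _ => a), (fun _ => bzero).
    assert (Hany : forall (u : nat -> X) l, bsums u l).
    { intros u l eps He. exists O. intros. unfold bdist. rewrite (Htriv (_ [-] _)), bnorm_0. auto. }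
    split; [intro; lra|]. split; [|split; intros; apply Hany].
    exists 0. intro n. rewrite rsum_const, bnorm_0. right; ring.
  - apply not_all_ex_not in Hnt. destruct Hnt as [e0 He0].
    assert (Hn0 : 0 < bnorm e0).
    { destruct (bnorm_nonneg _ e0) as [|E]; auto. exfalso; apply He0, bnorm_eq0; auto. }
    pose (e := / bnorm e0 [*] e0).
    assert (He : bnorm e = 1).
    { unfold e. rewrite bnorm_scal, Rabs_pos_eq; [field; lra|].
      left. apply Rinv_0_lt_compat; auto. }
    pose (b1 := fun k => Brick (lo (beta k)) (hi (beta k))
                          (bw (beta k) [+] bm (beta k) [*] e) (2 * bm (beta k))).
    pose (b2 := fun k => Brick (lo (beta k)) (hi (beta k))
                          (bopp (bm (beta k) [*] e)) (bm (beta k))).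
    pose (g := interleave b1 b2).
    assert (Hm : forall k, 0 <= bm (beta k)) by (intro; eapply bm_nonneg; eauto).
    assert (Hin1 : forall k, brick_in a c (b1 k)).
    { intro k. destruct (H1 k) as (?&?&?). unfold brick_in; simpl. repeat split; try lra.
      eapply Rle_trans; [apply bnorm_triangle|].
      rewrite bnorm_scal, He, Rabs_pos_eq by auto. lra. }
    assert (Hin2 : forall k, brick_in a c (b2 k)).
    { intro k. destruct (H1 k) as (?&?&?). unfold brick_in; simpl. repeat split; try lra.
      rewrite bnorm_opp, bnorm_scal, He, Rabs_pos_eq by auto. lra. }
    assert (Hin : forall m, brick_in a c (g m)) by (apply interleave_prop; auto).
    (* [co] stands for the length or for the indicator at a point. The two bricks of a pair add up
       to the original one, so the even partial sums are the original sums; absolute convergence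
       supplies the limit of the whole sequence. *)
    assert (Hsum : forall (co : brick X -> R) l M,
      (forall k, co (b1 k) = co (beta k)) -> (forall k, co (b2 k) = co (beta k)) ->
      (forall k, 0 <= co (g k)) ->
      (forall n, rsum (fun m => co (g m) * bnorm (bw (g m))) n <= M) ->
      bsums (fun k => co (beta k) [*] bw (beta k)) l ->
      bsums (fun m => co (g m) [*] bw (g m)) l).
    { intros co l M E1 E2 Hco HM Hl.
      destruct (@abs_summable X (fun m => co (g m) [*] bw (g m))
                  (fun m => co (g m) * bnorm (bw (g m))) M) as [l' Hl']; auto.
      { intro k. rewrite bnorm_scal, Rabs_pos_eq; auto; lra. }
      replace l with l'; auto.
      apply (fun H => bsums_unique_sub (phi := fun n => (2 * n)%nat) H Hl'); [intro; lia|].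
      intros eps Heps. destruct (Hl eps Heps) as [N HN]. exists N. intros n Hn.
      specialize (HN n Hn).
      unfold g. rewrite (bsum_interleave_map (fun b => co b [*] bw b)).
      replace (bsum (fun k => co (b1 k) [*] bw (b1 k) [+] co (b2 k) [*] bw (b2 k)) n)
        with (bsum (fun k => co (beta k) [*] bw (beta k)) n); auto.
      apply psum_ext. intros k _. rewrite E1, E2. simpl. vring. }
    exists (fun m => lo (g m)), (fun m => hi (g m)), (fun m => bw (g m)).
    split; [intro k; destruct (Hin k) as (?&?&?); lra|].
    assert (Hmass : forall n, rsum (fun m => mass (g m)) n <= 2 * S + S).
    { intro n. apply (rsum_interleave_map_le (h := @mass X)).
      - intro; eapply mass_nonneg; eauto.
      - intro; eapply mass_nonneg; eauto.
      - intro N. apply Rle_trans with (2 * rsum (fun k => mass (beta k)) N).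
        + rewrite <- rsum_scal. right; apply psum_ext. intros; unfold mass; simpl; ring.
        + apply Rmult_le_compat_l; auto; lra.
      - intro N. apply H2. }
    assert (Hlen : forall n, rsum (fun m => (hi (g m) - lo (g m)) * bnorm (bw (g m))) n <= 3 * S).
    { intro n. apply Rle_trans with (2 * S + S); [|lra]. eapply Rle_trans; [|apply (Hmass n)].
      apply rsum_le. intros k _. destruct (Hin k) as (?&?&?).
      unfold mass. apply Rmult_le_compat_l; lra. }
    split; [exists (3 * S); exact Hlen|]. split.
    + intros s Hs [M HM].
      apply (Hsum (fun b => ind (lo b) (hi b) s) (f s) M); auto.
      * intro. apply ind_range.
      (* The second brick of each pair has norm exactly [bm], so a finite sum of norms at [s] bounds
         the original majorants at [s]. *)
      * apply H3; auto. exists M. intro n. eapply Rle_trans; [|apply (HM (2 * n)%nat)].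
        unfold g. rewrite (rsum_interleave_map (fun b => ind (lo b) (hi b) s * bnorm (bw b))).
        match goal with |- ?x <= ?y + ?z => assert (x = z /\ 0 <= y); [|lra] end. split.
        -- apply psum_ext. intros k _. unfold mass_at. simpl.
           rewrite bnorm_opp, bnorm_scal, He, Rabs_pos_eq by auto. ring.
        -- apply rsum_nonneg. intro. apply Rmult_le_pos; [apply ind_range | apply bnorm_nonneg].
    + apply (Hsum (fun b => hi b - lo b) v (3 * S)); auto.
      intro k. destruct (Hin k) as (?&?&?). lra.
Qed.

End Conversion.

(** * Covering and comparison of integrals *)

(** Let [m] be the supremum of the points reached from [a]. The local property at [m] attaches to a
    reached point close to [m] and leads beyond [m] unless [m = c]. Additivity replaces an explicit
    tagged partition. *)
Lemma cousin (G : R -> R -> Prop) a c : a <= c ->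
  (forall u m v, a <= u <= m -> m <= v <= c -> G u m -> G m v -> G u v) ->
  (forall s, a <= s <= c -> exists delta, 0 < delta /\
     forall u v, a <= u <= s -> s <= v <= c -> s - delta < u -> v < s + delta -> G u v) ->
  G a c.
Proof.
  intros Hac Hadd Hloc.
  destruct (completeness (fun x => a <= x <= c /\ G a x)) as [m [Hub Hlub]].
  - exists c. intros x [Hx _]; lra.
  - exists a. split; [lra|]. destruct (Hloc a) as [d [Hd H]]; [lra|]. apply H; lra.
  - assert (Ham : a <= m).
    { apply Hub. split; [lra|]. destruct (Hloc a) as [d [Hd H]]; [lra|]. apply H; lra. }
    assert (Hmc : m <= c) by (apply Hlub; intros x [Hx _]; lra).
    destruct (Hloc m) as [d [Hd H]]; [lra|].
    destruct (classic (exists x, (a <= x <= c /\ G a x) /\ m - d < x)) as [[x [[Hx Gx] Hxm]]|Hno].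
    + assert (x <= m) by (apply Hub; auto).
      set (m' := Rmin c (m + d / 2)).
      assert (Hm' : m <= m' <= c /\ m' < m + d /\ (m' = c \/ m < m')).
      { unfold m', Rmin. destruct (Rle_dec c (m + d / 2)); lra. }
      assert (Gm' : G a m').
      { apply (Hadd a x m'); auto; try lra. apply H; lra. }
      destruct Hm' as (H1 & H2 & [E|E]); [rewrite <- E; auto|].
      assert (m' <= m) by (apply Hub; split; auto; lra). lra.
    + exfalso. assert (m <= m - d); [|lra]. apply Hlub. intros x Hx.
      apply Rnot_lt_le. intro. apply Hno. exists x; auto.
Qed.

Definition overlap (c d u v : R) : R := Rmax 0 (Rmin d v - Rmax c u).

Lemma overlap_nonneg c d u v : 0 <= overlap c d u v.
Proof. apply Rmax_l. Qed.

Lemma overlap_add c d u m v : c <= d -> u <= m <= v ->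
  overlap c d u v = overlap c d u m + overlap c d m v.
Proof. intros. unfold overlap, Rmax, Rmin. repeat destruct Rle_dec; lra. Qed.

Lemma overlap_le c d u v : c <= d -> u <= v -> overlap c d u v <= d - c /\ overlap c d u v <= v - u.
Proof. intros. unfold overlap, Rmax, Rmin. repeat destruct Rle_dec; lra. Qed.

Lemma overlap_inner c d u v : c <= u <= v -> v <= d -> overlap c d u v = v - u.
Proof. intros. unfold overlap, Rmax, Rmin. repeat destruct Rle_dec; lra. Qed.

Lemma overlap_outer c d u v : u <= c <= d -> d <= v -> overlap c d u v = d - c.
Proof. intros. unfold overlap, Rmax, Rmin. repeat destruct Rle_dec; lra. Qed.

Lemma overlap_out c d u v : c <= d -> u <= v -> v < c \/ d < u -> overlap c d u v = 0.
Proof. intros. unfold overlap, Rmax, Rmin. repeat destruct Rle_dec; lra. Qed.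

Lemma finite_min (eta : nat -> R) K : (forall k, 0 < eta k) ->
  exists delta, 0 < delta /\ forall k, (k < K)%nat -> delta <= eta k.
Proof.
  intro H. induction K as [|K [d [Hd IH]]].
  - exists 1. split; [lra|]. intros; lia.
  - exists (Rmin d (eta K)). split; [apply Rmin_pos; auto|].
    intros k Hk. destruct (Nat.eq_dec k K) as [->|]; [apply Rmin_r|].
    eapply Rle_trans; [apply Rmin_l | apply IH; lia].
Qed.

Lemma overlap_widened c d u v eta (rho eps : R) :
  c <= d -> u <= v -> 0 <= rho -> 0 < eta -> eta * rho <= eps ->
  rho * overlap (c - eta) (d + eta) u v <= (d - c) * rho + 2 * eps.
Proof.
  intros Hcd Huv Hr He H.
  destruct (@overlap_le (c - eta) (d + eta) u v) as [H1 _]; try lra.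
  apply Rle_trans with (rho * (d + eta - (c - eta))); [apply Rmult_le_compat_l; auto|]. nra.
Qed.

(* Widen the bricks a little, put small bricks at the exceptional points, and sum up over a
   fine partition. *)
Lemma covering (Psi : R -> R -> R) a c B (E lo hi rho : nat -> R) S :
  a <= c -> 0 <= B -> (forall k, lo k <= hi k) -> (forall k, 0 <= rho k) ->
  (forall n, rsum (fun k => (hi k - lo k) * rho k) n <= S) ->
  (forall u m v, a <= u <= m -> m <= v <= c -> Psi u v <= Psi u m + Psi m v) ->
  (forall u v, a <= u <= v -> v <= c -> Psi u v <= B * (v - u)) ->
  (forall s, a <= s <= c -> (forall k, s <> E k) -> forall eps, 0 < eps ->
     exists delta K, 0 < delta /\
       forall u v, a <= u <= s -> s <= v <= c -> s - delta < u -> v < s + delta ->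
       Psi u v <= (v - u) * (rsum (fun k => ind (lo k) (hi k) s * rho k) K + eps)) ->
  Psi a c <= S.
Proof.
  intros Hac HB Hlh Hrho HS Hsub Hbd Hloc. apply le_epsilon. intros eps Heps.
  (* The widened and the exceptional bricks will cost [8 * e1], the pointwise slack [e1 * (c - a)];
     together this is [eps - e1]. *)
  set (e1 := eps / (9 + (c - a))).
  assert (He1 : 0 < e1) by (apply Rdiv_lt_0_compat; lra).
  assert (Hpow : forall k, 0 < e1 * (/2)^k).
  { intro. apply Rmult_lt_0_compat; auto. apply pow_lt; lra. }
  (* Widening the k-th brick by [eta k] on both sides costs at most twice [e1 / 2^k], whatever its
     height; likewise for the bricks of height [B] around the exceptional points. *)
  pose (eta := fun k => e1 * (/2)^k / (1 + rho k)).
  pose (eta' := fun k => e1 * (/2)^k / (1 + B)).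
  assert (Heta : forall k, 0 < eta k).
  { intro. apply Rdiv_lt_0_compat; auto. specialize (Hrho k). lra. }
  assert (Heta' : forall k, 0 < eta' k) by (intro; apply Rdiv_lt_0_compat; auto; lra).
  assert (Hfrac : forall k r, 0 <= r -> e1 * (/2)^k / (1 + r) * r <= e1 * (/2)^k).
  { intros k r Hr. specialize (Hpow k). set (q := e1 * (/2)^k) in *.
    apply Rmult_le_reg_r with (1 + r); [lra|].
    replace (q / (1 + r) * r * (1 + r)) with (q * r) by (field; lra). nra. }
  pose (term := fun u v k => rho k * overlap (lo k - eta k) (hi k + eta k) u v
                           + B * overlap (E k - eta' k) (E k + eta' k) u v).
  assert (Hterm0 : forall u v k, 0 <= term u v k).
  { intros. unfold term. specialize (Hrho k).
    pose proof (overlap_nonneg (lo k - eta k) (hi k + eta k) u v).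
    pose proof (overlap_nonneg (E k - eta' k) (E k + eta' k) u v).
    apply Rplus_le_le_0_compat; apply Rmult_le_pos; auto. }
  (* The number [K] of terms may depend on the interval: all terms are nonnegative, so two intervals
     are joined with the larger number. *)
  assert (HG : exists K, Psi a c <= rsum (term a c) K + e1 * (c - a)).
  { apply (@cousin (fun u v => exists K, Psi u v <= rsum (term u v) K + e1 * (v - u)) a c Hac).
    - intros u m v Hu Hv [K1 HK1] [K2 HK2]. exists (Nat.max K1 K2).
      assert (rsum (term u m) K1 <= rsum (term u m) (Nat.max K1 K2))
        by (apply rsum_mono; auto; lia).
      assert (rsum (term m v) K2 <= rsum (term m v) (Nat.max K1 K2))
        by (apply rsum_mono; auto; lia).
      assert (rsum (term u v) (Nat.max K1 K2) =
              rsum (term u m) (Nat.max K1 K2) + rsum (term m v) (Nat.max K1 K2)).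
      { rewrite <- rsum_plus. apply psum_ext. intros k _. unfold term.
        specialize (Heta k). specialize (Heta' k). specialize (Hlh k).
        rewrite (@overlap_add _ _ u m v) by lra.
        rewrite (@overlap_add (E k - _) _ u m v) by lra. ring. }
      specialize (Hsub u m v Hu Hv). nra.
    - intros s Hs. destruct (classic (exists k, s = E k)) as [[k ->]|Hne].
      (* Near an exceptional point the crude bound [B * (v - u)] is paid by the brick of height [B]
         around it. *)
      + exists (eta' k). split; auto. intros u v Hu Hv Hu' Hv'. exists (Datatypes.S k).
        assert (B * (v - u) <= term u v k).
        { unfold term. rewrite (@overlap_inner (E k - eta' k)) by lra.
          pose proof (overlap_nonneg (lo k - eta k) (hi k + eta k) u v).
          specialize (Hrho k). nra. }
        assert (0 <= rsum (term u v) k) by (apply rsum_nonneg; auto).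
        assert (Psi u v <= B * (v - u)) by (apply Hbd; lra).
        simpl. assert (0 <= e1 * (v - u)) by (apply Rmult_le_pos; lra). lra.
      + destruct (Hloc s Hs) with (eps := e1) as [d [K [Hd H]]]; auto.
        { intros k Hk; apply Hne; eauto. }
        (* A brick among the first [K] that contains [s] then contains all of [u,v] after widening,
           so its overlap is the full length. *)
        destruct (finite_min K Heta) as [d' [Hd' Hmin]].
        exists (Rmin d d'). split; [apply Rmin_pos; auto|].
        intros u v Hu Hv Hu' Hv'. exists K.
        pose proof (Rmin_l d d'). pose proof (Rmin_r d d').
        eapply Rle_trans; [apply H; lra|].
        assert ((v - u) * rsum (fun k => ind (lo k) (hi k) s * rho k) K <= rsum (term u v) K);
          [|lra].
        rewrite <- rsum_scal. apply rsum_le. intros k Hk. specialize (Hmin k Hk).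
        apply Rle_trans with (rho k * overlap (lo k - eta k) (hi k + eta k) u v).
        * destruct (classic (lo k <= s <= hi k)) as [Hin|Hout].
          -- rewrite ind_in by auto. rewrite overlap_inner by lra. right; ring.
          -- rewrite ind_out by auto. rewrite Rmult_0_l, Rmult_0_r.
             apply Rmult_le_pos; auto. apply overlap_nonneg.
        * unfold term. assert (0 <= B * overlap (E k - eta' k) (E k + eta' k) u v); [|lra].
          apply Rmult_le_pos; auto. apply overlap_nonneg. }
  destruct HG as [K HK].
  assert (rsum (term a c) K <= S + 8 * e1).
  { apply Rle_trans with (rsum (fun k => (hi k - lo k) * rho k + 4 * e1 * (/2)^k) K).
    - apply rsum_le. intros k _. unfold term.
      pose proof (@overlap_widened (lo k) (hi k) a c (eta k) (rho k) (e1 * (/2)^k)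
        (Hlh k) Hac (Hrho k) (Heta k) (Hfrac k (rho k) (Hrho k))).
      pose proof (@overlap_widened (E k) (E k) a c (eta' k) B (e1 * (/2)^k)
        (Rle_refl _) Hac HB (Heta' k) (Hfrac k B HB)). lra.
    - rewrite rsum_plus. pose proof (HS K).
      pose proof (@rsum_geometric (4 * e1) K). lra. }
  assert (8 * e1 + e1 * (c - a) <= eps); [|lra].
  replace (8 * e1 + e1 * (c - a)) with (eps - e1); [lra|].
  unfold e1. field. lra.
Qed.

Definition tail_of (n : nat) (u : nat -> R) (k : nat) : R := if Nat.ltb k n then 0 else u k.

Lemma tail_of_nonneg n u : (forall k, 0 <= u k) -> forall k, 0 <= tail_of n u k.
Proof. intros H k. unfold tail_of. destruct (Nat.ltb k n); auto; lra. Qed.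

Lemma rsum_tail_of n u K : (n <= K)%nat -> rsum (tail_of n u) K = rsum u K - rsum u n.
Proof.
  intro H. induction H.
  - rewrite (psum_ext _ _ (v := fun _ => 0)).
    + rewrite rsum_const. ring.
    + intros k Hk. unfold tail_of. rewrite (proj2 (Nat.ltb_lt k n)); auto.
  - simpl. rewrite IHle. unfold tail_of. rewrite (proj2 (Nat.ltb_ge m n)) by lia. ring.
Qed.

Lemma rsum_tail_of_ge n u K : (forall k, 0 <= u k) ->
  rsum u K - rsum u n <= rsum (tail_of n u) K.
Proof.
  intro H. destruct (Nat.le_gt_cases n K) as [Hc|Hc].
  - rewrite rsum_tail_of; auto; lra.
  - assert (rsum u K <= rsum u n) by (apply rsum_mono; auto; lia).
    pose proof (@rsum_nonneg (tail_of n u) K (tail_of_nonneg n H)). lra.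
Qed.

Lemma rsum_tail_of_le n u K eps : (forall k, 0 <= u k) -> 0 <= eps ->
  (forall m, (n <= m)%nat -> rsum u m - rsum u n <= eps) -> rsum (tail_of n u) K <= eps.
Proof.
  intros H He Ht.
  apply Rle_trans with (rsum (tail_of n u) (Nat.max n K)).
  - apply rsum_mono; [apply tail_of_nonneg; auto | lia].
  - rewrite rsum_tail_of by lia. apply Ht. lia.
Qed.

Section Comparison.
Variables (X : Banach) (N : X -> R) (C : R).
Hypothesis N_add : forall x y, N (x [+] y) <= N x + N y.
Hypothesis N_scal : forall a x, N (a [*] x) = Rabs a * N x.
Hypothesis C_pos : 0 < C.
Hypothesis N_bnd : forall x, N x <= C * bnorm x.

Lemma seminorm_dist x y : N x <= N y + C * bdist x y.
Proof.
  replace x with (y [+] (x [-] y)) at 1 by vring.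
  eapply Rle_trans; [apply N_add|]. pose proof (N_bnd (x [-] y)). unfold bdist. lra.
Qed.

(** The integral over [u,v] of the step function given by the first [n] bricks. *)
Let step_part (beta : nat -> brick X) n u v : X :=
  bsum (fun k => overlap (lo (beta k)) (hi (beta k)) u v [*] bw (beta k)) n.

(** Each of the first [n] bricks either contains a neighbourhood of [s] or misses one, since [s] is
    not an end point. *)
Lemma step_part_locally_const (Y : Banach) (beta : nat -> brick Y) n s :
  (forall k, lo (beta k) <= hi (beta k)) ->
  (forall k, s <> lo (beta k)) -> (forall k, s <> hi (beta k)) ->
  exists delta, 0 < delta /\ forall u v, u <= s <= v -> s - delta < u -> v < s + delta ->
    bsum (fun k => overlap (lo (beta k)) (hi (beta k)) u v [*] bw (beta k)) n =
    (v - u) [*] bsum (fun k => value_at s (beta k)) n.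
Proof.
  intros Hlh Hlo Hhi.
  pose (eta := fun k => Rmin (Rabs (s - lo (beta k))) (Rabs (s - hi (beta k)))).
  assert (Heta : forall k, 0 < eta k).
  { intro k. apply Rmin_pos; apply Rabs_pos_lt;
      intro E; [apply (Hlo k) | apply (Hhi k)]; lra. }
  destruct (finite_min n Heta) as [d [Hd Hmin]].
  exists d. split; auto. intros u v Hs Hu Hv.
  rewrite (@bsum_map Y Y (fun x => (v - u) [*] x)).
  - apply psum_ext. intros k Hk. unfold value_at. rewrite bscal_assoc. f_equal.
    specialize (Hmin k Hk). unfold eta in Hmin.
    pose proof (Rle_trans _ _ _ Hmin (Rmin_l _ _)) as Hsl.
    pose proof (Rle_trans _ _ _ Hmin (Rmin_r _ _)) as Hsh. clear Hmin.
    specialize (Hlh k).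
    assert (d <= s - lo (beta k) \/ s - lo (beta k) <= - d)
      by (revert Hsl; unfold Rabs; destruct Rcase_abs; lra).
    assert (d <= s - hi (beta k) \/ s - hi (beta k) <= - d)
      by (revert Hsh; unfold Rabs; destruct Rcase_abs; lra).
    destruct (classic (lo (beta k) <= s <= hi (beta k))) as [Hin|Hout].
    + rewrite ind_in by auto. rewrite overlap_inner; lra.
    + rewrite ind_out by auto. rewrite overlap_out; lra.
  - intros. apply bscal_distr_l.
  - apply bscal_0r.
Qed.

(** [N (f s)] is not assumed integrable, only dominated by [g]. Let F and G be the integrals over
    [u,v] of the first [n] bricks of the two series. Then N(F) - G is subadditive in the interval,
    and near a point [s] that is no brick end it is v - u times its pointwise value, which up to a
    small slack is at most the tails of the majorant series at [s]. So [covering] bounds it on [a,c]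
    by the total mass of the tails. *)
Lemma Integ_le (f : R -> X) (g : R -> RB) a c (v : X) (I : RB) S S' :
  Integ f a c v S -> Integ g a c I S' ->
  (forall s, a < s < c -> N (f s) <= g s) -> N v <= I.
Proof.
  intros [Hac [beta (H1 & H2 & H3 & H4)]] [_ [gamma (G1 & G2 & G3 & G4)]] Hle.
  assert (Hmb : forall k, 0 <= bm (beta k)) by (intro; eapply bm_nonneg; eauto).
  assert (Hmg : forall k, 0 <= bm (gamma k)) by (intro; eapply bm_nonneg; eauto).
  assert (Hlb : forall k, lo (beta k) <= hi (beta k)) by (intro k; destruct (H1 k); lra).
  assert (Hlg : forall k, lo (gamma k) <= hi (gamma k)) by (intro k; destruct (G1 k); lra).
  assert (HMb : forall k, 0 <= mass (beta k)) by (intro; eapply mass_nonneg; eauto).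
  assert (HMg : forall k, 0 <= mass (gamma k)) by (intro; eapply mass_nonneg; eauto).
  assert (Hab : forall s k, 0 <= mass_at s (beta k)) by (intros; eapply mass_at_nonneg; eauto).
  assert (Hag : forall s k, 0 <= mass_at s (gamma k)) by (intros; eapply mass_at_nonneg; eauto).
  apply le_epsilon. intros eps0 Heps0.
  (* The errors are [C * eps + eps] from [covering], [C * eps] from replacing [v] by [F a c], and
     [eps] from replacing [I] by [G a c]. *)
  set (eps := eps0 / (2 * (C + 1))).
  assert (Heps : 0 < eps) by (apply Rdiv_lt_0_compat; lra).
  destruct (rsum_tail_small (eps := eps) HMb H2 Heps) as [n1 Hn1].
  destruct (rsum_tail_small (eps := eps) HMg G2 Heps) as [n2 Hn2].
  set (n := Nat.max n1 n2).
  assert (Htb : forall m, (n <= m)%nat ->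
     rsum (fun k => mass (beta k)) m - rsum (fun k => mass (beta k)) n <= eps).
  { intros m Hm. assert (rsum (fun k => mass (beta k)) n1 <= rsum (fun k => mass (beta k)) n)
      by (apply rsum_mono; auto; lia). specialize (Hn1 m ltac:(lia)). lra. }
  assert (Htg : forall m, (n <= m)%nat ->
     rsum (fun k => mass (gamma k)) m - rsum (fun k => mass (gamma k)) n <= eps).
  { intros m Hm. assert (rsum (fun k => mass (gamma k)) n2 <= rsum (fun k => mass (gamma k)) n)
      by (apply rsum_mono; auto; lia). specialize (Hn2 m ltac:(lia)). lra. }
  pose (F := fun u v => step_part beta n u v).
  pose (G := fun u v => bsum (fun k => overlap (lo (gamma k)) (hi (gamma k)) u v [*] bw (gamma k)) n : R).
  pose (Lo := interleave (fun k => lo (beta k)) (fun k => lo (gamma k))).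
  pose (Hi := interleave (fun k => hi (beta k)) (fun k => hi (gamma k))).
  (* The first [n] bricks of either family get height zero, so only the tails count in
     [covering]. *)
  pose (rho := interleave (tail_of n (fun k => C * bm (beta k))) (tail_of n (fun k => bm (gamma k)))).
  (* All brick ends and both ends of the interval are exceptional; at any other point the step
     functions are locally constant and the hypothesis on [f] and [g] applies. *)
  pose (E := interleave (interleave Lo Hi) (interleave (fun _ => a) (fun _ => c))).
  assert (HCm : forall k, 0 <= C * bm (beta k)) by (intro; apply Rmult_le_pos; auto; lra).
  set (B := rsum (fun k => C * bm (beta k) + bm (gamma k)) n).
  assert (HB : 0 <= B).
  { apply rsum_nonneg. intro k. specialize (HCm k). specialize (Hmg k). lra. }
  assert (Hmain : N (F a c) - G a c <= C * eps + eps).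
  { apply (@covering (fun u v => N (F u v) - G u v) a c B E Lo Hi rho); auto.
    - intro m. unfold Lo, Hi, interleave. destruct (Nat.even m); auto.
    - unfold rho. apply interleave_prop; apply tail_of_nonneg; auto.
    - intro m.
      rewrite (psum_ext _ _ (v := interleave (tail_of n (fun k => C * mass (beta k)))
                                         (tail_of n (fun k => mass (gamma k))))).
      2:{ intros k _. unfold Lo, Hi, rho, interleave, tail_of.
          destruct (Nat.even k); destruct (Nat.ltb (Nat.div2 k) n); unfold mass; ring. }
      apply rsum_interleave_le; try apply tail_of_nonneg; auto.
      + intro. apply Rmult_le_pos; auto; lra.
      + intro K. apply rsum_tail_of_le; auto.
        * intro; apply Rmult_le_pos; auto; lra.
        * apply Rmult_le_pos; lra.
        * intros m' Hm'. rewrite !rsum_scal. specialize (Htb m' Hm'). nra.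
      + intro K. apply rsum_tail_of_le; auto; lra.
    - intros u m w Hu Hw.
      assert (EF : F u w = F u m [+] F m w).
      { unfold F, step_part. rewrite <- bsum_plus. apply psum_ext. intros k _.
        rewrite (@overlap_add _ _ u m w) by (auto; lra). apply bscal_distr_r. }
      assert (EG : G u w = G u m + G m w).
      { unfold G. change (G u w = @badd RB (G u m) (G m w)).
        unfold G. rewrite <- (@bsum_plus RB). apply psum_ext. intros k _.
        rewrite (@overlap_add _ _ u m w) by (auto; lra). apply bscal_distr_r. }
      rewrite EF, EG. pose proof (N_add (F u m) (F m w)). lra.
    - intros u w Hu Hw.
      assert (HF : bnorm (F u w) <= (w - u) * rsum (fun k => bm (beta k)) n).
      { unfold F, step_part. eapply Rle_trans; [apply bnorm_bsum|].
        rewrite <- rsum_scal. apply rsum_le. intros k _. rewrite bnorm_scal.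
        rewrite Rabs_pos_eq by apply overlap_nonneg. destruct (H1 k) as (?&?&?).
        apply Rmult_le_compat; auto; [apply overlap_nonneg | apply bnorm_nonneg |].
        apply overlap_le; auto; lra. }
      assert (HG : Rabs (G u w) <= (w - u) * rsum (fun k => bm (gamma k)) n).
      { unfold G. eapply Rle_trans; [apply (@bnorm_bsum RB)|].
        rewrite <- rsum_scal. apply rsum_le. intros k _. rewrite bnorm_scal.
        rewrite Rabs_pos_eq by apply overlap_nonneg. destruct (G1 k) as (?&?&?).
        apply Rmult_le_compat; auto; [apply overlap_nonneg | apply bnorm_nonneg |].
        apply overlap_le; auto; lra. }
      pose proof (N_bnd (F u w)). pose proof (Rle_abs (- G u w)). rewrite Rabs_Ropp in H0.
      unfold B. rewrite rsum_plus, rsum_scal.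
      assert (C * bnorm (F u w) <= C * ((w - u) * rsum (fun k => bm (beta k)) n))
        by (apply Rmult_le_compat_l; lra).
      lra.
    - intros s Hs HE e He.
      assert (HE1 : forall m, s <> interleave Lo Hi m).
      { intros m. rewrite <- (interleave_even (interleave Lo Hi) (interleave (fun _ => a) (fun _ => c)) m).
        apply HE. }
      assert (HE2 : forall m, s <> interleave (fun _ => a) (fun _ => c) m).
      { intros m. rewrite <- (interleave_odd (interleave Lo Hi) (interleave (fun _ => a) (fun _ => c)) m).
        apply HE. }
      assert (HLo : forall m, s <> Lo m)
        by (intro m; rewrite <- (interleave_even Lo Hi m); apply HE1).
      assert (HHi : forall m, s <> Hi m)
        by (intro m; rewrite <- (interleave_odd Lo Hi m); apply HE1).
      assert (Hsac : a < s < c) by (pose proof (HE2 0%nat); pose proof (HE2 1%nat);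
        unfold interleave in *; simpl in *; lra).
      destruct (@step_part_locally_const X beta n s) as [d1 [Hd1 L1]]; auto.
      { intro k. rewrite <- (interleave_even (fun k => lo (beta k)) (fun k => lo (gamma k)) k). apply HLo. }
      { intro k. rewrite <- (interleave_even (fun k => hi (beta k)) (fun k => hi (gamma k)) k). apply HHi. }
      destruct (@step_part_locally_const RB gamma n s) as [d2 [Hd2 L2]]; auto.
      { intro k. rewrite <- (interleave_odd (fun k => lo (beta k)) (fun k => lo (gamma k)) k). apply HLo. }
      { intro k. rewrite <- (interleave_odd (fun k => hi (beta k)) (fun k => hi (gamma k)) k). apply HHi. }
      set (Fs := bsum (fun k => value_at s (beta k)) n).
      set (Gs := bsum (fun k => value_at s (gamma k)) n : R).
      set (tb := fun K => rsum (tail_of n (fun k => mass_at s (beta k))) K).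
      set (tg := fun K => rsum (tail_of n (fun k => mass_at s (gamma k))) K).
      (* If both majorant series are finite at [s], the partial sums approach [f s] and [g s], where
         the inequality holds. If one of them diverges, its tail alone eventually exceeds the
         left-hand side. *)
      assert (HK : exists K, N Fs - Gs <= C * tb K + tg K + e).
      { assert (tb0 : forall K, 0 <= C * tb K) by
          (intro; apply Rmult_le_pos; [lra|]; apply rsum_nonneg, tail_of_nonneg, Hab).
        assert (tg0 : forall K, 0 <= tg K) by
          (intro; apply rsum_nonneg, tail_of_nonneg, Hag).
        destruct (classic (finite_at beta s)) as [Fb|Fb].
        destruct (classic (finite_at gamma s)) as [Fg|Fg].
        - pose proof (H3 s Hsac Fb) as Sb. pose proof (G3 s Hsac Fg) as Sg.
          destruct (Sb (e / (C + 1))) as [K1 HK1]; [apply Rdiv_lt_0_compat; lra|].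
          destruct (Sg (e / (C + 1))) as [K2 HK2]; [apply Rdiv_lt_0_compat; lra|].
          set (K := Nat.max n (Nat.max K1 K2)). exists K.
          specialize (HK1 K ltac:(lia)). specialize (HK2 K ltac:(lia)).
          set (fK := bsum (fun k => value_at s (beta k)) K) in *.
          set (gK := bsum (fun k => value_at s (gamma k)) K) in *.
          assert (D1 : bdist fK Fs <= tb K).
          { unfold tb. rewrite rsum_tail_of by lia. apply bdist_bsum_tail; [|lia].
            intro. eapply bnorm_value_at; eauto. }
          assert (D2 : bdist gK (Gs : RB) <= tg K).
          { unfold tg. rewrite rsum_tail_of by lia. apply (@bdist_bsum_tail RB); [|lia].
            intro. eapply bnorm_value_at; eauto. }
          pose proof (seminorm_dist Fs (f s)) as D3.
          pose proof (bdist_triangle fK Fs (f s)) as D4. rewrite (bdist_sym Fs fK) in D4.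
          pose proof (Hle s Hsac) as D5.
          assert (D6 : g s - Gs <= tg K + e / (C + 1)).
          { change (Rabs (gK - Gs) <= tg K) in D2. change (Rabs (gK - g s) < e / (C + 1)) in HK2.
            apply Rabs_def2 in HK2. pose proof (Rle_abs (gK - Gs)).
            lra. }
          assert (C * bdist Fs (f s) <= C * (tb K + e / (C + 1))) by (apply Rmult_le_compat_l; lra).
          replace e with (C * (e / (C + 1)) + e / (C + 1)) by (field; lra). lra.
        - destruct (classic (exists K, N Fs - Gs + rsum (fun k => mass_at s (gamma k)) n
                     < rsum (fun k => mass_at s (gamma k)) K)) as [[K HK]|Hno].
          + exists K. pose proof (@rsum_tail_of_ge n (fun k => mass_at s (gamma k)) K (Hag s)) as Q.
            fold (tg K) in Q. specialize (tb0 K). lra.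
          + exfalso; apply Fg. eexists. intro K. apply Rnot_lt_le. intro Hc. apply Hno. exists K. exact Hc.
        - destruct (classic (exists K, (N Fs - Gs) / C + rsum (fun k => mass_at s (beta k)) n
                     < rsum (fun k => mass_at s (beta k)) K)) as [[K HK]|Hno].
          + exists K. pose proof (@rsum_tail_of_ge n (fun k => mass_at s (beta k)) K (Hab s)) as Q.
            fold (tb K) in Q. specialize (tg0 K).
            assert (C * ((N Fs - Gs) / C) <= C * tb K) by (apply Rmult_le_compat_l; lra).
            replace (C * ((N Fs - Gs) / C)) with (N Fs - Gs) in H by (field; lra). lra.
          + exfalso; apply Fb. eexists. intro K. apply Rnot_lt_le. intro Hc. apply Hno. exists K. exact Hc. }
      destruct HK as [K HK].
      (* [2 * K] terms of the interleaved family contain [K] of each. *)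
      exists (Rmin d1 d2), (2 * K)%nat. split; [apply Rmin_pos; auto|].
      intros u w Hu Hw Hu' Hw'. pose proof (Rmin_l d1 d2). pose proof (Rmin_r d1 d2).
      assert (EF : F u w = (w - u) [*] Fs) by (apply L1; lra).
      assert (EG : G u w = (w - u) * Gs) by (apply L2; lra).
      rewrite EF, EG, N_scal, Rabs_pos_eq by lra.
      rewrite (psum_ext _ _ (v := interleave (tail_of n (fun k => C * mass_at s (beta k)))
                                         (tail_of n (fun k => mass_at s (gamma k))))).
      2:{ intros k _. unfold Lo, Hi, rho, interleave, tail_of.
          destruct (Nat.even k); destruct (Nat.ltb (Nat.div2 k) n); unfold mass_at; ring. }
      rewrite rsum_interleave.
      rewrite (psum_ext _ _ (v := fun k => C * tail_of n (fun k => mass_at s (beta k)) k)).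
      2:{ intros k _. unfold tail_of. destruct (Nat.ltb k n); ring. }
      rewrite rsum_scal. fold (tb K). fold (tg K).
      rewrite <- Rmult_minus_distr_l. apply Rmult_le_compat_l; lra. }
  assert (EF : F a c = bsum (fun k => value (beta k)) n).
  { apply psum_ext. intros k _. unfold value. destruct (H1 k) as (?&?&?).
    rewrite overlap_outer by lra. auto. }
  assert (EG : G a c = bsum (fun k => value (gamma k)) n).
  { apply psum_ext. intros k _. unfold value. destruct (G1 k) as (?&?&?).
    rewrite overlap_outer by lra. auto. }
  assert (D1 : bdist v (F a c) <= eps).
  { rewrite EF. apply (bsums_dist_le (n0 := n) H4). intros m Hm.
    eapply Rle_trans; [apply (@bdist_bsum_tail X _ (fun k => mass (beta k))); auto | apply Htb; auto].
    intro. eapply bnorm_value; eauto. }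
  assert (D2 : bdist I (G a c : RB) <= eps).
  { rewrite EG. apply (@bsums_dist_le RB _ _ _ _ n G4). intros m Hm.
    eapply Rle_trans; [apply (@bdist_bsum_tail RB _ (fun k => mass (gamma k))); auto | apply Htg; auto].
    intro. eapply bnorm_value; eauto. }
  change (Rabs (I - G a c) <= eps) in D2. rewrite Rabs_minus_sym in D2.
  pose proof (Rle_abs (G a c - I)).
  pose proof (seminorm_dist v (F a c)).
  assert (C * bdist v (F a c) <= C * eps) by (apply Rmult_le_compat_l; lra).
  assert (eps0 = 2 * (C * eps + eps)) by (unfold eps; field; lra).
  change (N v <= (I : R) + eps0). lra.
Qed.

End Comparison.

(** The function f - f has integral v - v' and is dominated by zero, so comparison gives norm
    zero. *)
Lemma Integ_unique (X : Banach) (f : R -> X) a c v v' S S' :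
  Integ f a c v S -> Integ f a c v' S' -> v = v'.
Proof.
  intros H H'.
  assert (Hopp : Integ (fun s => bopp (f s)) a c (bopp v') (1 * S')).
  { apply (@Integ_map X X bopp 1); auto; try lra.
    - intros; vring.
    - intros; vring.
    - intro. rewrite bnorm_opp; lra. }
  assert (Hs := Integ_add H Hopp).
  assert (Hac : a <= c) by apply H.
  apply bsub_eq0, bnorm_eq0, Rle_antisym; [|apply bnorm_nonneg].
  apply (@Integ_le X bnorm 1 (@bnorm_triangle X) (@bnorm_scal X) Rlt_0_1) with
    (1 := fun x => Req_le _ _ (eq_sym (Rmult_1_l _))) (2 := Hs) (3 := @Integ_zero RB a c Hac).
  intros s _. rewrite badd_opp, bnorm_0. simpl; lra.
Qed.

(** * Right-continuous integrands *)

Section Right_continuous.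
Variable X : Banach.

(** Half-open intervals fit the one-sided notion: consecutive pieces [u,m) and [m,v) glue without
    any condition at [m]. *)
Definition right_cont (h : R -> X) (a c : R) : Prop :=
  forall s, a <= s < c -> forall eps, 0 < eps -> exists delta, 0 < delta /\
    forall s', s <= s' < c -> s' < s + delta -> bdist (h s') (h s) <= eps.

Lemma right_cont_sub (h g : R -> X) a c :
  right_cont h a c -> right_cont g a c -> right_cont (fun s => h s [-] g s) a c.
Proof.
  intros Hh Hg s Hs eps He.
  destruct (Hh s Hs (eps / 2)) as [d1 [Hd1 H1]]; [lra|].
  destruct (Hg s Hs (eps / 2)) as [d2 [Hd2 H2]]; [lra|].
  exists (Rmin d1 d2). split; [apply Rmin_pos; auto|]. intros s' Hs' Hd.
  pose proof (Rmin_l d1 d2). pose proof (Rmin_r d1 d2).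
  specialize (H1 s' Hs' ltac:(lra)). specialize (H2 s' Hs' ltac:(lra)).
  eapply Rle_trans; [apply bdist_add|].
  replace (bdist (bopp (g s')) (bopp (g s))) with (bdist (g s') (g s)); [lra|].
  unfold bdist. rewrite <- bnorm_opp. f_equal. vring.
Qed.

Section Approximation.
Variables (h : R -> X) (B eps : R).

(** The approximant is again right-continuous, so that the remainder can be approximated in turn,
    and its mass is bounded by height times length, so that masses of countably many pieces add
    up. *)
Definition approximable (u v : R) : Prop :=
  exists g, right_cont g u v /\
    (forall s, u <= s < v -> bnorm (g s) <= B /\ bdist (h s) (g s) <= eps) /\
    exists w, Integ g u v w (B * (v - u)).

Lemma approximable_refl u : approximable u u.
Proof.
  exists (fun _ => bzero). split; [|split].
  - intros s Hs; lra.
  - intros s Hs; lra.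
  - exists bzero. replace (B * (u - u)) with 0 by ring. apply Integ_zero; lra.
Qed.

Lemma approximable_const u v : u <= v -> bnorm (h u) <= B ->
  (forall s, u <= s < v -> bdist (h s) (h u) <= eps) -> approximable u v.
Proof.
  intros Huv HB H. exists (fun _ => h u). split; [|split].
  - intros s Hs e He. exists 1. split; [lra|]. intros. rewrite bdist_refl; lra.
  - intros; split; auto.
  - eexists. eapply Integ_mono_bound; [|apply Integ_const; auto].
    rewrite Rmult_comm. apply Rmult_le_compat_r; lra.
Qed.

(** The half-open pieces are disjoint and cover [p 0, m), so each point picks the approximant of its
    own piece. Extended by zero, the pieces are summed by [Integ_sum], with masses that telescope.
    Empty pieces are allowed. *)
Lemma approximable_glue (p : nat -> R) m : 0 <= B ->
  (forall n, p n <= p (S n)) -> (forall n, p n <= m) ->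
  (forall s, p O <= s < m -> exists n, p n <= s < p (S n)) ->
  (forall n, approximable (p n) (p (S n))) -> approximable (p O) m.
Proof.
  intros HB Hmono Hm Hcov Happ.
  assert (Hle : forall i j, (i <= j)%nat -> p i <= p j).
  { intros i j Hij. induction Hij; [lra|]. specialize (Hmono m0). lra. }
  destruct (choice (fun n g => right_cont g (p n) (p (S n)) /\
    (forall s, p n <= s < p (S n) -> bnorm (g s) <= B /\ bdist (h s) (g s) <= eps) /\
    exists w, Integ g (p n) (p (S n)) w (B * (p (S n) - p n)))) as [g Hg]; auto.
  assert (Huniq : forall s i j, p i <= s < p (S i) -> p j <= s < p (S j) -> i = j).
  { intros s i j Hi Hj. destruct (Nat.lt_trichotomy i j) as [H|[H|H]]; auto.
    - pose proof (Hle (S i) j ltac:(lia)). lra.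
    - pose proof (Hle (S j) i ltac:(lia)). lra. }
  destruct (choice (fun s n => p O <= s < m -> p n <= s < p (S n))) as [idx Hidx].
  { intro s. destruct (classic (p O <= s < m)) as [Hs|Hs].
    - destruct (Hcov s Hs) as [n Hn]. exists n; auto.
    - exists O. tauto. }
  pose (G := fun s => g (idx s) s).
  assert (HG : forall n s, p n <= s < p (S n) -> G s = g n s).
  { intros n s Hs. unfold G. f_equal. apply (Huniq s); auto. apply Hidx.
    pose proof (Hle O n ltac:(lia)). pose proof (Hm (S n)). lra. }
  exists G. split; [|split].
  - intros s Hs e He. destruct (Hcov s Hs) as [n Hn].
    destruct (proj1 (Hg n) s Hn e He) as [d [Hd H]].
    exists (Rmin d (p (S n) - s)). split; [apply Rmin_pos; lra|].
    intros s' Hs' Hd'. pose proof (Rmin_l d (p (S n) - s)). pose proof (Rmin_r d (p (S n) - s)).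
    rewrite (HG n s), (HG n s') by lra. apply H; lra.
  - intros s Hs. destruct (Hcov s Hs) as [n Hn]. rewrite (HG n s) by auto. apply Hg; auto.
  - pose (f := fun n s => if Rle_dec (p n) s then if Rlt_dec s (p (S n)) then g n s else bzero else bzero).
    destruct (choice (fun n w => Integ (f n) (p O) m w (B * (p (S n) - p n)))) as [w Hw].
    { intro n. destruct (Hg n) as (_ & _ & w & Hw). exists w.
      apply (Integ_extend (f := g n) (a := p n) (c := p (S n))); auto.
      - apply Hle; lia.
      - intros s Hs. unfold f. destruct (Rle_dec (p n) s), (Rlt_dec s (p (S n))); auto; lra.
      - intros s Hs. unfold f. pose proof (Hmono n).
        destruct (Rle_dec (p n) s), (Rlt_dec s (p (S n))); auto; lra. }
    destruct (@Integ_sum X f G (p O) m w (fun n => B * (p (S n) - p n)) (B * (m - p O)) 0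
       (fun _ => zero_brick X (p O))) as [w' [_ HI]]; auto.
    + intro n. rewrite rsum_scal. apply Rmult_le_compat_l; auto.
      assert (rsum (fun k => p (S k) - p k) n = p n - p O).
      { induction n; simpl; [ring|]. rewrite IHn; ring. }
      rewrite H. specialize (Hm n). lra.
    + intro. apply brick_in_zero. specialize (Hm O). lra.
    + intro n. rewrite rsum_const. unfold mass; simpl; right; ring.
    + intros s Hs _ _. destruct (Hcov s ltac:(lra)) as [n Hn].
      replace (G s) with (f n s).
      * apply (@bsums_single X (fun n => f n s) n). intros k Hk. unfold f.
        destruct (Rle_dec (p k) s), (Rlt_dec s (p (S k))); auto.
        exfalso; apply Hk. apply (Huniq s); lra.
      * rewrite (HG n s) by auto. unfold f.
        destruct (Rle_dec (p n) s), (Rlt_dec s (p (S n))); auto; lra.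
    + exists w'. rewrite Rplus_0_l in HI. auto.
Qed.

Hypothesis eps_pos : 0 < eps.

(* Continuous induction on the right end point; limits from the left are reached by gluing
   countably many pieces. *)
Lemma right_cont_approximable a c : a <= c -> 0 <= B -> right_cont h a c ->
  (forall s, a <= s < c -> bnorm (h s) <= B) -> approximable a c.
Proof.
  intros Hac HB Hrc Hbd.
  (* All subintervals are demanded, because gluing towards the supremum needs pieces with arbitrary
     left ends. *)
  pose (E := fun v => a <= v <= c /\ forall u' v', a <= u' <= v' -> v' <= v -> approximable u' v').
  destruct (completeness E) as [m [Hub Hlub]].
  - exists c. intros x [Hx _]; lra.
  - exists a. split; [lra|]. intros u' v' H1 H2.
    replace v' with u' by lra. apply approximable_refl.
  - assert (Ham : a <= m).
    { apply Hub. split; [lra|]. intros u' v' H1 H2.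
      replace v' with u' by lra. apply approximable_refl. }
    assert (Hmc : m <= c) by (apply Hlub; intros x [Hx _]; lra).
    assert (Hbelow : forall u' v', a <= u' <= v' -> v' < m -> approximable u' v').
    { intros u' v' Hu Hv. destruct (classic (exists x, E x /\ v' < x)) as [[x [[_ Hx] Hvx]]|Hno].
      - apply Hx; lra.
      - exfalso. assert (m <= v'); [|lra]. apply Hlub. intros x Hx.
        apply Rnot_lt_le; intro; apply Hno; eauto. }
    assert (Hat : forall u', a <= u' <= m -> approximable u' m).
    { intros u' Hu. destruct (Req_dec u' m) as [->|Hne]; [apply approximable_refl|].
      assert (Hlt : 0 < m - u') by lra.
      (* The pieces accumulate only at [m]; each of them ends strictly before [m], where
         approximation is already available. *)
      pose (p := fun n => m - (m - u') * (/2)^n).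
      assert (Hpow : forall n, 0 < (/2)^n) by (intro; apply pow_lt; lra).
      assert (Hps : forall n, p n < p (S n)).
      { intro n. unfold p. simpl. specialize (Hpow n). nra. }
      assert (Hpm : forall n, p n < m) by (intro n; unfold p; specialize (Hpow n); nra).
      assert (Hp0 : p O = u') by (unfold p; simpl; ring).
      assert (Hpu : forall n, u' <= p n).
      { induction n; [lra|]. specialize (Hps n). lra. }
      rewrite <- Hp0. apply approximable_glue; auto.
      - intro; left; auto.
      - intro; left; auto.
      - intros s Hs.
        destruct (@half_pow_small (m - u') (m - s)) as [N HN]; [lra|].
        specialize (HN N (le_n N)).
        assert (Hfind : forall n, s < p n -> exists k, p k <= s < p (S k)).
        { induction n; intro Hn; [lra|]. destruct (Rlt_dec s (p n)) as [H|H]; auto.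
          exists n. lra. }
        apply (Hfind N). unfold p. lra.
      - intro n. apply Hbelow; auto. specialize (Hps n). specialize (Hpu n). lra. }
    destruct (Req_dec m c) as [->|Hne]; [apply Hat; lra|].
    exfalso.
    (* Half of [eps], because the constant used on a piece is the value at its left end, not the
       value at [m]. *)
    destruct (Hrc m ltac:(lra) (eps / 2)) as [d [Hd H]]; [lra|].
    set (m' := Rmin c (m + d / 2)).
    assert (Hm' : m < m' <= c /\ m' < m + d).
    { unfold m', Rmin. destruct (Rle_dec c (m + d / 2)); lra. }
    assert (Hafter : forall u' v', m <= u' <= v' -> v' <= m' -> approximable u' v').
    { intros u' v' Hu Hv. destruct (Req_dec u' v') as [->|Hne']; [apply approximable_refl|].
      apply approximable_const; [lra | apply Hbd; lra |].
      intros s Hs. pose proof (H s ltac:(lra) ltac:(lra)). pose proof (H u' ltac:(lra) ltac:(lra)).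
      eapply Rle_trans; [apply (bdist_triangle (h m))|]. rewrite (bdist_sym (h m)). lra. }
    assert (E m'); [|assert (m' <= m) by (apply Hub; auto); lra].
    split; [lra|]. intros u' v' Hu Hv.
    destruct (Rlt_dec v' m) as [Hc|Hc]; [apply Hbelow; lra|].
    destruct (Rlt_dec u' m) as [Hc'|Hc']; [|apply Hafter; lra].
    (* A finite gluing written as an infinite one, constant from the third point on. *)
    pose (p := fun n => match n with O => u' | 1%nat => m | _ => v' end).
    apply (@approximable_glue p v'); auto.
    + intros [|[|n]]; simpl; lra.
    + intros [|[|n]]; simpl; lra.
    + intros s Hs. simpl in Hs. destruct (Rlt_dec s m); [exists O | exists 1%nat]; simpl; lra.
    + intros [|[|n]]; simpl; [apply Hat; lra | apply Hafter; lra | apply approximable_refl].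
Qed.

End Approximation.

(** The remainder is approximated again and again with errors B / 2^n. This writes [h] as a
    pointwise convergent series of integrable functions bounded by B / 2^n, whence the factor 2 in
    the mass. *)
Lemma right_cont_Integ (h : R -> X) a c B : a <= c -> 0 <= B -> right_cont h a c ->
  (forall s, a <= s < c -> bnorm (h s) <= B) -> exists v, Integ h a c v (2 * B * (c - a)).
Proof.
  intros Hac HB Hrc Hbd.
  (* The errors have to be positive, so the zero function is settled separately. *)
  destruct (Req_dec B 0) as [->|HB0].
  { exists bzero. replace (2 * 0 * (c - a)) with 0 by ring.
    apply (Integ_ext (f := fun _ => bzero)); [|apply Integ_zero; auto].
    intros s Hs. symmetry. apply bnorm_eq0. apply Rle_antisym; [|apply bnorm_nonneg].
    apply Hbd; lra. }
  pose (Bn := fun n => B * (/2)^n).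
  assert (HBn : forall n, 0 < Bn n).
  { intro. apply Rmult_lt_0_compat; [lra | apply pow_lt; lra]. }
  pose (admissible := fun n (k : R -> X) =>
    right_cont k a c /\ forall s, a <= s < c -> bnorm (k s) <= Bn n).
  (* The approximant is chosen beforehand as a function of the stage and of the remainder, so that
     the remainders can be defined by recursion. *)
  destruct (choice (fun (nk : nat * (R -> X)) g => admissible (fst nk) (snd nk) ->
    right_cont g a c /\
    (forall s, a <= s < c -> bnorm (g s) <= Bn (fst nk) /\ bdist (snd nk s) (g s) <= Bn (S (fst nk))) /\
    exists w, Integ g a c w (Bn (fst nk) * (c - a)))) as [step Hstep].
  { intros [n k]. simpl. destruct (classic (admissible n k)) as [[H1 H2]|Hn].
    - destruct (@right_cont_approximable k (Bn n) (Bn (S n)) (HBn (S n)) a c Hac) as [g Hg]; auto.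
      { left; auto. }
      exists g; auto.
    - exists k. tauto. }
  pose (hn := fix hn n := match n with O => h | S n => fun s => hn n s [-] step (n, hn n) s end).
  pose (g := fun n => step (n, hn n)).
  assert (Hadm : forall n, admissible n (hn n)).
  { induction n.
    - split; auto. intros s Hs. unfold Bn. simpl. rewrite Rmult_1_r. auto.
    - destruct (Hstep (n, hn n) IHn) as (G1 & G2 & _). split.
      + apply right_cont_sub; auto. apply IHn.
      + intros s Hs. apply (G2 s Hs). }
  assert (Hg : forall n s, a <= s < c -> bnorm (g n s) <= Bn n).
  { intros n s Hs. apply (Hstep (n, hn n) (Hadm n)); auto. }
  destruct (choice (fun n w => Integ (g n) a c w (Bn n * (c - a)))) as [w Hw].
  { intro n. apply (Hstep (n, hn n) (Hadm n)). }
  destruct (@Integ_sum X g h a c w (fun n => Bn n * (c - a)) (2 * B * (c - a)) 0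
       (fun _ => zero_brick X a)) as [v [_ HI]]; auto.
  - intro n. apply Rle_trans with (rsum (fun k => B * (c - a) * (/2)^k) n).
    + right; apply psum_ext. intros; unfold Bn; ring.
    + eapply Rle_trans; [apply rsum_geometric; apply Rmult_le_pos; lra|]. lra.
  - intro. apply brick_in_zero; lra.
  - intro n. rewrite rsum_const. unfold mass; simpl; right; ring.
  - intros s Hs _ _ eps He. destruct (@half_pow_small B eps He) as [N HN]. exists N. intros n Hn.
    assert (E : bsum (fun n => g n s) n = h s [-] hn n s).
    { clear. induction n; simpl; [vring|]. rewrite IHn. unfold g. vring. }
    rewrite E. unfold bdist. replace (h s [-] hn n s [-] h s) with (bopp (hn n s)) by vring.
    rewrite bnorm_opp. eapply Rle_lt_trans; [|apply (HN n Hn)].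
    apply (Hadm n). lra.
  - exists v. rewrite Rplus_0_l in HI. auto.
Qed.

(** On each brick the integrand is s -> H(s)w for a fixed vector w, which is right-continuous and
    bounded by K times the majorant. The resulting integrals are summed with the bricks of [y]
    themselves as [gamma]: convergence is then needed only where the series of [y] converges, and
    there [H s] carries it over. *)
Lemma Integ_operator (y : R -> X) a c v S (H : R -> X -> X) K : 0 < K ->
  Integ y a c v S ->
  (forall s, a <= s <= c -> forall x x', H s (x [+] x') = H s x [+] H s x') ->
  (forall s, a <= s <= c -> forall r x, H s (r [*] x) = r [*] H s x) ->
  (forall s, a <= s <= c -> forall x, bnorm (H s x) <= K * bnorm x) ->
  (forall x, right_cont (fun s => H s x) a c) ->
  exists v' S', Integ (fun s => H s (y s)) a c v' S'.
Proof.
  intros HK [Hac [beta (H1 & H2 & H3 & H4)]] Hadd Hscal Hbd Hrc.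
  assert (Hm : forall k, 0 <= bm (beta k)) by (intro; eapply bm_nonneg; eauto).
  pose (f := fun k s => ind (lo (beta k)) (hi (beta k)) s [*] H s (bw (beta k))).
  destruct (choice (fun k w => Integ (f k) a c w (2 * K * mass (beta k)))) as [w Hw].
  { intro k. destruct (H1 k) as (B1 & B2 & B3).
    destruct (@right_cont_Integ (fun s => H s (bw (beta k))) (lo (beta k)) (hi (beta k))
                (K * bm (beta k))) as [w Hw].
    - lra.
    - apply Rmult_le_pos; auto; lra.
    - intros s Hs e He. destruct (Hrc (bw (beta k)) s ltac:(lra) e He) as [d [Hd Q]].
      exists d. split; auto. intros; apply Q; lra.
    - intros s Hs. eapply Rle_trans; [apply Hbd; lra|]. apply Rmult_le_compat_l; lra.
    - exists w. eapply Integ_mono_bound; [|eapply Integ_extend; [| | | |apply Hw]]; try lra.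
      + unfold mass. right; ring.
      + intros s Hs. unfold f. rewrite ind_in by lra. apply bscal_1.
      + intros s Hs. unfold f. rewrite ind_out by lra. apply bscal_0l. }
  destruct (@Integ_sum X f (fun s => H s (y s)) a c w (fun k => 2 * K * mass (beta k)) (2 * K * S) S beta)
    as [v' [_ HI]]; auto.
  - intro n. rewrite rsum_scal. apply Rmult_le_compat_l; auto; lra.
  - intros s Hs Hfin _.
    apply (@bsums_ext X (fun k => H s (value_at s (beta k)))).
    + intro k. unfold value_at, f. apply Hscal; lra.
    + apply (@bsums_map X X (H s) K); auto.
      * intros; apply Hadd; lra.
      * intros; apply Hscal; lra.
      * intros; apply Hbd; lra.
  - eauto.
Qed.

End Right_continuous.

(** * The evolution family and its backward extension *)

Section Dichotomy.
Variables (X : Banach) (T : R -> R -> X -> X) (nt : R -> X -> R) (P : R -> X -> X).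
Hypothesis ev : evolution_family T.
Hypothesis nt_norm : forall t, 1 <= t -> is_norm (nt t).
Variables C0 eps0 : R.
Hypothesis C0_pos : 0 < C0.
Hypothesis eps0_nonneg : 0 <= eps0.
Hypothesis nt_equiv : forall x tau, 1 <= tau ->
  bnorm x <= nt tau x /\ nt tau x <= C0 * Rpower tau eps0 * bnorm x.
Hypothesis P_proj : forall t, 1 <= t -> lin_op (P t) /\ forall x, P t (P t x) = P t x.
Hypothesis P_T : forall t tau x, 1 <= tau <= t -> P t (T t tau x) = T t tau (P tau x).
Hypothesis ker_iso : forall t tau, 1 <= tau <= t ->
  (forall x y, P tau x = bzero -> P tau y = bzero -> T t tau x = T t tau y -> x = y) /\
  (forall z, P t z = bzero -> exists x, P tau x = bzero /\ T t tau x = z).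
Variables lam D : R.
Hypothesis lam_pos : 0 < lam.
Hypothesis D_pos : 0 < D.
Hypothesis stable : forall t tau x, 1 <= tau <= t ->
  nt t (T t tau (P tau x)) <= D * Rpower (t / tau) (- lam) * nt tau x.
Hypothesis unstable : forall t tau x z, 1 <= t <= tau -> P t z = bzero -> T tau t z = Qop P tau x ->
  nt t z <= D * Rpower (tau / t) (- lam) * nt tau x.

Lemma T_add t tau x x' : 1 <= tau <= t -> T t tau (x [+] x') = T t tau x [+] T t tau x'.
Proof. intro H. apply ev; auto. Qed.

Lemma T_scal t tau r x : 1 <= tau <= t -> T t tau (r [*] x) = r [*] T t tau x.
Proof. intro H. apply ev; auto. Qed.

Lemma T_opp t tau x : 1 <= tau <= t -> T t tau (bopp x) = bopp (T t tau x).
Proof. intro H. rewrite !bopp_scal. apply T_scal; auto. Qed.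

Lemma T_zero t tau : 1 <= tau <= t -> T t tau bzero = bzero.
Proof. intro H. apply lin_zero. intros; apply T_scal; auto. Qed.

Lemma T_id t x : 1 <= t -> T t t x = x.
Proof. intro H. apply ev; auto. Qed.

Lemma T_comp t s tau x : 1 <= tau -> tau <= s <= t -> T t s (T s tau x) = T t tau x.
Proof. intros H1 H2. apply ev; lra. Qed.

Lemma P_add t x x' : 1 <= t -> P t (x [+] x') = P t x [+] P t x'.
Proof. intro H. apply P_proj; auto. Qed.

Lemma P_scal t r x : 1 <= t -> P t (r [*] x) = r [*] P t x.
Proof. intro H. apply P_proj; auto. Qed.

Lemma P_opp t x : 1 <= t -> P t (bopp x) = bopp (P t x).
Proof. intro H. rewrite !bopp_scal. apply P_scal; auto. Qed.

Lemma P_zero t : 1 <= t -> P t bzero = bzero.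
Proof. intro H. apply lin_zero. intros; apply P_scal; auto. Qed.

Lemma P_Q t x : 1 <= t -> P t (Qop P t x) = bzero.
Proof.
  intro H. unfold Qop. rewrite P_add, P_opp by auto.
  rewrite (proj2 (P_proj H)). apply badd_opp.
Qed.

Lemma Q_ker t x : P t x = bzero -> Qop P t x = x.
Proof. intro H. unfold Qop. rewrite H. vring. Qed.

Lemma Q_T t tau x : 1 <= tau <= t -> Qop P t (T t tau x) = T t tau (Qop P tau x).
Proof. intro H. unfold Qop. rewrite T_add, T_opp, P_T; auto. Qed.

Lemma nt_add t x x' : 1 <= t -> nt t (x [+] x') <= nt t x + nt t x'.
Proof. intro H. apply (nt_norm H). Qed.

Lemma nt_scal t r x : 1 <= t -> nt t (r [*] x) = Rabs r * nt t x.
Proof. intro H. apply (nt_norm H). Qed.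

Lemma nt_nonneg t x : 1 <= t -> 0 <= nt t x.
Proof. intro H. apply (nt_norm H). Qed.

Lemma nt_eq0 t x : 1 <= t -> nt t x = 0 -> x = bzero.
Proof. intro H. apply (nt_norm H). Qed.

Lemma nt_opp t x : 1 <= t -> nt t (bopp x) = nt t x.
Proof. intro H. rewrite bopp_scal, nt_scal, Rabs_left by lra. ring. Qed.

Lemma nt_zero t : 1 <= t -> nt t bzero = 0.
Proof. intro H. rewrite <- (bscal_0l (bzero : X)), nt_scal, Rabs_R0 by auto. ring. Qed.

Lemma bnorm_le_nt t x : 1 <= t -> bnorm x <= nt t x.
Proof. intro H. apply nt_equiv; auto. Qed.

(** * Power rates and bounds in the original norm *)

Definition cnt (t : R) : R := C0 * Rpower t eps0.

Lemma cnt_pos t : 0 < cnt t.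
Proof. apply Rmult_lt_0_compat; auto. apply exp_pos. Qed.

Lemma nt_le t x : 1 <= t -> nt t x <= cnt t * bnorm x.
Proof. intro H. apply nt_equiv; auto. Qed.

Lemma cnt_mono s t : 1 <= s <= t -> cnt s <= cnt t.
Proof. intro H. apply Rmult_le_compat_l; [lra|]. apply Rle_Rpower_l; lra. Qed.

(** Decay rates are rewritten as quotients of values of this one function, which compose by
    cancellation and telescope. *)
Definition e (r : R) : R := Rpower r lam.

Lemma e_pos r : 0 < e r.
Proof. apply exp_pos. Qed.

Lemma e_mono s t : 1 <= s <= t -> e s <= e t.
Proof. intro H. apply Rle_Rpower_l; lra. Qed.

Lemma e_ratio s t : 1 <= s <= t -> Rpower (t / s) (- lam) = e s / e t.
Proof.
  intro H. unfold e, Rdiv. rewrite <- Rpower_mult_distr; [|lra|apply Rinv_0_lt_compat; lra].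
  rewrite !Rpower_Ropp. rewrite Rmult_comm. f_equal.
  rewrite <- Rpower_Ropp. unfold Rpower. f_equal. rewrite ln_Rinv by lra. ring.
Qed.

Lemma e_ratio_le1 s t : 1 <= s <= t -> 0 <= e s / e t <= 1.
Proof.
  intro H. pose proof (e_mono H). pose proof (e_pos s). pose proof (e_pos t). split.
  - left; apply Rdiv_lt_0_compat; auto.
  - apply Rmult_le_reg_r with (e t); auto. unfold Rdiv. rewrite Rmult_assoc, Rinv_l; lra.
Qed.

(* ln(1 - x) <= - x at x = 1/(r+1), and exp u >= 1 + u. *)
Lemma e_growth r : 1 <= r -> e r * (1 + lam / (r + 1)) <= e (r + 1).
Proof.
  intro Hr. unfold e, Rpower.
  assert (Hln : ln r <= ln (r + 1) - / (r + 1)).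
  { assert (H1 : 0 < r / (r + 1)) by (apply Rdiv_lt_0_compat; lra).
    assert (H2 : r / (r + 1) <= exp (- / (r + 1))).
    { pose proof (exp_ineq1_le (- / (r + 1))).
      replace (r / (r + 1)) with (1 + - / (r + 1)) by (field; lra). auto. }
    assert (H3 : ln (r / (r + 1)) <= - / (r + 1)).
    { rewrite <- (ln_exp (- / (r + 1))). destruct H2 as [H2|H2]; [left; apply ln_increasing | rewrite H2]; auto; lra. }
    unfold Rdiv in H3. rewrite ln_mult, ln_Rinv in H3; try lra. apply Rinv_0_lt_compat; lra. }
  assert (H4 : 1 + lam / (r + 1) <= exp (lam / (r + 1))) by apply exp_ineq1_le.
  apply Rle_trans with (exp (lam * ln r) * exp (lam / (r + 1))).
  - apply Rmult_le_compat_l; auto. left; apply exp_pos.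
  - rewrite <- exp_plus.
    assert (Hle : lam * ln r + lam / (r + 1) <= lam * ln (r + 1)).
    { assert (lam * ln r <= lam * (ln (r + 1) - / (r + 1))) by (apply Rmult_le_compat_l; lra).
      unfold Rdiv in *. lra. }
    destruct Hle as [Hl|E]; [left; apply exp_increasing; auto | rewrite E; lra].
Qed.

Lemma e_unbounded A : exists r0, 1 <= r0 /\ forall r, r0 <= r -> A <= e r.
Proof.
  set (B := Rmax A 1). assert (HB : 1 <= B) by apply Rmax_r.
  set (r0 := Rpower B (/ lam)).
  assert (E : e r0 = B).
  { unfold e, r0. rewrite Rpower_mult, Rinv_l, Rpower_1 by lra. auto. }
  exists (Rmax 1 r0). split; [apply Rmax_l|]. intros r Hr.
  apply Rle_trans with B; [apply Rmax_l|]. rewrite <- E. unfold e. apply Rle_Rpower_l; [lra|].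
  split; [apply exp_pos|]. eapply Rle_trans; [apply Rmax_r | apply Hr].
Qed.

Lemma e_decay tau A eps : 1 <= tau -> 0 < eps ->
  exists t0, tau <= t0 /\ forall t, t0 <= t -> A * (e tau / e t) <= eps.
Proof.
  intros Ht He. destruct (e_unbounded (Rabs A * e tau / eps)) as [r0 [Hr0 H]].
  exists (Rmax r0 tau). split; [apply Rmax_r|]. intros t Hrt.
  assert (r0 <= t) by (eapply Rle_trans; [apply Rmax_l | apply Hrt]).
  specialize (H t H0). pose proof (e_pos tau). pose proof (e_pos t).
  apply Rle_trans with (Rabs A * (e tau / e t)).
  - apply Rmult_le_compat_r; [left; apply Rdiv_lt_0_compat; auto | apply Rle_abs].
  - apply Rmult_le_reg_r with (e t / eps); [apply Rdiv_lt_0_compat; auto|].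
    replace (Rabs A * (e tau / e t) * (e t / eps)) with (Rabs A * e tau / eps) by (field; lra).
    replace (eps * (e t / eps)) with (e t) by (field; lra). auto.
Qed.

Lemma stable_e t tau x : 1 <= tau <= t -> nt t (T t tau (P tau x)) <= D * (e tau / e t) * nt tau x.
Proof. intro H. rewrite <- e_ratio by auto. apply stable; auto. Qed.

Lemma stable_1 t tau x : 1 <= tau <= t -> nt t (T t tau (P tau x)) <= D * nt tau x.
Proof.
  intro H. eapply Rle_trans; [apply stable_e; auto|].
  pose proof (e_ratio_le1 H). assert (0 <= nt tau x) by (apply nt_nonneg; lra).
  apply Rmult_le_compat_r; auto. rewrite <- (Rmult_1_r D) at 2. apply Rmult_le_compat_l; lra.
Qed.

Lemma P_nt t x : 1 <= t -> nt t (P t x) <= D * nt t x.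
Proof. intro H. rewrite <- (T_id (P t x) H). apply stable_1; lra. Qed.

(** The dichotomy bounds operators in the norms [nt], whereas passing an operator through an
    integral needs a bound in the original norm. *)
Lemma bound_by_nt (A : X -> X) s r K : 1 <= s -> 1 <= r -> 0 <= K ->
  (forall x, nt s (A x) <= K * nt r x) -> forall x, bnorm (A x) <= K * cnt r * bnorm x.
Proof.
  intros Hs Hr HK H x. eapply Rle_trans; [apply (bnorm_le_nt _ Hs)|].
  eapply Rle_trans; [apply H|]. rewrite Rmult_assoc. apply Rmult_le_compat_l; auto.
  apply nt_le; auto.
Qed.

(** The operator T(tau,t)Q(t) for [tau <= t]. Composing with the projection makes it linear on all
    of X. *)
Definition back (tau t : R) (x : X) : X :=
  epsilon (inhabits bzero) (fun z => P tau z = bzero /\ T t tau z = Qop P t x).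

Lemma back_spec tau t x : 1 <= tau <= t ->
  P tau (back tau t x) = bzero /\ T t tau (back tau t x) = Qop P t x.
Proof.
  intro H. unfold back. apply epsilon_spec. apply (proj2 (ker_iso H)). apply P_Q; lra.
Qed.

Lemma back_ker tau t x : 1 <= tau <= t -> P tau (back tau t x) = bzero.
Proof. intro H. apply back_spec; auto. Qed.

Lemma T_back tau t x : 1 <= tau <= t -> T t tau (back tau t x) = Qop P t x.
Proof. intro H. apply back_spec; auto. Qed.

(** Injectivity of T(t,tau) on the kernel. The algebraic identities for [back] below are obtained by
    checking these two conditions on a candidate. *)
Lemma back_unique tau t x z : 1 <= tau <= t ->
  P tau z = bzero -> T t tau z = Qop P t x -> back tau t x = z.
Proof.
  intros H H1 H2. apply (proj1 (ker_iso H)); auto.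
  - apply back_ker; auto.
  - rewrite T_back; auto.
Qed.

Lemma back_add tau t x x' : 1 <= tau <= t -> back tau t (x [+] x') = back tau t x [+] back tau t x'.
Proof.
  intro H. apply back_unique; auto.
  - rewrite P_add, !back_ker by (auto; lra). apply badd_0.
  - rewrite T_add, !T_back by auto. unfold Qop. rewrite P_add by lra. vring.
Qed.

Lemma back_scal tau t r x : 1 <= tau <= t -> back tau t (r [*] x) = r [*] back tau t x.
Proof.
  intro H. apply back_unique; auto.
  - rewrite P_scal, back_ker by (auto; lra). apply bscal_0r.
  - rewrite T_scal, T_back by auto. unfold Qop. rewrite P_scal by lra. vring.
Qed.

Lemma back_opp tau t x : 1 <= tau <= t -> back tau t (bopp x) = bopp (back tau t x).
Proof. intro H. rewrite !bopp_scal. apply back_scal; auto. Qed.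

Lemma back_T tau s t x : 1 <= tau -> tau <= s <= t -> back tau t (T t s x) = back tau s x.
Proof.
  intros H1 H2. apply back_unique; try lra.
  - apply back_ker; lra.
  - rewrite <- (T_comp (s := s)) by lra. rewrite T_back, Q_T by lra. auto.
Qed.

Lemma back_back tau s t x : 1 <= tau -> tau <= s <= t -> back tau s (back s t x) = back tau t x.
Proof.
  intros H1 H2. symmetry. apply back_unique; try lra.
  - apply back_ker; lra.
  - rewrite <- (T_comp (s := s)) by lra. rewrite T_back, Q_ker, T_back by (try apply back_ker; lra).
    auto.
Qed.

Lemma back_id t x : 1 <= t -> P t x = bzero -> back t t x = x.
Proof. intros H Hx. apply back_unique; auto; try lra. rewrite T_id, Q_ker; auto. Qed.

(** With [s = 1] this turns the dependence of [back] on its first time into an orbit of the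
    evolution family, which is continuous. *)
Lemma T_back_part t s u x : 1 <= s -> s <= t <= u -> T t s (back s u x) = back t u x.
Proof.
  intros H1 H2. symmetry. apply back_unique; try lra.
  - rewrite P_T, back_ker by lra. apply T_zero; lra.
  - rewrite T_comp by lra. apply T_back; lra.
Qed.

Lemma back_e tau t x : 1 <= tau <= t -> nt tau (back tau t x) <= D * (e tau / e t) * nt t x.
Proof.
  intro H. rewrite <- e_ratio by auto. apply unstable; auto.
  - apply back_ker; auto.
  - apply T_back; auto.
Qed.

Lemma back_1 tau t x : 1 <= tau <= t -> nt tau (back tau t x) <= D * nt t x.
Proof.
  intro H. eapply Rle_trans; [apply back_e; auto|].
  pose proof (e_ratio_le1 H). assert (0 <= nt t x) by (apply nt_nonneg; lra).
  apply Rmult_le_compat_r; auto. rewrite <- (Rmult_1_r D) at 2. apply Rmult_le_compat_l; lra.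
Qed.

(* On ker P(s) the operator T(t,s) factors as T(t,1) after the backward operator. *)
Lemma T_bounded t : 1 <= t ->
  exists K, 0 < K /\ forall s x, 1 <= s <= t -> bnorm (T t s x) <= K * bnorm x.
Proof.
  intro Ht. destruct ev as [E1 _]. destruct (E1 t 1 ltac:(lra)) as [_ [K0 HK0]].
  set (K1 := Rabs K0). assert (HK1 : 0 <= K1) by apply Rabs_pos.
  pose proof (cnt_pos t) as Hc.
  assert (HDc : 0 < D * cnt t) by (apply Rmult_lt_0_compat; auto).
  exists (D * cnt t + K1 * (D * cnt t)). split; [nra|].
  intros s x Hs.
  assert (Hns : nt s x <= cnt t * bnorm x).
  { eapply Rle_trans; [apply nt_le; lra|]. apply Rmult_le_compat_r; [apply bnorm_nonneg|].
    apply cnt_mono; auto. }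
  replace (T t s x) with (T t s (P s x) [+] T t 1 (back 1 s x)).
  2:{ rewrite <- (@T_comp t s 1) by lra. rewrite T_back by lra. rewrite <- T_add by auto.
      f_equal. unfold Qop. vring. }
  eapply Rle_trans; [apply bnorm_triangle|]. rewrite Rmult_plus_distr_r.
  apply Rplus_le_compat.
  - eapply Rle_trans; [apply (bnorm_le_nt _ Ht)|]. eapply Rle_trans; [apply stable_1; auto|].
    rewrite Rmult_assoc. apply Rmult_le_compat_l; lra.
  - eapply Rle_trans; [apply HK0|].
    apply Rle_trans with (K1 * bnorm (back 1 s x)).
    + apply Rmult_le_compat_r; [apply bnorm_nonneg | apply Rle_abs].
    + rewrite Rmult_assoc. apply Rmult_le_compat_l; auto.
      eapply Rle_trans; [apply (@bnorm_le_nt 1); lra|].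
      eapply Rle_trans; [apply back_1; lra|].
      rewrite Rmult_assoc. apply Rmult_le_compat_l; lra.
Qed.

Definition kernel (t s : R) (x : X) : X := / s [*] T t s x.

(* T(t,s')x - T(t,s)x = T(t,s')(x - T(s',s)x) for s <= s', so continuity of T(.,s)x at s and
   the uniform bound give continuity from the right. *)
Lemma kernel_right_cont t x : 1 <= t -> right_cont (fun s => kernel t s x) 1 t.
Proof.
  intros Ht s Hs eps He. destruct (T_bounded Ht) as [K [HK HT]].
  destruct ev as (_ & _ & _ & E4).
  destruct (E4 s x ltac:(lra) s ltac:(lra) (eps / (2 * K))) as [d [Hd H]];
    [apply Rdiv_lt_0_compat; lra|].
  set (b := bnorm (T t s x)). assert (Hb : 0 <= b) by apply bnorm_nonneg.
  (* Pays for the scalar factor: reciprocals of numbers at least 1 differ by at most the distance of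
     the numbers. *)
  set (d' := eps / (2 * (b + 1))).
  assert (Hd' : 0 < d') by (apply Rdiv_lt_0_compat; lra).
  exists (Rmin d d'). split; [apply Rmin_pos; auto|].
  intros s' Hs' Hlt. pose proof (Rmin_l d d'). pose proof (Rmin_r d d').
  assert (Hinv : 0 < / s' <= 1).
  { split; [apply Rinv_0_lt_compat; lra|]. rewrite <- Rinv_1. apply Rinv_le_contravar; lra. }
  assert (Hinv0 : 0 < / s <= 1).
  { split; [apply Rinv_0_lt_compat; lra|]. rewrite <- Rinv_1. apply Rinv_le_contravar; lra. }
  assert (Hx : bnorm (T t s' x [-] T t s x) <= eps / 2).
  { replace (T t s' x [-] T t s x) with (T t s' (x [-] T s' s x)).
    - eapply Rle_trans; [apply HT; lra|].
      specialize (H s' ltac:(lra)). rewrite Rabs_pos_eq in H by lra.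
      specialize (H ltac:(lra)). rewrite T_id in H by lra. rewrite bdist_sym in H.
      unfold bdist in H.
      apply Rle_trans with (K * (eps / (2 * K))); [apply Rmult_le_compat_l; lra|].
      right; field; lra.
    - rewrite T_add, T_opp, T_comp by lra. auto. }
  assert (Hy : Rabs (/ s' - / s) * b <= eps / 2).
  { assert (Rabs (/ s' - / s) <= d').
    { replace (/ s' - / s) with (- ((s' - s) * (/ s' * / s))) by (field; lra).
      rewrite Rabs_Ropp, Rabs_pos_eq.
      - assert (/ s' * / s <= 1 * 1) by (apply Rmult_le_compat; lra).
        assert (0 <= / s' * / s) by (apply Rmult_le_pos; lra). nra.
      - apply Rmult_le_pos; [lra|]. apply Rmult_le_pos; lra. }
    apply Rle_trans with (d' * (b + 1)).
    - apply Rmult_le_compat; auto; [apply Rabs_pos | lra].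
    - unfold d'. right; field; lra. }
  unfold bdist, kernel.
  replace (/ s' [*] T t s' x [-] / s [*] T t s x) with
    (/ s' [*] (T t s' x [-] T t s x) [+] (/ s' - / s) [*] T t s x) by vring.
  eapply Rle_trans; [apply bnorm_triangle|]. rewrite !bnorm_scal.
  rewrite (Rabs_pos_eq (/ s')) by lra. fold b.
  pose proof (bnorm_nonneg _ (T t s' x [-] T t s x)). nra.
Qed.

(** * The bounded solution *)

Variable y : R -> X.
Hypothesis y_int : forall a b, 1 <= a <= b -> exists v, BInt y a b v.
Variable M : R.
Hypothesis M_nonneg : 0 <= M.
Hypothesis y_unit : forall t, 1 <= t ->
  exists I, LInt (fun s => nt s (y s)) t (t + 1) I /\ I <= M.

Definition V (t tau : R) : X :=
  epsilon (inhabits bzero) (fun v => exists S, Integ (fun s => kernel t s (y s)) tau t v S).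

Lemma V_Integ t tau : 1 <= tau <= t ->
  exists S, Integ (fun s => kernel t s (y s)) tau t (V t tau) S.
Proof.
  intro H. unfold V. apply epsilon_spec.
  destruct (y_int H) as [v Hv]. destruct (BInt_Integ Hv) as [S HS].
  destruct (@T_bounded t) as [K [HK HT]]; [lra|].
  destruct (@Integ_operator X y tau t v S (kernel t) K HK HS) as [v' [S' H']].
  - intros s Hs x x'. unfold kernel. rewrite T_add by lra. apply bscal_distr_l.
  - intros s Hs r x. unfold kernel. rewrite T_scal by lra. vring.
  - intros s Hs x. unfold kernel. rewrite bnorm_scal.
    assert (0 < / s <= 1).
    { split; [apply Rinv_0_lt_compat; lra|]. rewrite <- Rinv_1. apply Rinv_le_contravar; lra. }
    rewrite Rabs_pos_eq by lra. specialize (HT s x ltac:(lra)).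
    pose proof (bnorm_nonneg _ (T t s x)). nra.
  - intros x s Hs eps He. destruct (@kernel_right_cont t x ltac:(lra) s ltac:(lra) eps He) as [d Hd].
    exists d. auto.
  - eauto.
Qed.

Lemma V_refl t : 1 <= t -> V t t = bzero.
Proof.
  intro H. destruct (@V_Integ t t) as [S HS]; [lra|].
  apply (fun H => Integ_unique (S' := 0) HS H). apply (Integ_ext (f := fun _ => bzero)); [intros; lra|].
  apply Integ_zero; lra.
Qed.

(** On [tau,s] the kernel of [t] is T(t,s) applied to the kernel of [s]; the bounded operator leaves
    the integral, and concatenation with [s,t] and uniqueness finish. *)
Lemma V_comp t s tau : 1 <= tau -> tau <= s <= t -> V t tau = T t s (V s tau) [+] V t s.
Proof.
  intros H1 H2.
  destruct (@V_Integ t tau) as [S HS]; [lra|]. destruct (@V_Integ s tau) as [S1 HS1]; [lra|].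
  destruct (@V_Integ t s) as [S2 HS2]; [lra|].
  destruct (@T_bounded t) as [K [HK HT]]; [lra|].
  assert (HI : Integ (fun r => kernel t r (y r)) tau s (T t s (V s tau)) (K * S1)).
  { apply (Integ_ext (f := fun r => T t s (kernel s r (y r)))).
    - intros r Hr. unfold kernel. rewrite T_scal, T_comp by lra. auto.
    - apply Integ_map; auto; intros.
      + apply T_add; lra.
      + apply T_scal; lra.
      + apply HT; lra. }
  apply (Integ_unique HS (Integ_concat HI HS2)).
Qed.

(** Serves both for [P t] and for [back tau t]. The integral of s -> nt s (y s) may be known only on
    a larger interval [a,c], so the left integrand is extended by zero to it. The bound [K] in the
    original norm secures the integral; the estimate itself uses the dichotomy constant and 1/s <=
    1/tau. *)
Lemma V_estimate (A : X -> X) K r t tau a c (I : RB) S : 1 <= r -> 1 <= tau <= t ->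
  1 <= a <= tau -> t <= c -> 0 < K ->
  (forall x x', A (x [+] x') = A x [+] A x') -> (forall q x, A (q [*] x) = q [*] A x) ->
  (forall x, bnorm (A x) <= K * bnorm x) ->
  (forall s, tau <= s <= t -> nt r (A (T t s (y s))) <= D * nt s (y s)) ->
  Integ (fun s => nt s (y s) : RB) a c I S ->
  nt r (A (V t tau)) <= D / tau * I.
Proof.
  intros Hr Ht Ha Hc HK Aadd Ascal Abd Hpt HI.
  destruct (@V_Integ t tau Ht) as [S1 HS1].
  assert (H1 := Integ_map HK Aadd Ascal Abd HS1).
  pose (f := fun s => if Rlt_dec tau s then if Rlt_dec s t then A (kernel t s (y s)) else bzero
                      else bzero).
  assert (H2 : Integ f a c (A (V t tau)) (K * S1)).
  { apply (fun Ha Hc H0 Hout => Integ_extend (f := fun s => A (kernel t s (y s))) Ha Hc H0 Hout H1); auto.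
    - lra.
    - intros s Hs. unfold f. destruct (Rlt_dec tau s), (Rlt_dec s t); auto; lra.
    - intros s Hs. unfold f. destruct (Rlt_dec tau s), (Rlt_dec s t); auto; lra. }
  assert (Hq : 0 < D / tau) by (apply Rdiv_lt_0_compat; lra).
  assert (H3 : Integ (fun s => D / tau * nt s (y s) : RB) a c (D / tau * I : RB) (D / tau * S)).
  { apply (@Integ_map RB RB (fun x : RB => (D / tau * x : R) : RB) (D / tau)); auto.
    - intros; simpl; ring.
    - intros; simpl; ring.
    - intro x. simpl. rewrite Rabs_mult, (Rabs_pos_eq (D / tau)); lra. }
  apply (@Integ_le X (nt r) (cnt r) (fun x x' => nt_add x x' Hr) (fun q x => nt_scal q x Hr)
    (cnt_pos r) (fun x => nt_le x Hr) _ _ _ _ _ _ _ _ H2 H3).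
  intros s Hs. unfold f.
  assert (Hn : 0 <= nt s (y s)) by (apply nt_nonneg; lra).
  destruct (Rlt_dec tau s); [destruct (Rlt_dec s t)|];
    try (rewrite nt_zero by auto; apply Rmult_le_pos; lra).
  unfold kernel. rewrite Ascal, nt_scal by auto.
  assert (0 < / s) by (apply Rinv_0_lt_compat; lra).
  assert (/ s <= / tau) by (apply Rinv_le_contravar; lra).
  rewrite Rabs_pos_eq by lra.
  apply Rle_trans with (/ tau * (D * nt s (y s))).
  - apply Rmult_le_compat; try lra; auto. apply nt_nonneg; auto. apply Hpt; lra.
  - right. unfold Rdiv. simpl. ring.
Qed.

Definition W (tau t : R) : X := back tau t (V t tau).

Lemma PV_estimate t tau a c (I : RB) S : 1 <= tau <= t -> 1 <= a <= tau -> t <= c ->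
  Integ (fun s => nt s (y s) : RB) a c I S -> nt t (P t (V t tau)) <= D / tau * I.
Proof.
  intros Ht Ha Hc HI.
  apply (@V_estimate (P t) (D * cnt t) t t tau a c I S); auto; try lra.
  - apply Rmult_lt_0_compat; auto. apply cnt_pos.
  - intros; apply P_add; lra.
  - intros; apply P_scal; lra.
  - apply (@bound_by_nt (P t) t t D); try lra. intro; apply P_nt; lra.
  - intros s Hs. rewrite P_T by lra. apply stable_1; lra.
Qed.

Lemma W_estimate t tau a c (I : RB) S : 1 <= tau <= t -> 1 <= a <= tau -> t <= c ->
  Integ (fun s => nt s (y s) : RB) a c I S -> nt tau (W tau t) <= D / tau * I.
Proof.
  intros Ht Ha Hc HI.
  apply (@V_estimate (back tau t) (D * cnt t) tau t tau a c I S); auto; try lra.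
  - apply Rmult_lt_0_compat; auto. apply cnt_pos.
  - intros; apply back_add; lra.
  - intros; apply back_scal; lra.
  - apply (@bound_by_nt (back tau t) tau t D); try lra. intro; apply back_1; lra.
  - intros s Hs. rewrite back_T by lra. apply back_1; lra.
Qed.

Lemma unit_estimate t tau : 1 <= tau <= t -> t <= tau + 1 ->
  nt t (P t (V t tau)) <= D / tau * M /\ nt tau (W tau t) <= D / tau * M.
Proof.
  intros Ht Ht1. destruct (@y_unit tau) as [I [HI HM]]; [lra|].
  destruct (@BInt_Integ RB (fun s => nt s (y s)) tau (tau + 1) I HI) as [S HS].
  assert (Hq : 0 < D / tau) by (apply Rdiv_lt_0_compat; lra).
  assert (D / tau * I <= D / tau * M) by (apply Rmult_le_compat_l; lra).
  split; (eapply Rle_trans; [|apply H]).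
  - apply (@PV_estimate t tau tau (tau + 1) I S); auto; lra.
  - apply (@W_estimate t tau tau (tau + 1) I S); auto; lra.
Qed.

(** Absolute continuity of the integral of s -> nt s (y s) makes both parts small on short intervals
    around [t0]; continuity of the solution rests on this. *)
Lemma local_estimate t0 eps : 1 <= t0 -> 0 < eps ->
  exists delta, 0 < delta /\ forall tau t, 1 <= tau <= t -> t0 - delta < tau -> t < t0 + delta ->
    nt t (P t (V t tau)) <= eps /\ nt tau (W tau t) <= eps.
Proof.
  (* A window [r, r + 1] inside the half-line that contains all points of it within 1/2 of [t0]. *)
  intros Ht0 He. set (r := Rmax 1 (t0 - 1 / 2)).
  assert (Hr : 1 <= r /\ r <= t0 /\ t0 - 1 / 2 <= r /\ (r = 1 \/ r = t0 - 1 / 2))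
    by (unfold r, Rmax; destruct Rle_dec; lra).
  destruct (@y_unit r) as [I [HI _]]; [lra|].
  destruct (@BInt_Integ RB (fun s => nt s (y s)) r (r + 1) I HI) as [S HS].
  destruct (@Integ_restrict_small RB (fun s => nt s (y s)) r (r + 1) I S (eps / D) HS)
    as [d [Hd H]]; [apply Rdiv_lt_0_compat; lra|].
  exists (Rmin (1 / 2) (d / 2)). split; [apply Rmin_pos; lra|].
  intros tau t Ht H1 H2. pose proof (Rmin_l (1 / 2) (d / 2)). pose proof (Rmin_r (1 / 2) (d / 2)).
  destruct (H tau t) as [I' [HI' Hn]]; try lra.
  assert (Hb : D / tau * I' <= eps).
  { assert (/ tau <= 1) by (rewrite <- Rinv_1; apply Rinv_le_contravar; lra).
    assert (0 < / tau) by (apply Rinv_0_lt_compat; lra).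
    change (Rabs I' <= eps / D) in Hn. pose proof (Rle_abs I'). pose proof (Rabs_pos I').
    apply Rle_trans with (D * (eps / D)); [|right; field; lra].
    apply Rle_trans with (D * Rabs I'); [|apply Rmult_le_compat_l; lra].
    unfold Rdiv. rewrite Rmult_assoc. apply Rmult_le_compat_l; [lra|]. simpl in *. nra. }
  split; (eapply Rle_trans; [|apply Hb]).
  - apply (@PV_estimate t tau tau t I' S); auto; lra.
  - apply (@W_estimate t tau tau t I' S); auto; lra.
Qed.

(** * Cocycle identities and uniform bounds by telescoping *)

Lemma W_comp tau s t : 1 <= tau -> tau <= s <= t -> W tau t = W tau s [+] back tau s (W s t).
Proof.
  intros H1 H2. unfold W. rewrite (V_comp H1 H2), back_add, back_T, back_back by lra. auto.
Qed.

Lemma W_refl t : 1 <= t -> W t t = bzero.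
Proof.
  intro H. unfold W. rewrite V_refl by auto. apply back_id; auto. apply P_zero; auto.
Qed.

Lemma PV_comp t s tau : 1 <= tau -> tau <= s <= t ->
  P t (V t tau) = T t s (P s (V s tau)) [+] P t (V t s).
Proof. intros H1 H2. rewrite (V_comp H1 H2), P_add, P_T by lra. auto. Qed.

(** D M bounds a piece of length at most one that stays in place, D^2 M a piece that is transported
    once more by the dichotomy. *)
Definition K1 : R := D * M + D * D * M.

Lemma K1_nonneg : 0 <= K1 /\ D * M <= K1 /\ D * D * M <= K1.
Proof.
  unfold K1. assert (0 <= D * M) by (apply Rmult_le_pos; lra).
  assert (0 <= D * D * M) by (apply Rmult_le_pos; [nra|lra]). lra.
Qed.

Lemma unit_estimate_K1 t tau : 1 <= tau <= t -> t <= tau + 1 ->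
  nt t (P t (V t tau)) <= K1 /\ nt tau (W tau t) <= K1.
Proof.
  intros H H1. pose proof K1_nonneg. destruct (unit_estimate H H1) as [Q1 Q2].
  assert (D / tau * M <= D * M); [|lra].
  unfold Rdiv. rewrite Rmult_assoc. apply Rmult_le_compat_l; [lra|].
  assert (/ tau <= 1) by (rewrite <- Rinv_1; apply Rinv_le_contravar; lra).
  assert (0 < / tau) by (apply Rinv_0_lt_compat; lra). nra.
Qed.

Lemma nat_floor x : 0 <= x -> exists n, INR n <= x <= INR n + 1.
Proof.
  intro Hx. destruct (INR_unbounded x) as [m Hm].
  assert (forall m, x < INR m -> exists n, INR n <= x <= INR n + 1); [|eauto].
  induction m0; intro H; [simpl in H; lra|].
  destruct (Rlt_dec x (INR m0)) as [Hc|Hc]; auto. exists m0. rewrite S_INR in H. lra.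
Qed.

(** Adding a piece that starts at r + 1 costs D^2 M / (r + 1) times [e tau / e (r + 1)]. By
    [e_growth] this is at most K1 / lam times a difference of consecutive values of [e tau / e], and
    those differences sum to at most 1. *)
Lemma W_bound tau t : 1 <= tau <= t -> nt tau (W tau t) <= K1 * (1 + / lam).
Proof.
  intro H. assert (Htau : 1 <= tau) by lra.
  destruct (@nat_floor (t - tau)) as [n Hn]; [lra|].
  assert (Hil : 0 < / lam) by (apply Rinv_0_lt_compat; auto).
  pose proof K1_nonneg as HK.
  assert (Hclaim : forall n t, tau + INR n <= t <= tau + INR n + 1 ->
    nt tau (W tau t) <= K1 * (1 + / lam * (1 - e tau / e (tau + INR n)))).
  { clear n t H Hn. intro n. induction n; intros t Ht.
    - simpl INR in *. rewrite Rplus_0_r in *. pose proof (e_pos tau).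
      replace (e tau / e tau) with 1 by (field; lra).
      replace (K1 * (1 + / lam * (1 - 1))) with K1 by ring. apply unit_estimate_K1; lra.
    - rewrite S_INR in *. pose proof (pos_INR n). set (r := tau + INR n) in *.
      replace (tau + (INR n + 1)) with (r + 1) in * by (unfold r; ring).
      assert (Hr : tau <= r) by (unfold r; lra).
      destruct (unit_estimate (t := t) (tau := r + 1)) as [_ Hu]; try lra.
      specialize (IHn (r + 1) ltac:(unfold r; lra)).
      rewrite (@W_comp tau (r + 1) t) by lra.
      eapply Rle_trans; [apply nt_add; lra|].
      pose proof (@back_e tau (r + 1) (W (r + 1) t) ltac:(lra)) as Hb.
      pose proof (e_pos r) as P1. pose proof (e_pos (r + 1)) as P2. pose proof (e_pos tau) as P3.
      assert (Hr0 : 0 <= e tau / e (r + 1)) by (left; apply Rdiv_lt_0_compat; auto).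
      assert (HD0 : 0 <= D * (e tau / e (r + 1))) by (apply Rmult_le_pos; lra).
      assert (Hs : nt tau (back tau (r + 1) (W (r + 1) t)) <=
                   K1 * (/ (r + 1) * (e tau / e (r + 1)))).
      { eapply Rle_trans; [apply Hb|].
        apply Rle_trans with (D * (e tau / e (r + 1)) * (D / (r + 1) * M));
          [apply Rmult_le_compat_l; auto|].
        replace (D * (e tau / e (r + 1)) * (D / (r + 1) * M)) with
          (D * D * M * (/ (r + 1) * (e tau / e (r + 1)))) by (field; lra).
        apply Rmult_le_compat_r; [|lra]. apply Rmult_le_pos; auto.
        left; apply Rinv_0_lt_compat; lra. }
      (* This is [e_growth] multiplied by [e tau / (lam * e r * e (r + 1))]. *)
      assert (Hg : / (r + 1) * (e tau / e (r + 1)) <= / lam * (e tau / e r - e tau / e (r + 1))).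
      { pose proof (@e_growth r ltac:(lra)) as G.
        apply Rmult_le_reg_l with (lam * e r * e (r + 1) * / e tau).
        - apply Rmult_lt_0_compat; [|apply Rinv_0_lt_compat; auto].
          apply Rmult_lt_0_compat; auto. apply Rmult_lt_0_compat; auto.
        - replace (lam * e r * e (r + 1) * / e tau * (/ (r + 1) * (e tau / e (r + 1)))) with
            (e r * (lam / (r + 1))) by (field; lra).
          replace (lam * e r * e (r + 1) * / e tau * (/ lam * (e tau / e r - e tau / e (r + 1)))) with
            (e (r + 1) - e r) by (field; lra). lra. }
      apply (Rmult_le_compat_l K1) in Hg; [|lra]. lra. }
  assert (Hpos : 0 <= e tau / e (tau + INR n))
    by (left; apply Rdiv_lt_0_compat; apply e_pos).
  eapply Rle_trans; [apply (Hclaim n t); lra|].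
  apply Rmult_le_compat_l; [lra|]. nra.
Qed.

(** Unit steps are counted backwards from [t], since the decay factors [e r / e t] refer to [t]. The
    sum of the increments [e (r + 1) - e r] stays below [e t]. *)
Lemma PV_bound tau t : 1 <= tau <= t -> nt t (P t (V t tau)) <= K1 * (1 + 3 * / lam).
Proof.
  intro H. destruct (@nat_floor (t - tau)) as [n Hn]; [lra|].
  assert (Hil : 0 < / lam) by (apply Rinv_0_lt_compat; auto).
  pose proof K1_nonneg as HK. pose proof (e_pos t) as Pt.
  assert (Hclaim : forall n tau, 1 <= tau -> t - INR n - 1 <= tau <= t - INR n ->
    nt t (P t (V t tau)) <= K1 * (1 + 3 * / lam * ((e t - e (t - INR n)) / e t))).
  { clear n tau H Hn. intro n. induction n; intros tau H1 Ht.
    - simpl INR in *. rewrite Rminus_0_r in *.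
      replace ((e t - e t) / e t) with 0 by (field; lra).
      replace (K1 * (1 + 3 * / lam * 0)) with K1 by ring. apply unit_estimate_K1; lra.
    - rewrite S_INR in *. pose proof (pos_INR n). set (r := t - (INR n + 1)) in *.
      replace (t - INR n) with (r + 1) in * by (unfold r; ring).
      destruct (unit_estimate (t := r) (tau := tau)) as [Hu _]; try lra.
      assert (Hrt : r <= t) by (unfold r; lra).
      specialize (IHn r ltac:(lra) ltac:(lra)).
      rewrite (@PV_comp t r tau) by lra.
      eapply Rle_trans; [apply nt_add; lra|].
      (* Idempotence exposes a projection, so that the stable estimate applies while the unit
         estimate is still available for the inner vector. *)
      replace (P r (V r tau)) with (P r (P r (V r tau))) by (apply P_proj; lra).
      pose proof (@stable_e t r (P r (V r tau)) ltac:(lra)) as Hb.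
      pose proof (e_pos r) as P1. pose proof (e_pos (r + 1)) as P2.
      assert (Hr0 : 0 <= e r / e t) by (left; apply Rdiv_lt_0_compat; auto).
      assert (HD0 : 0 <= D * (e r / e t)) by (apply Rmult_le_pos; lra).
      (* The factor 3: the piece [tau, r] has length at most one and [tau >= 1], so r + 1 <= tau + 2
         <= 3 tau. *)
      assert (Hinv : / tau <= 3 * / (r + 1)).
      { replace (3 * / (r + 1)) with (/ ((r + 1) / 3)) by (field; lra).
        apply Rinv_le_contravar; lra. }
      assert (Hs : nt t (T t r (P r (P r (V r tau)))) <= K1 * (3 * (/ (r + 1) * (e r / e t)))).
      { eapply Rle_trans; [apply Hb|].
        apply Rle_trans with (D * (e r / e t) * (D / tau * M));
          [apply Rmult_le_compat_l; auto|].
        replace (D * (e r / e t) * (D / tau * M)) with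
          (D * D * M * (/ tau * (e r / e t))) by (field; lra).
        apply Rmult_le_compat; try lra.
        - apply Rmult_le_pos; [apply Rmult_le_pos|]; lra.
        - apply Rmult_le_pos; auto. left; apply Rinv_0_lt_compat; lra.
        - rewrite <- Rmult_assoc. apply Rmult_le_compat_r; auto. }
      assert (Hg : 3 * (/ (r + 1) * (e r / e t)) <= 3 * / lam * ((e (r + 1) - e r) / e t)).
      { pose proof (@e_growth r ltac:(lra)) as G.
        apply Rmult_le_reg_l with (lam * e t / 3).
        - apply Rmult_lt_0_compat; [|lra]. apply Rmult_lt_0_compat; auto.
        - replace (lam * e t / 3 * (3 * (/ (r + 1) * (e r / e t)))) with
            (e r * (lam / (r + 1))) by (field; lra).
          replace (lam * e t / 3 * (3 * / lam * ((e (r + 1) - e r) / e t))) with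
            (e (r + 1) - e r) by (field; lra). lra. }
      apply (Rmult_le_compat_l K1) in Hg; [|lra].
      replace (K1 * (1 + 3 * / lam * ((e t - e r) / e t))) with
        (K1 * (3 * / lam * ((e (r + 1) - e r) / e t)) +
         K1 * (1 + 3 * / lam * ((e t - e (r + 1)) / e t))) by (field; lra).
      lra. }
  eapply Rle_trans; [apply (Hclaim n tau); lra|].
  apply Rmult_le_compat_l; [lra|].
  assert ((e t - e (t - INR n)) / e t <= 1).
  { apply Rmult_le_reg_r with (e t); auto. unfold Rdiv. rewrite Rmult_assoc, Rinv_l by lra.
    pose proof (e_pos (t - INR n)). lra. }
  nra.
Qed.

(** * The limit of the pull-backs *)

Definition K2 : R := D * (K1 * (1 + / lam)).

(** The increment is the pull-back from [t] of [W t t'], which is bounded uniformly in [t']; the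
    backward decay supplies the factor. *)
Lemma W_diff tau t t' : 1 <= tau -> tau <= t <= t' ->
  nt tau (W tau t' [-] W tau t) <= K2 * (e tau / e t).
Proof.
  intros H1 H2. rewrite (W_comp H1 H2).
  match goal with |- nt _ (?a [+] ?b [-] ?a) <= _ => replace (a [+] b [-] a) with b by vring end.
  eapply Rle_trans; [apply back_e; lra|].
  pose proof (@W_bound t t' ltac:(lra)).
  assert (0 <= D * (e tau / e t)).
  { apply Rmult_le_pos; [lra|]. left; apply Rdiv_lt_0_compat; apply e_pos. }
  unfold K2. replace (D * (K1 * (1 + / lam)) * (e tau / e t)) with
    (D * (e tau / e t) * (K1 * (1 + / lam))) by ring.
  apply Rmult_le_compat_l; auto.
Qed.

(** The improper Green integral of T(tau,s)Q(s)y(s)/s over [tau,oo). The limit is taken along tau +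
    n because completeness speaks of sequences. *)
Definition z (tau : R) : X := epsilon (inhabits bzero) (fun l =>
  forall eps, 0 < eps -> exists N, forall n, (N <= n)%nat -> bdist (W tau (tau + INR n)) l < eps).

Lemma z_lim tau eps : 1 <= tau -> 0 < eps ->
  exists N, forall n, (N <= n)%nat -> bdist (W tau (tau + INR n)) (z tau) < eps.
Proof.
  intro Ht. revert eps. unfold z. apply epsilon_spec. apply bcomplete. intros eps He.
  destruct (@e_decay tau K2 (eps / 3) Ht) as [t0 [Ht0 Hd]]; [lra|].
  destruct (INR_unbounded t0) as [N HN]. exists N.
  assert (Hone : forall n, (N <= n)%nat ->
     bdist (W tau (tau + INR n)) (W tau (tau + INR N)) <= eps / 3).
  { intros n Hn. apply le_INR in Hn. pose proof (pos_INR N).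
    eapply Rle_trans; [apply (bnorm_le_nt _ Ht)|].
    eapply Rle_trans; [apply W_diff; lra|]. apply Hd; lra. }
  intros n m Hn Hm. pose proof (Hone n Hn). pose proof (Hone m Hm).
  change (bdist (W tau (tau + INR n)) (W tau (tau + INR m)) < eps).
  pose proof (bdist_triangle (W tau (tau + INR N)) (W tau (tau + INR n)) (W tau (tau + INR m))).
  rewrite (bdist_sym (W tau (tau + INR N)) (W tau (tau + INR m))) in H1. lra.
Qed.

(** [W_diff] in the limit. Convergence holds in the original norm, and passing to [nt tau] costs the
    factor [cnt tau], which is fixed because [tau] is. *)
Lemma z_W tau t : 1 <= tau <= t -> nt tau (z tau [-] W tau t) <= K2 * (e tau / e t).
Proof.
  intro H. apply le_epsilon. intros eps He. pose proof (cnt_pos tau) as Hc.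
  destruct (@z_lim tau (eps / cnt tau)) as [N HN]; [lra | apply Rdiv_lt_0_compat; lra|].
  destruct (INR_unbounded t) as [m Hm]. set (n := Nat.max N m).
  specialize (HN n ltac:(lia)). assert (Hn : INR m <= INR n) by (apply le_INR; lia).
  replace (z tau [-] W tau t) with
    ((z tau [-] W tau (tau + INR n)) [+] (W tau (tau + INR n) [-] W tau t)) by vring.
  eapply Rle_trans; [apply nt_add; lra|].
  assert (nt tau (z tau [-] W tau (tau + INR n)) <= eps).
  { eapply Rle_trans; [apply nt_le; lra|]. rewrite bdist_sym in HN. unfold bdist in HN.
    apply Rle_trans with (cnt tau * (eps / cnt tau)); [apply Rmult_le_compat_l; lra|].
    right; field; lra. }
  assert (nt tau (W tau (tau + INR n) [-] W tau t) <= K2 * (e tau / e t)) by (apply W_diff; lra).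
  lra.
Qed.

(** The identity [W_comp] with last time u tending to infinity; both errors carry a factor
    [1 / e u]. *)
Lemma z_comp tau t : 1 <= tau <= t -> z tau = W tau t [+] back tau t (z t).
Proof.
  intro H. apply bsub_eq0. apply (@nt_eq0 tau); [lra|].
  apply Rle_antisym; [|apply nt_nonneg; lra]. apply le_epsilon. intros eps He.
  destruct (@e_decay tau K2 (eps / 2)) as [t1 [Ht1 H1]]; try lra.
  destruct (@e_decay t (D * K2) (eps / 2)) as [t2 [Ht2 H2]]; try lra.
  set (u := Rmax t1 t2).
  assert (Hu1 : t1 <= u) by apply Rmax_l. assert (Hu2 : t2 <= u) by apply Rmax_r.
  specialize (H1 u Hu1). specialize (H2 u Hu2).
  replace (z tau [-] (W tau t [+] back tau t (z t))) with
    ((z tau [-] W tau u) [-] back tau t (z t [-] W t u)).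
  2:{ rewrite (@W_comp tau t u) by lra. rewrite back_add, back_opp by lra. vring. }
  eapply Rle_trans; [apply nt_add; lra|]. rewrite nt_opp by lra.
  pose proof (@z_W tau u ltac:(lra)).
  pose proof (@back_1 tau t (z t [-] W t u) ltac:(lra)).
  pose proof (@z_W t u ltac:(lra)).
  apply (Rmult_le_compat_l D) in H4; [|lra]. lra.
Qed.

Lemma z_ker t : 1 <= t -> P t (z t) = bzero.
Proof.
  intro H. rewrite (@z_comp t t) by lra. rewrite W_refl, badd_0l by auto. apply back_ker; lra.
Qed.

Lemma z_bound t : 1 <= t -> nt t (z t) <= K2.
Proof.
  intro H. pose proof (@z_W t t ltac:(lra)) as Hz. rewrite W_refl in Hz by auto.
  pose proof (e_pos t). replace (e t / e t) with 1 in Hz by (field; lra).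
  replace (z t [-] bzero) with (z t) in Hz by vring. lra.
Qed.

(** * The solution: equation, boundedness, continuity, uniqueness *)

Definition sol (t : R) : X := P t (V t 1) [-] z t.

(** T(t,tau) undoes [back tau t] up to Q(t), so it sends z(tau) to Q(t)V(t,tau) + z(t). This Q-part
    and the P-part of the cocycle identity add up to V(t,tau). *)
Lemma sol_mild t tau : 1 <= tau <= t -> sol t = T t tau (sol tau) [+] V t tau.
Proof.
  intro H. unfold sol. rewrite (@PV_comp t tau 1) by lra.
  rewrite T_add, T_opp by auto. rewrite (@z_comp tau t) by auto.
  rewrite T_add by auto. unfold W. rewrite !T_back by auto.
  rewrite (Q_ker (z_ker (t := t) ltac:(lra))). unfold Qop. vring.
Qed.

Lemma sol_bound t : 1 <= t -> nt t (sol t) <= K1 * (1 + 3 * / lam) + K2.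
Proof.
  intro H. unfold sol. eapply Rle_trans; [apply nt_add; auto|]. rewrite nt_opp by auto.
  apply Rplus_le_compat; [apply PV_bound; lra | apply z_bound; auto].
Qed.

(** The stable part vanishes at time 1, where the interval of integration is a point. *)
Lemma sol_start : exists u, sol 1 = Qop P 1 u.
Proof.
  exists (bopp (z 1)). unfold sol, Qop. rewrite V_refl, P_zero, P_opp, z_ker by lra. vring.
Qed.

(** A function uniformly close near [t0] to one continuous at [t0]. Continuity of [q] is asked only
    within [delta], since the comparison function for [z] is meaningful only before a time slightly
    later than [t0]. *)
Lemma cont_close (g q : R -> X) t0 delta eps : 1 <= t0 -> 0 < delta -> 0 < eps ->
  (forall eta, 0 < eta -> exists d, 0 < d /\ forall t, 1 <= t -> Rabs (t - t0) < d ->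
     t0 - delta < t < t0 + delta -> bdist (q t) (q t0) < eta) ->
  (forall t, 1 <= t -> t0 - delta < t < t0 + delta -> bdist (g t) (q t) <= eps / 4) ->
  exists d, 0 < d /\ forall t, 1 <= t -> Rabs (t - t0) < d -> bdist (g t) (g t0) < eps.
Proof.
  intros Ht0 Hd He Hq Hg. destruct (Hq (eps / 4)) as [d [Hd' H]]; [lra|].
  exists (Rmin d delta). split; [apply Rmin_pos; auto|]. intros t Ht Hlt.
  pose proof (Rmin_l d delta). pose proof (Rmin_r d delta).
  assert (t0 - delta < t < t0 + delta) by (apply Rabs_def2 in Hlt; lra).
  specialize (H t Ht ltac:(lra) H2). pose proof (Hg t Ht H2). pose proof (Hg t0 Ht0 ltac:(lra)).
  pose proof (bdist_triangle (q t) (g t) (g t0)).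
  pose proof (bdist_triangle (q t0) (q t) (g t0)). rewrite (bdist_sym (q t0) (g t0)) in H6. lra.
Qed.

(** From a time [r] slightly before [t0] the stable part is the orbit of a fixed vector plus a
    contribution from a short interval. *)
Lemma PV_cont : cont_from 1 (fun t => P t (V t 1)).
Proof.
  intros t0 Ht0 eps He. destruct (@local_estimate t0 (eps / 4) Ht0) as [d [Hd H]]; [lra|].
  set (r := Rmax 1 (t0 - d / 2)).
  assert (Hr : 1 <= r <= t0 /\ t0 - d < r /\ (r = 1 \/ r = t0 - d / 2))
    by (unfold r, Rmax; destruct Rle_dec; lra).
  assert (Hcut : forall t, 1 <= t -> t0 - d / 2 < t < t0 + d / 2 -> r <= t)
    by (intros t H1 H2; destruct Hr as (?&?&[E|E]); lra).
  apply (@cont_close (fun t => P t (V t 1)) (fun t => T t r (P r (V r 1))) t0 (d / 2) eps); auto; try lra.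
  - intros eta Heta. destruct ev as (_ & _ & _ & E4).
    destruct (E4 r (P r (V r 1)) ltac:(lra) t0 ltac:(lra) eta Heta) as [d' [Hd' Hc]].
    exists d'. split; auto.
  - intros t Ht Hin. pose proof (Hcut t Ht Hin).
    rewrite (@PV_comp t r 1) by lra. unfold bdist.
    match goal with |- bnorm (?a [+] ?b [-] ?a) <= _ => replace (a [+] b [-] a) with b by vring end.
    eapply Rle_trans; [apply (bnorm_le_nt _ Ht)|]. apply (H r t); lra.
Qed.

(** The mirror image: [z] is pulled back from a time [u] slightly after [t0], up to a contribution
    from a short interval. *)
Lemma z_cont : cont_from 1 z.
Proof.
  intros t0 Ht0 eps He. destruct (@local_estimate t0 (eps / 4) Ht0) as [d [Hd H]]; [lra|].
  set (u := t0 + d / 2).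
  apply (@cont_close z (fun t => back t u (z u)) t0 (d / 2) eps); auto; try lra.
  - intros eta Heta. destruct ev as (_ & _ & _ & E4).
    destruct (E4 1 (back 1 u (z u)) ltac:(lra) t0 ltac:(lra) eta Heta) as [d' [Hd' Hc]].
    exists d'. split; auto. intros t Ht Hlt Hin.
    rewrite <- (@T_back_part t 1 u), <- (@T_back_part t0 1 u) by (unfold u; lra). apply Hc; auto.
  - intros t Ht Hin. rewrite (@z_comp t u) by (unfold u; lra). unfold bdist.
    match goal with |- bnorm (?a [+] ?b [-] ?b) <= _ => replace (a [+] b [-] b) with a by vring end.
    eapply Rle_trans; [apply (bnorm_le_nt _ Ht)|]. apply (H t u); unfold u; lra.
Qed.

Lemma sol_cont : cont_from 1 sol.
Proof.
  intros t0 Ht0 eps He.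
  destruct (@PV_cont t0 Ht0 (eps / 2)) as [d1 [Hd1 H1]]; [lra|].
  destruct (@z_cont t0 Ht0 (eps / 2)) as [d2 [Hd2 H2]]; [lra|].
  exists (Rmin d1 d2). split; [apply Rmin_pos; auto|]. intros s Hs Hlt.
  pose proof (Rmin_l d1 d2). pose proof (Rmin_r d1 d2).
  specialize (H1 s Hs ltac:(lra)). specialize (H2 s Hs ltac:(lra)).
  unfold sol. eapply Rle_lt_trans; [apply bdist_add|].
  replace (bdist (bopp (z s)) (bopp (z t0))) with (bdist (z s) (z t0)); [lra|].
  unfold bdist. rewrite <- bnorm_opp. f_equal. vring.
Qed.

Lemma sol_unique (x : R -> X) : inYZ nt P x -> mild_sol T y x -> forall t, 1 <= t -> x t = sol t.
Proof.
  intros (_ & [B HB] & [u Hu]) Hx.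
  (* The integral provided by [mild_sol] is [V t 1] by uniqueness of integrals. *)
  assert (Hmild : forall t, 1 <= t -> x t = T t 1 (x 1) [+] V t 1).
  { intros t Ht. destruct (Hx t 1 ltac:(lra)) as [v [Hv E]]. rewrite E. f_equal.
    destruct (BInt_Integ Hv) as [S HS]. destruct (@V_Integ t 1) as [S' HS']; [lra|].
    apply (Integ_unique HS HS'). }
  set (h := x 1 [-] sol 1).
  assert (Hdiff : forall t, 1 <= t -> x t [-] sol t = T t 1 h).
  { intros t Ht. rewrite (Hmild t Ht), (@sol_mild t 1) by lra. unfold h.
    rewrite T_add, T_opp by lra. vring. }
  assert (Hker : P 1 h = bzero).
  { destruct sol_start as [u' Hu']. unfold h. rewrite Hu, Hu'.
    rewrite P_add, P_opp, !P_Q by lra. vring. }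
  assert (Hh : h = bzero).
  { apply (@nt_eq0 1); [lra|]. apply Rle_antisym; [|apply nt_nonneg; lra].
    apply le_epsilon. intros eps He. rewrite Rplus_0_l.
    set (Bs := B + (K1 * (1 + 3 * / lam) + K2)).
    destruct (@e_decay 1 (D * Bs) eps) as [t [Ht H]]; try lra.
    eapply Rle_trans; [|apply (H t); lra].
    (* As [h] lies in the kernel at time 1, it is recovered from its orbit at time t. The orbit is
       bounded, so the backward decay bounds [h] by arbitrarily small numbers. *)
    assert (E : back 1 t (T t 1 h) = h).
    { rewrite back_T by lra. apply back_id; auto; lra. }
    rewrite <- E at 1. eapply Rle_trans; [apply back_e; lra|].
    assert (nt t (T t 1 h) <= Bs).
    { rewrite <- Hdiff by lra. eapply Rle_trans; [apply nt_add; lra|]. rewrite nt_opp by lra.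
      apply Rplus_le_compat; [apply HB; lra | apply sol_bound; lra]. }
    assert (0 <= D * (e 1 / e t)).
    { apply Rmult_le_pos; [lra|]. left; apply Rdiv_lt_0_compat; apply e_pos. }
    replace (D * Bs * (e 1 / e t)) with (D * (e 1 / e t) * Bs) by ring.
    apply Rmult_le_compat_l; auto. }
  intros t Ht. apply bsub_eq0. rewrite Hdiff, Hh by auto. apply T_zero; lra.
Qed.

End Dichotomy.

Theorem theorem3p1 (X : Banach) (T : R -> R -> X -> X) (nt : R -> X -> R)
  (P : R -> X -> X) :
  evolution_family T -> norm_family nt -> poly_dichotomy T nt P ->
  forall y : R -> X, inY1 nt y ->
  exists x : R -> X, inYZ nt P x /\ mild_sol T y x /\
    (forall x' : R -> X, inYZ nt P x' -> mild_sol T y x' ->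
       forall t, 1 <= t -> x' t = x t).
Proof.
  intros ev (Hn & (C & eps & HC & Heps & Heq) & _)
    (HP & HPT & Hker & lam & D & Hlam & HD & Hst & Hun) y [Hy [M HM]].
  (* The given bound is replaced by its absolute value, so that a nonnegative constant enters the
     estimates. *)
  assert (HM' : forall t, 1 <= t ->
    exists I, LInt (fun s => nt s (y s)) t (t + 1) I /\ I <= Rabs M).
  { intros t Ht. destruct (HM t Ht) as [I [HI Hle]]. exists I. split; auto.
    pose proof (Rle_abs M). lra. }
  pose proof (Rabs_pos M) as HM0.
  exists (sol T P y). split; [split; [|split]|split].
  - exact (sol_cont ev Hn HC Heps Heq HP HPT Hker Hlam HD Hst Hun Hy HM0 HM').
  - eexists. intros t Ht.
    apply (sol_bound ev Hn HC Heps Heq HP HPT Hker Hlam HD Hst Hun Hy HM0 HM' Ht).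
  - exact (sol_start ev Hn HC Heps Heq HP HPT Hker Hlam HD Hst Hun Hy HM0 HM').
  - intros t tau Ht. exists (V T y t tau). split.
    + destruct (V_Integ ev Hn HC Heps Heq HP Hker Hlam HD Hst Hun Hy Ht) as [S HS].
      (* Back from bricks with majorants to the integral of the statement. *)
      exact (Integ_BInt HS).
    + exact (sol_mild ev Hn HC Heps Heq HP HPT Hker Hlam HD Hst Hun Hy HM0 HM' Ht).
  - exact (sol_unique ev Hn HC Heps Heq HP HPT Hker Hlam HD Hst Hun Hy HM0 HM').
Qed.
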